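(* Let $T_0>0$ and let $(F,\Psi,\mathfrak{P})$ be a Wu solution on $[0,T_0]$ (as defined in the context) such that $\Sigma(t)=\{\Psi(\alpha',t) : \alpha'\in\mathbb{R}\}$ is a Jordan curve for all $t\in[0,T_0]$, thereby giving rise to a solution of the Euler equation with $(\overline{\mathbf v},P)=(F\circ\Psi^{-1},\mathfrak{P}\circ\Psi^{-1})$ on $\Omega(t)=\{\Psi(z',t) : z'\in P_-\}$. Then for every fixed $t\in[0,T_0]$, the quantities $\mathbf v(\cdot,t)$, $\mathbf v_t(\cdot,t)$, $\nabla\mathbf v(\cdot,t)=(\mathbf v_x,\mathbf v_y)(\cdot,t)$ and $\nabla P(\cdot,t)$ extend continuously to $\overline{\Omega}(t)$. Moreover the Euler equation $$\mathbf v_t+(\mathbf v\cdot\nabla)\mathbf v=-i-\nabla P$$ holds on $\overline{\Omega}(t)$, with $\nabla\mathbf v$ and $\nabla P$ vanishing at the singularities $\{Z(\alpha',t) : \alpha'\in S(t)\}\subset\Sigma(t)$, where $S(t)=\{\alpha'\in\mathbb{R} : \frac1{\Psi_{z'}}(\alpha',t)=0\}$. Hence the acceleration $\mathbf v_t+(\mathbf v\cdot\nabla)\mathbf v$ is equal to $-i$ at the singularities.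
   Context: **Notation.** Identify $\mathbb{R}^2$ with $\mathbb{C}$. $P_-=\{z'=x'+iy' : y'<0\}$ is the lower half plane, $\overline{P}_-$ its closure, with boundary $\mathbb{R}$. $\partial_{z'}=\frac12(\partial_{x'}-i\partial_{y'})$; subscripts $t,z',\alpha,\alpha'$ denote partial derivatives (except in the symbols $Z_t,Z_{tt}$, defined below). $\|\cdot\|_p$ is the $L^p(\mathbb{R})$ norm; $\|f\|_{\dot H^{1/2}}=\||\xi|^{1/2}\hat f\|_2$. $K_y(x)=\frac{-y}{\pi(x^2+y^2)}$ for $y<0$ is the Poisson kernel; $*$ is convolution in the real variable. Compositions and inverses are in the spatial variable. $f_\epsilon\Rightarrow f$ on $U$ means uniform convergence on compact subsets of $U$. $C(\cdot)$ denotes finite quantities depending only on the indicated arguments. Convention: if a function (or a product such as $\frac{1}{\Psi_{z'}}F_{z'}$) defined on $P_-$ extends continuously to $\overline{P}_-$, its value at a boundary point is that of the continuous extension. **Euler equation.** $\mathbf v_t+(\mathbf v\cdot\nabla)\mathbf v=-i-\nabla P$, $\operatorname{div}\mathbf v=0$, $\operatorname{curl}\mathbf v=0$ on $\Omega(t)$; $P=0$ on $\Sigma(t)=\partial\Omega(t)$; $(1,\mathbf v)$ is tangent to the free surface $(t,\Sigma(t))$; $\mathbf v\to0$, $\nabla P\to-i$ at infinity. Here $\mathbf v$ and $\nabla P$ are identified with complex numbers. The interface is an unbounded curve tending to the real line at infinity; ''Jordan curve'' means it does not self-intersect. **Water wave system in $P_-$.** For $F,\Psi$ complex valued and $\mathfrak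 P$ real valued: (i) $F_t-\Psi_t\frac{F_{z'}}{\Psi_{z'}}+\overline F\frac{F_{z'}}{\Psi_{z'}}=-\frac{1}{\Psi_{z'}}(\partial_{x'}-i\partial_{y'})\mathfrak P+i$ on $P_-$; (ii) $F(\cdot,t)$ holomorphic and $\Psi(\cdot,t)$ conformal on $P_-$; (iii) $\mathfrak P=0$ on $\partial P_-$; (iv) the trace of $\frac{1}{\Psi_{z'}}(\overline F-\Psi_t)$ on $\partial P_-$ is real valued; with $F\to0$, $(\partial_{x'}-i\partial_{y'})\mathfrak P\to i$, $\Psi_{z'}\to1$, $\Psi_t\to0$ as $z'\to\infty$. **Energy.** All norms are in $x'$ at height $y'$: $\mathcal E_1(t)=\sup_{y'<0}\|F_{z'}\|_{L^2}^2+\sup_{y'<0}\|\frac{1}{\Psi_{z'}}F_{z'}\|_{\dot H^{1/2}}^2+\sup_{y'<0}\|\frac{1}{\Psi_{z'}}\partial_{z'}(\frac{1}{\Psi_{z'}}F_{z'})\|_{L^2}^2+\sup_{y'<0}\|\frac{1}{\Psi_{z'}^2}\partial_{z'}(\frac{1}{\Psi_{z'}}F_{z'})\|_{\dot H^{1/2}}^2+\sup_{y'<0}\|\frac{1}{\Psi_{z'}}\|_{L^\infty}^2+\sup_{y'<0}\|\partial_{z'}(\frac{1}{\Psi_{z'}})\|_{L^2}^2+\sup_{y'<0}\|\frac{1}{\Psi_{z'}}\partial_{z'}(\frac{1}{\Psi_{z'}}\partial_{z'}(\frac{1}{\Psi_{z'}}))\|_{L^2}^2$. **Initial data.** $F(\cdot,0),\Psi(\cdot,0)$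 are holomorphic on $P_-$, $\Psi(\cdot,0)$ is conformal onto a domain whose boundary is a Jordan curve, $\Psi_{z'}(z',0)\to1$ as $z'\to\infty$; $\mathfrak P(\cdot,0)$ is the unique solution of $\Delta\mathfrak P=-2|F_{z'}|^2$ on $P_-$, $\mathfrak P=0$ on $\partial P_-$, $(\partial_{x'}+i\partial_{y'})\mathfrak P\to-i$ at infinity; and $\mathcal E_1(0)<\infty$, $c_0:=\sup_{y'<0}\|F(\cdot+iy',0)\|_{L^2}+\sup_{y'<0}\|\frac{1}{\Psi_{z'}(\cdot+iy',0)}-1\|_{L^2}<\infty$. **Wu solution on $[0,T_0]$.** This is a solution produced by Wu's existence theorem from such data. Concretely it is a solution $(F,\Psi,\mathfrak P)$ of the system on $[0,T_0]$ with the following properties. (1) $\Psi$ is $C^1$ on $P_-\times[0,T_0]$, each $\Psi(\cdot,t)$ is conformal, and $\Psi,\frac1{\Psi_{z'}},\frac{\Psi_t}{\Psi_{z'}}$ are continuous on $\overline P_-\times[0,T_0]$; $F$ is bounded and continuous on $\overline P_-\times[0,T_0]$, $C^1$ on $P_-\times[0,T_0]$, each $F(\cdot,t)$ holomorphic; $\mathfrak P$ is continuous on $\overline P_-\times[0,T_0]$ and $C^1$ on $P_-\times[0,T_0]$; for all $t$, $\mathcal E_1(t)<\infty$ and $\sup_{y'<0}\|F(\cdot+iy',t)\|_{L^2}+\sup_{y'<0}\|\frac1{\Psi_{z'}(\cdot+iy',t)}-1\|_{L^2}<\infty$. (2) Smooth approximations. For each $0<\epsilon\le1$ there is a solution $(F^\epsilon,\Psi^\epsilon,\mathfrak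 P^\epsilon)$ of the system on $[0,T_0]$, smooth up to the boundary, with $F^\epsilon(z',0)=F(z'-\epsilon i,0)$, $\Psi^\epsilon(z',0)=\Psi(z'-\epsilon i,0)$. Write $Z^\epsilon(\alpha',t)=\Psi^\epsilon(\alpha',t)$, $Z^\epsilon_{,\alpha'}=\partial_{\alpha'}Z^\epsilon$, $Z_t^\epsilon=\overline{F^\epsilon}|_{\mathbb R}$, $Z^\epsilon_{t,\alpha'}=\partial_{\alpha'}Z^\epsilon_t$, $b^\epsilon=\frac{1}{\Psi^\epsilon_{z'}}(\overline{F^\epsilon}-\Psi^\epsilon_t)|_{\mathbb R}$; $h^\epsilon$ is the flow $h^\epsilon_t=b^\epsilon\circ h^\epsilon$, $h^\epsilon(\alpha,0)=\alpha$; $z^\epsilon=Z^\epsilon\circ h^\epsilon$ (so $z^\epsilon_t=Z_t^\epsilon\circ h^\epsilon$), $Z^\epsilon_{tt}=z^\epsilon_{tt}\circ(h^\epsilon)^{-1}$; $A_1^\epsilon(\alpha',t)=1+\frac1{2\pi}\int\frac{|Z_t^\epsilon(\alpha',t)-Z_t^\epsilon(\beta',t)|^2}{(\alpha'-\beta')^2}d\beta'$. On $\mathbb R$: $\frac{1}{\Psi^\epsilon_{z'}}(\partial_{x'}-i\partial_{y'})\mathfrak P^\epsilon=i\frac{A_1^\epsilon}{Z^\epsilon_{,\alpha'}}$ and $\overline{Z^\epsilon_{tt}}-i=-i\frac{A_1^\epsilon}{Z^\epsilon_{,\alpha'}}$. Moreover $\mathfrak P^\epsilon=-\frac12|F^\epsilon|^2-y'+\frac12K_{y'}*(|Z_t^\epsilon|^2)$.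 (3) Uniform bounds for all $0<\epsilon\le1$, $t\in[0,T_0]$: the quantities $\|Z^\epsilon_{t,\alpha'}\|_2$, $\|\partial_{\alpha'}\frac1{Z^\epsilon_{,\alpha'}}\|_2$, $\|A_1^\epsilon\|_\infty$, $\|\frac1{Z^\epsilon_{,\alpha'}}\partial_{\alpha'}A_1^\epsilon\|_2$, $\|b^\epsilon_{\alpha'}\|_\infty$, $\|\frac{h^\epsilon_{t\alpha}}{h^\epsilon_\alpha}\|_\infty$, $\|\frac{z^\epsilon_{t\alpha}}{z^\epsilon_\alpha}\|_\infty$, $\|\partial_{\alpha'}(\frac{1}{(Z^\epsilon_{,\alpha'})^2}Z^\epsilon_{t,\alpha'})\|_2$ (and the same with $\overline{Z^\epsilon_{t,\alpha'}}$ in place of $Z^\epsilon_{t,\alpha'}$) are at most $C(\mathcal E_1(0))$; $\|Z_t^\epsilon\|_\infty+\|\frac1{Z^\epsilon_{,\alpha'}}\|_\infty\le C(c_0,\mathcal E_1(0))$; and there are $0<c_1,c_2<\infty$ depending only on $\mathcal E_1(0)$ with $c_1\le|h^\epsilon_\alpha(\alpha,t)|\le c_2$, $c_1|z^\epsilon_\alpha(\alpha,0)|\le|z^\epsilon_\alpha(\alpha,t)|\le c_2|z^\epsilon_\alpha(\alpha,0)|$, $|z^\epsilon_{t\alpha}(\alpha,t)|\le c_2|z^\epsilon_\alpha(\alpha,0)|$. (4) Convergence along a sequence $\epsilon=\epsilon_j\to0$. There is a continuous $h:\mathbb R\times[0,T_0]\to\mathbb R$, each $h(\cdot,t)$ a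 homeomorphism, $h(\alpha,0)=\alpha$, with $h^\epsilon\Rightarrow h$, $(h^\epsilon)^{-1}\Rightarrow h^{-1}$ on $\mathbb R\times[0,T_0]$, and $0<c_1\le\frac{h(\alpha,t)-h(\beta,t)}{\alpha-\beta}\le c_2<\infty$ for $\alpha\ne\beta$. There is a continuous $z:\mathbb R\times[0,T_0]\to\mathbb C$, twice continuously differentiable in $t$ with $z_t,z_{tt}$ bounded and continuous, and $z^\epsilon\Rightarrow z$, $z^\epsilon_t\Rightarrow z_t$, $z^\epsilon_{tt}\Rightarrow z_{tt}$. Put $Z=z\circ h^{-1}$, $Z_t=z_t\circ h^{-1}$, $Z_{tt}=z_{tt}\circ h^{-1}$; then $Z^\epsilon\Rightarrow Z$, $Z_t^\epsilon\Rightarrow Z_t$, $Z_{tt}^\epsilon\Rightarrow Z_{tt}$ on $\mathbb R\times[0,T_0]$, $Z(\alpha',t)=\Psi(\alpha',t)$ and $\overline{Z_t}(\alpha',t)=F(\alpha',t)$. On $\overline P_-\times[0,T_0]$: $\Psi^\epsilon\Rightarrow\Psi$, $\frac1{\Psi^\epsilon_{z'}}\Rightarrow\frac1{\Psi_{z'}}$, $\frac{\Psi^\epsilon_t}{\Psi^\epsilon_{z'}}\Rightarrow\frac{\Psi_t}{\Psi_{z'}}$, $F^\epsilon\Rightarrow F$, $\mathfrak P^\epsilon\Rightarrow\mathfrak P$. On $P_-\times[0,T_0]$: $\Psi^\epsilon_t\Rightarrow\Psi_t$, $\Psi^\epsilon_{z'}\Rightarrow\Psi_{z'}$, $F^\epsilon_{z'}\Rightarrow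 F_{z'}$, $F^\epsilon_t\Rightarrow F_t$, $(\partial_{x'}-i\partial_{y'})\mathfrak P^\epsilon\Rightarrow(\partial_{x'}-i\partial_{y'})\mathfrak P$. Finally $\mathfrak P=-\frac12|F|^2-y'+\frac12K_{y'}*(|Z_t|^2)$ on $P_-\times[0,T_0]$. *)

(* Defs.v *)
From HB Require Import structures.
From mathcomp Require Import all_boot all_order all_algebra.
From mathcomp Require Import all_classical all_reals all_analysis.
From mathcomp Require Import complex.
Set Implicit Arguments.
Unset Strict Implicit.
Unset Printing Implicit Defensive.
Import Order.TTheory GRing.Theory Num.Theory.
Import numFieldNormedType.Exports.
Local Open Scope classical_set_scope.
Local Open Scope ring_scope.

(* MathComp-Analysis. The plane is R[i], with the topology of its modulus. *)
HB.instance Definition _ (R : realType) := NormedModule.copy R[i] R[i]^o.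

Definition toC {R : realType} (x : R) : R[i] := Complex x 0.
Definition iC {R : realType} : R[i] := Complex 0 1.

(* Real modulus; `|z| lives in R[i]. *)
Definition modC {R : realType} (z : R[i]) : R := Normc.normc z.

Section Plane.
Context {R : realType}.

Definition lower : set R[i] := [set z | complex.Im z < 0].
Definition lowerbar : set R[i] := [set z | complex.Im z <= 0].

Definition time (T : R) : set R := [set t | 0 <= t <= T].
Definition slab (T : R) : set (R[i] * R) := lower `*` time T.
Definition slabbar (T : R) : set (R[i] * R) := lowerbar `*` time T.
Definition strip (T : R) : set (R * R) := [set: R] `*` time T.

End Plane.

Section Extension.
Context {X : topologicalType} {R : realType}.

(* f, meaningful on D, extends continuously to E (in use: D is dense in E). *)
Definition extends (D E : set X) (f : X -> R[i]) : Prop :=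
  exists2 g : X -> R[i], {within E, continuous g} & {in D, g =1 f}.

Definition ext (D : set X) (f : X -> R[i]) (p : X) : R[i] :=
  lim (f q @[q --> within D (nbhs p)]).

End Extension.

Definition ucvg {X : topologicalType} {Y : uniformType}
    (U : set X) (f_ : nat -> X -> Y) (f : X -> Y) : Prop :=
  forall K : set X, compact K -> K `<=` U -> {uniform K, f_ @ \oo --> f}.

Section Derivatives.
Context {R : realType}.

(* Derivative at x of f restricted to I; one-sided at an end point of I. *)
Definition quotient_filter (I : set R) (f : R -> R[i]) (x : R) : set_system R[i] :=
  (toC (y - x)^-1 * (f y - f x)) @[y --> within I (x^')].
Definition is_rderiv (I : set R) (f : R -> R[i]) (x : R) (l : R[i]) : Prop :=
  quotient_filter I f x --> l.
Definition rderivable (I : set R) (f : R -> R[i]) (x : R) : Prop :=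
  cvg (quotient_filter I f x).
Definition rderiv (I : set R) (f : R -> R[i]) (x : R) : R[i] :=
  lim (quotient_filter I f x).

Inductive direction := dirx | diry | dirt.

Implicit Types (f : R[i] * R -> R[i]) (p : R[i] * R) (T : R).

Definition slice (d : direction) (f : R[i] * R -> R[i]) (p : R[i] * R) (s : R) : R[i] :=
  match d with
  | dirx => f (Complex s (complex.Im p.1), p.2)
  | diry => f (Complex (complex.Re p.1) s, p.2)
  | dirt => f (p.1, s)
  end.

Definition coordinate (d : direction) (p : R[i] * R) : R :=
  match d with
  | dirx => complex.Re p.1
  | diry => complex.Im p.1
  | dirt => p.2
  end.

Definition domain (T : R) (d : direction) : set R :=
  match d with dirt => time T | _ => [set: R] end.

Definition partial T d f p : R[i] :=
  rderiv (domain T d) (slice d f p) (coordinate d p).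
Definition has_partial T d f p : Prop :=
  rderivable (domain T d) (slice d f p) (coordinate d p).
Definition is_partial T d f p (l : R[i]) : Prop :=
  is_rderiv (domain T d) (slice d f p) (coordinate d p) l.

(* The time horizon is irrelevant to the space derivatives. *)
Definition dx f p : R[i] := partial 0 dirx f p.
Definition dy f p : R[i] := partial 0 diry f p.
Definition dt T f p : R[i] := partial T dirt f p.
Definition dz f p : R[i] := 2^-1 * (dx f p - iC * dy f p).

Definition complexify {X : Type} (P : X -> R) : X -> R[i] := fun u => toC (P u).

Definition C1_slab T f : Prop := forall d,
  (forall p, slab T p -> has_partial T d f p) /\
  {within slab T, continuous (partial T d f)}.

(* Every iterated partial derivative exists on the slab and extends continuously
   to its closure. *)
Definition smooth_slab T f : Prop :=
  exists G : seq direction -> R[i] * R -> R[i],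
    [/\ {in slabbar T, G [::] =1 f},
        forall ds, {within slabbar T, continuous (G ds)} &
        forall d ds p, slab T p -> is_partial T d (G ds) p (G (d :: ds) p)].

(* Functions of (alpha, t) on the real line times [0, T]. *)
Definition line_da (f : R * R -> R[i]) (q : R * R) : R[i] :=
  rderiv [set: R] (fun a => f (a, q.2)) q.1.
Definition line_dt T (f : R * R -> R[i]) (q : R * R) : R[i] :=
  rderiv (time T) (fun s => f (q.1, s)) q.2.
Definition line_has_da (f : R * R -> R[i]) (q : R * R) : Prop :=
  rderivable [set: R] (fun a => f (a, q.2)) q.1.
Definition line_has_dt T (f : R * R -> R[i]) (q : R * R) : Prop :=
  rderivable (time T) (fun s => f (q.1, s)) q.2.

Definition bdry (q : R * R) : R[i] * R := (toC q.1, q.2).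

End Derivatives.

Section HolomorphicMaps.
Context {R : realType}.

Definition holomorphic (f : R[i] -> R[i]) : Prop :=
  forall z, lower z -> derivable f z 1.

Definition conformal (f : R[i] -> R[i]) : Prop :=
  [/\ holomorphic f, set_inj lower f & forall z, lower z -> derive1 f z != 0].

Definition tends_at_infinity (f : R[i] -> R[i]) (l : R[i]) : Prop :=
  forall e : R, 0 < e -> exists M : R,
    forall z, lower z -> M < modC z -> modC (f z - l) < e.

(* A curve without self-intersection, unbounded in both directions and tending
   to the real line at infinity. *)
Definition jordan_interface (g : R -> R[i]) : Prop :=
  [/\ continuous g, injective g,
      modC (g a) @[a --> +oo] --> +oo /\ modC (g a) @[a --> -oo] --> +oo &
      complex.Im (g a) @[a --> +oo] --> 0 /\ complex.Im (g a) @[a --> -oo] --> 0].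

End HolomorphicMaps.

Section Norms.
Context {R : realType}.
Local Notation mu := (@lebesgue_measure R).

Definition lpnorm (p : \bar R) (f : R -> R[i]) : \bar R :=
  Lnorm mu p (fun x => (modC (f x))%:E).

Definition line_norm (p : \bar R) (f : R * R -> R[i]) (t : R) : \bar R :=
  lpnorm p (fun a => f (a, t)).

Definition cintegral (D : set R) (f : R -> R[i]) : R[i] :=
  Complex (Rintegral mu D (fun x => complex.Re (f x)))
          (Rintegral mu D (fun x => complex.Im (f x))).

Definition expi (x : R) : R[i] := Complex (cos x) (sin x).

(* g is the Plancherel transform of f, with the convention
   \hat f(xi) = \int f(x) e^(- i x xi) dx: the L^2 limit of the transforms of the
   truncations of f. *)
Definition is_fourier (f g : R -> R[i]) : Prop :=
  [/\ measurable_fun [set: R] (fun xi => complex.Re (g xi)),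
      measurable_fun [set: R] (fun xi => complex.Im (g xi)) &
      lpnorm 2%:E (fun xi =>
        cintegral [set x | `|x| <= N%:R] (fun x => f x * expi (- (x * xi))) - g xi)
        @[N --> \oo] --> 0%E].

(* The transform is unique up to null sets, so that for f in L^2 the set below
   is a singleton; for other f it is empty and the infimum is +oo. *)
Definition hhalf (f : R -> R[i]) : \bar R :=
  ereal_inf [set lpnorm 2%:E (fun xi => toC (Num.sqrt `|xi|) * g xi)
            | g in is_fourier f].

Definition horizontal (f : R[i] * R -> R[i]) (y t : R) : R -> R[i] :=
  fun x => f (Complex x y, t).

(* sup over y' < 0 of the norm at height y' of f(., t) *)
Definition sup_norm (N : (R -> R[i]) -> \bar R) (f : R[i] * R -> R[i]) (t : R) : \bar R :=
  ereal_sup [set N (horizontal f y t) | y in [set y | y < 0]].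
Definition sup_norm2 (N : (R -> R[i]) -> \bar R) (f : R[i] * R -> R[i]) (t : R) : \bar R :=
  ereal_sup [set (N (horizontal f y t) ^+ 2)%E | y in [set y | y < 0]].

Definition poisson (y x : R) : R := - y / (pi * (x ^+ 2 + y ^+ 2)).

Definition poisson_conv (g : R -> R) (z : R[i]) : R :=
  Rintegral mu [set: R]
    (fun s => poisson (complex.Im z) (complex.Re z - s) * g s).

End Norms.

Section WaterWave.
Context {R : realType}.
Implicit Types (T t : R) (F Psi : R[i] * R -> R[i]) (P : R[i] * R -> R).

Definition recip_dz Psi p : R[i] := (dz Psi p)^-1.
Definition wdz Psi (f : R[i] * R -> R[i]) p : R[i] := recip_dz Psi p * dz f p.

(* (d_x' - i d_y') P *)
Definition cgrad P p : R[i] :=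
  dx (complexify P) p - iC * dy (complexify P) p.

Definition energy1 F Psi t : \bar R :=
  (sup_norm2 (lpnorm 2%:E) (dz F) t
   + sup_norm2 hhalf (wdz Psi F) t
   + sup_norm2 (lpnorm 2%:E) (wdz Psi (wdz Psi F)) t
   + sup_norm2 hhalf (fun p => (recip_dz Psi p ^+ 2 * dz (wdz Psi F) p)%R) t
   + sup_norm2 (lpnorm +oo) (recip_dz Psi) t
   + sup_norm2 (lpnorm 2%:E) (dz (recip_dz Psi)) t
   + sup_norm2 (lpnorm 2%:E) (wdz Psi (wdz Psi (recip_dz Psi))) t)%E.

Definition l2size F Psi t : \bar R :=
  (sup_norm (lpnorm 2%:E) F t
   + sup_norm (lpnorm 2%:E) (fun p => (recip_dz Psi p - 1)%R) t)%E.

(* (1 / Psi_z') (conj F - Psi_t), whose trace on the real line is b *)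
Definition drift T F Psi p : R[i] := recip_dz Psi p * ((F p)^* - dt T Psi p).

Record water_wave T F Psi P : Prop := {
  ww_equation : forall p, slab T p ->
    dt T F p - dt T Psi p * (dz F p / dz Psi p) + (F p)^* * (dz F p / dz Psi p)
    = - (recip_dz Psi p * cgrad P p) + iC ;
  ww_holomorphic : forall t, time T t -> holomorphic (fun z => F (z, t)) ;
  ww_conformal : forall t, time T t -> conformal (fun z => Psi (z, t)) ;
  ww_pressure : forall q, strip T q -> P (bdry q) = 0 ;
  ww_trace : extends (slab T) (slabbar T) (drift T F Psi) ;
  ww_trace_real : forall q, strip T q ->
    complex.Im (ext (slab T) (drift T F Psi) (bdry q)) = 0 ;
  ww_infty : forall t, time T t ->
    [/\ tends_at_infinity (fun z => F (z, t)) 0,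
        tends_at_infinity (fun z => cgrad P (z, t)) iC,
        tends_at_infinity (fun z => dz Psi (z, t)) 1 &
        tends_at_infinity (fun z => dt T Psi (z, t)) 0]
}.

Definition fluid_domain Psi t : set R[i] := (fun z => Psi (z, t)) @` lower.

(* P(., 0) solves a Dirichlet problem whose solution is unique; uniqueness is a
   fact, so only the defining equations appear. *)
Record initial_data F Psi P : Prop := {
  id_holomorphic : holomorphic (fun z => F (z, 0)) ;
  id_conformal : conformal (fun z => Psi (z, 0)) ;
  id_boundary :
    closure (fluid_domain Psi 0) `\` fluid_domain Psi 0
    = range (fun a : R => Psi (toC a, 0)) ;
  id_jordan : jordan_interface (fun a => Psi (toC a, 0)) ;
  id_infty : tends_at_infinity (fun z => dz Psi (z, 0)) 1 ;
  id_pressure_diff : forall z, lower z -> forall d, d <> dirt ->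
    has_partial 0 d (complexify P) (z, 0) /\
    has_partial 0 d (partial 0 d (complexify P)) (z, 0) ;
  id_pressure_laplace : forall z, lower z ->
    dx (dx (complexify P)) (z, 0) + dy (dy (complexify P)) (z, 0)
    = toC (- 2 * modC (dz F (z, 0)) ^+ 2) ;
  id_pressure_bdry : forall a : R, P (toC a, 0) = 0 ;
  id_pressure_infty : tends_at_infinity (fun z =>
    dx (complexify P) (z, 0) + iC * dy (complexify P) (z, 0)) (- iC) ;
  id_energy : (energy1 F Psi 0 < +oo)%E ;
  id_l2 : (l2size F Psi 0 < +oo)%E
}.

(* Boundary quantities of a solution that is smooth up to the boundary, as
   functions of (alpha', t), respectively (alpha, t). *)
Section Boundary.
Variables (T : R) (F Psi : R[i] * R -> R[i]) (h hinv : R * R -> R).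

Definition bZ (q : R * R) : R[i] := Psi (bdry q).
Definition bZ_a (q : R * R) : R[i] := line_da bZ q.
Definition bZ_recip (q : R * R) : R[i] := (bZ_a q)^-1.
Definition bZt (q : R * R) : R[i] := (F (bdry q))^*.
Definition bZt_a (q : R * R) : R[i] := line_da bZt q.
Definition bb (q : R * R) : R := complex.Re (ext (slab T) (drift T F Psi) (bdry q)).
Definition bz (q : R * R) : R[i] := bZ (h q, q.2).
Definition bzt (q : R * R) : R[i] := line_dt T bz q.
Definition bztt (q : R * R) : R[i] := line_dt T bzt q.
Definition bZtt (q : R * R) : R[i] := bztt (hinv q, q.2).
Definition bA1 (q : R * R) : R :=
  1 + (2 * pi)^-1 * Rintegral (@lebesgue_measure R) [set: R]
        (fun s => modC (bZt q - bZt (s, q.2)) ^+ 2 / (q.1 - s) ^+ 2).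

Definition h_a (q : R * R) : R[i] := line_da (complexify h) q.
Definition h_ta (q : R * R) : R[i] := line_da (line_dt T (complexify h)) q.
Definition bz_a (q : R * R) : R[i] := line_da bz q.
Definition bzt_a (q : R * R) : R[i] := line_da bzt q.

Record is_flow : Prop := {
  fl_ode : forall q, strip T q ->
    is_rderiv (time T) (fun s => complexify h (q.1, s)) q.2 (toC (bb (h q, q.2))) ;
  fl_init : forall a, h (a, 0) = a ;
  fl_inv : forall q, strip T q -> hinv (h q, q.2) = q.1 /\ h (hinv q, q.2) = q.1 ;
  fl_diff : forall q, strip T q ->
    [/\ line_has_da (complexify h) q & line_has_da (line_dt T (complexify h)) q]
}.

End Boundary.

Section Solution.
Variables (T : R) (C c1 c2 : R -> R) (C0 : R -> R -> R).

(* The solution (Fe, Pe, Qe) issued from the data of (F, Psi) shifted down by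
   eps. *)
Record smooth_approx F Psi (eps : R) Fe Pe (Qe : R[i] * R -> R) he hie : Prop := {
  sa_smooth : [/\ smooth_slab T Fe, smooth_slab T Pe & smooth_slab T (complexify Qe)] ;
  sa_immersed : forall q, strip T q -> bZ_a Pe q != 0 ;
  sa_water_wave : water_wave T Fe Pe Qe ;
  sa_init : forall z, lowerbar z ->
    Fe (z, 0) = F (z - toC eps * iC, 0) /\ Pe (z, 0) = Psi (z - toC eps * iC, 0) ;
  sa_flow : is_flow T Fe Pe he hie ;
  sa_z_diff : forall q, strip T q ->
    [/\ line_has_dt T (bz Pe he) q, line_has_dt T (bzt T Pe he) q,
        line_has_da (bz Pe he) q & line_has_da (bzt T Pe he) q] ;
  sa_zt : forall q, strip T q -> bzt T Pe he q = bZt Fe (he q, q.2) ;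
  sa_pressure_trace : forall q, strip T q ->
    ext (slab T) (fun p => recip_dz Pe p * cgrad Qe p) (bdry q)
    = iC * (toC (bA1 Fe q) / bZ_a Pe q) ;
  sa_acceleration : forall q, strip T q ->
    (bZtt T Pe he hie q)^* - iC = - (iC * (toC (bA1 Fe q) / bZ_a Pe q)) ;
  sa_pressure : forall p, slab T p ->
    Qe p = - 2^-1 * modC (Fe p) ^+ 2 - complex.Im p.1
           + 2^-1 * poisson_conv (fun a => modC (bZt Fe (a, p.2)) ^+ 2) p.1
}.

(* E and c0 are the initial energy and the initial L^2 size. *)
Record uniform_bounds (E c0 : R) Fe Pe he : Prop := {
  ub_Zta : forall t, time T t -> (line_norm 2%:E (bZt_a Fe) t <= (C E)%:E)%E ;
  ub_recip_a : forall t, time T t ->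
    (line_norm 2%:E (line_da (bZ_recip Pe)) t <= (C E)%:E)%E ;
  ub_A1 : forall t, time T t ->
    (line_norm +oo (complexify (bA1 Fe)) t <= (C E)%:E)%E ;
  ub_A1_a : forall t, time T t ->
    (line_norm 2%:E (fun q => bZ_recip Pe q * line_da (complexify (bA1 Fe)) q)%R t
      <= (C E)%:E)%E ;
  ub_b_a : forall t, time T t ->
    (line_norm +oo (line_da (complexify (bb T Fe Pe))) t <= (C E)%:E)%E ;
  ub_h_ta : forall t, time T t ->
    (line_norm +oo (fun q => h_ta T he q / h_a he q)%R t <= (C E)%:E)%E ;
  ub_z_ta : forall t, time T t ->
    (line_norm +oo (fun q => bzt_a T Pe he q / bz_a Pe he q)%R t <= (C E)%:E)%E ;
  ub_weighted : forall t, time T t ->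
    (line_norm 2%:E (line_da (fun q => bZ_recip Pe q ^+ 2 * bZt_a Fe q)%R) t
      <= (C E)%:E)%E ;
  ub_weighted_conj : forall t, time T t ->
    (line_norm 2%:E (line_da (fun q => bZ_recip Pe q ^+ 2 * (bZt_a Fe q)^*)%R) t
      <= (C E)%:E)%E ;
  ub_sup : forall t, time T t ->
    (line_norm +oo (bZt Fe) t + line_norm +oo (bZ_recip Pe) t <= (C0 c0 E)%:E)%E ;
  ub_h : forall q, strip T q -> c1 E <= modC (h_a he q) <= c2 E ;
  ub_z : forall q, strip T q ->
    c1 E * modC (bz_a Pe he (q.1, 0)) <= modC (bz_a Pe he q)
      <= c2 E * modC (bz_a Pe he (q.1, 0)) ;
  ub_zt : forall q, strip T q ->
    modC (bzt_a T Pe he q) <= c2 E * modC (bz_a Pe he (q.1, 0))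
}.

(* Fs j, Ps j, Qs j, hs j, his j are the approximations for eps = eps_j; h, z are
   their limits and hi is the inverse of h in the space variable. *)
Record convergence (E : R) F Psi P
    (Fs Ps : nat -> R[i] * R -> R[i]) (Qs : nat -> R[i] * R -> R)
    (hs his : nat -> R * R -> R) (h hi : R * R -> R) (z : R * R -> R[i]) : Prop := {
  cv_h_cont : {within strip T, continuous h} ;
  cv_h_inv : forall q, strip T q -> hi (h q, q.2) = q.1 /\ h (hi q, q.2) = q.1 ;
  cv_h_homeo : forall t, time T t ->
    continuous (fun a => h (a, t)) /\ continuous (fun a => hi (a, t)) ;
  cv_h_init : forall a, h (a, 0) = a ;
  cv_h_lip : forall t a b, time T t -> a != b ->
    c1 E <= (h (a, t) - h (b, t)) / (a - b) <= c2 E ;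
  cv_h : ucvg (strip T) hs h ;
  cv_hi : ucvg (strip T) his hi ;
  cv_z_cont : {within strip T, continuous z} ;
  cv_z_diff : forall q, strip T q ->
    line_has_dt T z q /\ line_has_dt T (line_dt T z) q ;
  cv_z_C2 : {within strip T, continuous (line_dt T z)} /\
            {within strip T, continuous (line_dt T (line_dt T z))} ;
  cv_z_bounded : exists M : R, forall q, strip T q ->
    modC (line_dt T z q) <= M /\ modC (line_dt T (line_dt T z) q) <= M ;
  cv_z : ucvg (strip T) (fun j => bz (Ps j) (hs j)) z ;
  cv_zt : ucvg (strip T) (fun j => bzt T (Ps j) (hs j)) (line_dt T z) ;
  cv_ztt : ucvg (strip T) (fun j => bztt T (Ps j) (hs j)) (line_dt T (line_dt T z)) ;
  cv_Z : ucvg (strip T) (fun j => bZ (Ps j)) (fun q => z (hi q, q.2)) ;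
  cv_Zt : ucvg (strip T) (fun j => bZt (Fs j)) (fun q => line_dt T z (hi q, q.2)) ;
  cv_Ztt : ucvg (strip T) (fun j => bZtt T (Ps j) (hs j) (his j))
    (fun q => line_dt T (line_dt T z) (hi q, q.2)) ;
  cv_trace : forall q, strip T q ->
    z (hi q, q.2) = Psi (bdry q) /\ (line_dt T z (hi q, q.2))^* = F (bdry q) ;
  cv_Psi : ucvg (slabbar T) Ps Psi ;
  cv_recip : ucvg (slabbar T) (fun j => ext (slab T) (recip_dz (Ps j)))
    (ext (slab T) (recip_dz Psi)) ;
  cv_Psit_recip : ucvg (slabbar T)
    (fun j => ext (slab T) (fun p => dt T (Ps j) p / dz (Ps j) p))
    (ext (slab T) (fun p => dt T Psi p / dz Psi p)) ;
  cv_F : ucvg (slabbar T) Fs F ;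
  cv_P : ucvg (slabbar T) Qs P ;
  cv_Psit : ucvg (slab T) (fun j => dt T (Ps j)) (dt T Psi) ;
  cv_Psiz : ucvg (slab T) (fun j => dz (Ps j)) (dz Psi) ;
  cv_Fz : ucvg (slab T) (fun j => dz (Fs j)) (dz F) ;
  cv_Ft : ucvg (slab T) (fun j => dt T (Fs j)) (dt T F) ;
  cv_cgrad : ucvg (slab T) (fun j => cgrad (Qs j)) (cgrad P) ;
  cv_pressure : forall p, slab T p ->
    P p = - 2^-1 * modC (F p) ^+ 2 - complex.Im p.1
          + 2^-1 * poisson_conv (fun a => modC (line_dt T z (hi (a, p.2), p.2)) ^+ 2) p.1
}.

Record wu_regularity F Psi P : Prop := {
  wr_Psi : C1_slab T Psi ;
  wr_Psi_cont : {within slabbar T, continuous Psi} ;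
  wr_recip : extends (slab T) (slabbar T) (recip_dz Psi) ;
  wr_Psit_recip : extends (slab T) (slabbar T) (fun p => dt T Psi p / dz Psi p) ;
  wr_F : C1_slab T F ;
  wr_F_cont : {within slabbar T, continuous F} ;
  wr_F_bounded : exists M : R, forall p, slabbar T p -> modC (F p) <= M ;
  wr_P : C1_slab T (complexify P) ;
  wr_P_cont : {within slabbar T, continuous P} ;
  wr_finite : forall t, time T t ->
    (energy1 F Psi t < +oo)%E /\ (l2size F Psi t < +oo)%E
}.

(* C, C0, c1, c2 are the constants of the existence theorem, as functions of the
   initial energy and of the initial L^2 size. *)
Definition wu_solution F Psi P : Prop :=
  let E := fine (energy1 F Psi 0) in
  let c0 := fine (l2size F Psi 0) in
  [/\ initial_data F Psi P, water_wave T F Psi P, wu_regularity F Psi P &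
      0 < c1 E /\ 0 < c2 E] /\
  exists (Fe Pe : R -> R[i] * R -> R[i]) (Qe : R -> R[i] * R -> R)
         (he hie : R -> R * R -> R),
    (forall eps, 0 < eps <= 1 ->
       smooth_approx F Psi eps (Fe eps) (Pe eps) (Qe eps) (he eps) (hie eps) /\
       uniform_bounds E c0 (Fe eps) (Pe eps) (he eps)) /\
    exists (e : nat -> R) (h hi : R * R -> R) (z : R * R -> R[i]),
      [/\ forall j, 0 < e j <= 1, e j @[j --> \oo] --> 0 &
          convergence E F Psi P (Fe \o e) (Pe \o e) (Qe \o e) (he \o e) (hie \o e) h hi z].

End Solution.

(* alpha' in S(t) *)
Definition singular T Psi (q : R * R) : Prop :=
  ext (slab T) (recip_dz Psi) (bdry q) = 0.

(* Real gradient, as a complex number. *)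
Definition rgrad P p : R[i] :=
  dx (complexify P) p + iC * dy (complexify P) p.

End WaterWave.

(* Main.v *)
(* Composition with Psi turns the gradients of v and of P into the conjugates of
   g = F_z'/Psi_z' and q = (1/Psi_z') (d_x' - i d_y') P, so that everything follows
   from the existence of boundary limits of g and q which vanish at the zeros of
   w = 1/Psi_z'.

   The energy bounds F_z', w' and w g' in L^2 on horizontal lines, uniformly. Where
   w does not vanish, g' is locally L^2 and g is equicontinuous up to the boundary.
   At a zero a of w, (g^2)' = 2 F_z' (w g') is equi-integrable, because the L^2 mass
   of the Hardy function F_z' does not concentrate at a; hence g^2 has a
   limit, and the limit is 0 since |w|^2 = O(|z - a|).

   For the approximations, q = H - conj(F) g with H and g holomorphic, and q equals
   i - conj(Z_tt) on the real line. The holomorphic function H - conj(F(a)) g is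
   close to i - conj(Z_tt(a)) on the real line near a, uniformly along the sequence;
   a Phragmén-Lindelöf argument with a peak function carries this into the half
   plane and, in the limit, to q. At a zero of w, |i - conj(Z_tt)| <= C |w| gives the
   value 0.

   Psi(., t) is a proper continuous injection of the closed half plane, hence a
   homeomorphism onto the closure of the fluid domain, and the Euler equation is
   the first equation of the system read through it. *)
Require Import Defs.
From HB Require Import structures.
From mathcomp Require Import all_boot all_order all_algebra.
From mathcomp Require Import all_classical all_reals all_analysis.
From mathcomp Require Import measurable_realfun ess_sup_inf complex ring lra.
Import Order.TTheory GRing.Theory Num.Theory.
Import numFieldNormedType.Exports.
Local Open Scope classical_set_scope.
Local Open Scope ring_scope.
Set Implicit Arguments.
Unset Strict Implicit.
Unset Printing Implicit Defensive.

(** * Modulus, continuity and one-variable derivatives *)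

(** Squaring [g] is forced: its derivative is controlled only through [w g'], which says nothing
    where [w] vanishes, whereas the derivative of the square is a product of two square-integrable
    functions. That the mass of [F_z'] does not concentrate follows from convergence of its traces
    in L^2. The inner product of the traces at heights y and s depends on y + s only; hence the
    squared norm is midpoint convex in the height, so monotone because it is bounded, and expanding
    the square of a difference makes the traces Cauchy. The pressure needs another route: the
    gradients of the approximations converge only inside the half plane, so boundary information
    survives only if it holds on a neighbourhood of [a] whose size does not depend on the index of
    the approximation. The factor conj(F) destroys holomorphy; freezing it at [a] restores it at the
    cost of |F - F(a)| |g|, and this cost is small because [g] is bounded up to the boundary
    uniformly along the sequence. *)

Section Modulus.
Context {R : realType}.
Implicit Types (z w : R[i]) (x y : R).

Lemma normr_modC z : `|z| = toC (modC z).
Proof. by rewrite /modC normc_def; case: z. Qed.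

Lemma conjE z : Num.conj z = conjc z.
Proof. by []. Qed.

Lemma modC_ge0 z : 0 <= modC z.
Proof. by case: z => a b; rewrite /modC /= sqrtr_ge0. Qed.

Lemma modCM z w : modC (z * w) = modC z * modC w.
Proof. exact: Normc.normcM. Qed.

Lemma modCV z : modC z^-1 = (modC z)^-1.
Proof. exact: Normc.normcV. Qed.

Lemma modCD z w : modC (z + w) <= modC z + modC w.
Proof. exact: le_normcD. Qed.

Lemma modCN z : modC (- z) = modC z.
Proof. exact: normcN. Qed.

Lemma modCB z w : modC (z - w) <= modC z + modC w.
Proof. by rewrite (le_trans (modCD _ _))// modCN. Qed.

Lemma modC_sub z w : modC (z - w) = modC (w - z).
Proof. by rewrite -modCN opprB. Qed.

Lemma modC_tri z w u : modC (z - u) <= modC (z - w) + modC (w - u).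
Proof. by rewrite (le_trans _ (modCD _ _))// addrA subrK. Qed.

Lemma modC_triB z w : modC z - modC w <= modC (z - w).
Proof. by rewrite lerBlDr (le_trans _ (modCD _ _))// subrK. Qed.

Lemma modC_eq0 z : (modC z == 0) = (z == 0).
Proof.
apply/eqP/eqP => [/Normc.eq0_normc//|->]; exact: Normc.normc0.
Qed.

Lemma modC0 : modC (0 : R[i]) = 0. Proof. exact: Normc.normc0. Qed.
Lemma modC1 : modC (1 : R[i]) = 1. Proof. exact: Normc.normc1. Qed.

Lemma modC_gt0 z : (0 < modC z) = (z != 0).
Proof. by rewrite lt_def modC_ge0 andbT modC_eq0. Qed.

Lemma modC_toC x : modC (toC x) = `|x|.
Proof. by rewrite /modC /toC /= expr0n addr0 sqrtr_sqr. Qed.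

Lemma modC_iC : modC (iC : R[i]) = 1.
Proof. by rewrite /modC /iC /= expr0n /= add0r expr1n sqrtr1. Qed.

Lemma modC_sqr z : modC z ^+ 2 = complex.Re z ^+ 2 + complex.Im z ^+ 2.
Proof. by case: z => a b; rewrite /modC /= sqr_sqrtr// addr_ge0// sqr_ge0. Qed.

Lemma modC_conj z : modC (Num.conj z) = modC z.
Proof. by rewrite conjE; case: z => a b; rewrite /modC /= sqrrN. Qed.

Lemma Re_le_modC z : `|complex.Re z| <= modC z.
Proof.
by rewrite -(@ler_pXn2r _ 2)// ?nnegrE ?modC_ge0// modC_sqr real_normK ?num_real// lerDl sqr_ge0.
Qed.

Lemma Im_le_modC z : `|complex.Im z| <= modC z.
Proof.
by rewrite -(@ler_pXn2r _ 2)// ?nnegrE ?modC_ge0// modC_sqr real_normK ?num_real// lerDr sqr_ge0.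
Qed.

Lemma modC_le z : modC z <= `|complex.Re z| + `|complex.Im z|.
Proof.
have h : z = toC (complex.Re z) + iC * toC (complex.Im z).
  by case: z => a b; rewrite /toC /iC; apply/eqP; rewrite eq_complex /=; apply/andP; split; apply/eqP; ring.
by rewrite {1}h (le_trans (modCD _ _))// modCM modC_iC mul1r !modC_toC.
Qed.

Lemma modCX z n : modC (z ^+ n) = modC z ^+ n.
Proof. by elim: n => [|n IH]; rewrite ?expr0 ?modC1// !exprS modCM IH. Qed.

Lemma complexP z w : complex.Re z = complex.Re w -> complex.Im z = complex.Im w -> z = w.
Proof. by case: z => a b; case: w => c d /= -> ->. Qed.

Lemma complexRI z : z = toC (complex.Re z) + iC * toC (complex.Im z).
Proof. by apply: complexP; case: z => a b /=; ring. Qed.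

Lemma toCD x y : toC (x + y) = toC x + toC y.
Proof. by apply: complexP => /=; ring. Qed.
Lemma toCN x : toC (- x) = - toC x.
Proof. by apply: complexP => /=; ring. Qed.
Lemma toCB x y : toC (x - y) = toC x - toC y.
Proof. by rewrite toCD toCN. Qed.
Lemma toCM x y : toC (x * y) = toC x * toC y.
Proof. by apply: complexP => /=; ring. Qed.
Lemma toCV x : toC x^-1 = (toC x)^-1.
Proof.
have [->|x0] := eqVneq x 0.
  by rewrite invr0 (_ : toC 0 = 0 :> R[i])// invr0.
have tx0 : toC x != 0 by rewrite -modC_eq0 modC_toC normr_eq0.
by apply: (mulIf tx0); rewrite -toCM !mulVf.
Qed.
Lemma toC_eq0 x : (toC x == 0) = (x == 0).
Proof. by rewrite -modC_eq0 modC_toC normr_eq0. Qed.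
Lemma toC0 : toC (0 : R) = 0. Proof. by []. Qed.
Lemma toC1 : toC (1 : R) = 1. Proof. by []. Qed.
Lemma iCi : iC * iC = (-1 : R[i]).
Proof. by apply: complexP => /=; ring. Qed.
Lemma iC_neq0 : (iC : R[i]) != 0.
Proof. by rewrite -modC_eq0 modC_iC oner_eq0. Qed.
Lemma reD z w : complex.Re (z + w) = complex.Re z + complex.Re w.
Proof. by case: z; case: w. Qed.
Lemma imD z w : complex.Im (z + w) = complex.Im z + complex.Im w.
Proof. by case: z; case: w. Qed.
Lemma reN z : complex.Re (- z) = - complex.Re z.
Proof. by case: z. Qed.
Lemma imN z : complex.Im (- z) = - complex.Im z.
Proof. by case: z. Qed.
Lemma reM z w : complex.Re (z * w) = complex.Re z * complex.Re w - complex.Im z * complex.Im w.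
Proof. by case: z; case: w. Qed.
Lemma imM z w : complex.Im (z * w) = complex.Re z * complex.Im w + complex.Im z * complex.Re w.
Proof. by case: z => a b; case: w => c d /=; ring. Qed.

End Modulus.

(** * Neighbourhoods and one-sided derivatives through real radii *)

Section Balls.
Context {R : realType}.
Local Notation C := R[i].

(** The norm of [R[i]] is itself complex valued, so its balls have complex radii; this is the
    passage to real radii on which the epsilon arguments in the plane rest. *)
Lemma nbhs_modC (z : C) (A : set C) :
  nbhs z A <-> exists2 d : R, 0 < d & forall w, modC (w - z) < d -> A w.
Proof.
split.
  move=> /nbhs_ballP[e e0 eA].
  (* Positivity for the partial order of [R[i]] forces the radius to be real. *)
  have [er eim] : complex.Im e = 0 /\ 0 < complex.Re e.
    by move: e0; rewrite /= ltcE /= => /andP[/eqP <- ->].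
  exists (complex.Re e) => // w wz; apply: eA; rewrite -ball_normE /ball_ /= normr_modC.
  by rewrite modC_sub in wz; rewrite ltcE /= er eqxx.
move=> [d d0 dA]; apply/nbhs_ballP; exists (toC d); first by rewrite /= ltcE /= eqxx.
move=> w; rewrite -ball_normE /ball_ /= normr_modC ltcE /= eqxx /= => wz.
by apply: dA; rewrite modC_sub.
Qed.

Lemma nbhs_plane_time (p : C * R) (A : set (C * R)) :
  nbhs p A <-> exists2 d : R, 0 < d &
    forall w s, modC (w - p.1) < d -> `|s - p.2| < d -> A (w, s).
Proof.
split.
  move=> [[U V] /= [/nbhs_modC[d d0 dU] /nbhs_ballP[e e0 eV]] UVA].
  exists (Num.min d e); first by rewrite lt_min d0.
  move=> w s; rewrite !lt_min => /andP[wd _] /andP[_ se]; apply: UVA; split; first exact: dU.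
  by apply: eV; rewrite -ball_normE /ball_ /= distrC.
move=> [d d0 dA]; exists ([set w | modC (w - p.1) < d], [set s | `|s - p.2| < d]).
  split => /=; first by apply/nbhs_modC; exists d.
  by apply/nbhs_ballP; exists d => // y; rewrite -ball_normE /ball_ /= distrC.
by move=> [w s] /= [? ?]; exact: dA.
Qed.

Lemma cvg_modC {T : Type} (F : set_system T) {FF : Filter F} (f : T -> C) (l : C) :
  f @ F --> l <-> forall e : R, 0 < e -> F [set x | modC (f x - l) < e].
Proof.
split=> [fl e e0|h A /nbhs_modC[d d0 dA]].
  by apply: (fl [set w | modC (w - l) < e]); apply/nbhs_modC; exists e.
by have := h d d0; apply: (@filterS _ F) => x /= ?; apply: dA.
Qed.

Lemma nbhs_realE (x : R) (A : set R) :
  nbhs x A <-> exists2 d : R, 0 < d & forall y, `|y - x| < d -> A y.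
Proof.
split=> [/nbhs_ballP[d d0 dA]|[d d0 dA]].
  by exists d => // y yx; apply: dA; rewrite -ball_normE /ball_ /= distrC.
by apply/nbhs_ballP; exists d => // y; rewrite -ball_normE /ball_ /= distrC; exact: dA.
Qed.

(** Multiplying out the difference quotient readmits [y = x], where both sides vanish, and gives
    bounds that are linear in the increment and can be added. *)
Lemma is_rderivP (I : set R) (f : R -> C) (x : R) (l : C) :
  is_rderiv I f x l <-> forall e : R, 0 < e -> exists2 d : R, 0 < d &
    forall y, I y -> `|y - x| < d -> modC (f y - f x - l * toC (y - x)) <= e * `|y - x|.
Proof.
have key y : y != x ->
    modC (f y - f x - l * toC (y - x)) = modC (toC (y - x)^-1 * (f y - f x) - l) * `|y - x|.
  move=> yx; rewrite -(modC_toC (y - x)) -modCM mulrBl toCV mulrAC mulVf ?mul1r//.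
  by rewrite toC_eq0 subr_eq0.
rewrite /is_rderiv /quotient_filter; split.
  move=> /cvg_modC fl e e0; have := fl e e0; rewrite /within /= => /nbhs_realE[d d0 dd].
  exists d => // y Iy yx; have [->|yNx] := eqVneq y x.
    by rewrite !subrr toC0 mulr0 subrr modC0 normr0 mulr0.
  by rewrite key// ler_wpM2r// ltW//; apply: dd.
move=> h; apply/cvg_modC => e e0; have e20 : 0 < e / 2 by rewrite divr_gt0.
have [d d0 dd] := h _ e20; apply/nbhs_realE; exists d => // y yx /= yNx Iy.
have yx0 : 0 < `|y - x| by rewrite normr_gt0 subr_eq0.
have := dd y Iy yx; rewrite key// ler_pM2r// => /le_lt_trans; apply.
by rewrite ltr_pdivrMr// ltr_pMr// ltr1n.
Qed.

(** The limit that defines [rderiv] is determined only if the punctured neighbourhoods within [I]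
    form a proper filter; the next two lemmas provide this for the line and for the time
    interval. *)
Lemma is_rderiv_val (I : set R) (f : R -> C) (x : R) (l : C) :
  ProperFilter (within I (x^')) -> is_rderiv I f x l -> rderiv I f x = l.
Proof. by move=> PF h; apply: cvg_lim => //; exact: norm_hausdorff. Qed.

Lemma proper_setT (x : R) : ProperFilter (within [set: R] (x^')).
Proof.
apply: Build_ProperFilter_ex => P; rewrite /within /= => /nbhs_realE[d d0 dP].
exists (x + d / 2); apply: dP => //.
  by rewrite addrAC subrr add0r gtr0_norm ?divr_gt0// ltr_pdivrMr// ltr_pMr// ltr1n.
by rewrite -subr_eq0 addrAC subrr add0r mulf_neq0// ?gt_eqF// invr_neq0.
Qed.

Lemma proper_time (T x : R) : 0 < T -> time T x -> ProperFilter (within (time T) (x^')).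
Proof.
move=> T0 /andP[x0 xT].
apply: Build_ProperFilter_ex => P; rewrite /within /= => /nbhs_realE[d d0 dP].
(* Move towards the farther end: a displacement of at most [T / 2] then stays in the interval, also
   when [x] is an end point. *)
have [xT2|xT2] := lerP x (T / 2).
  pose h := Num.min (d / 2) (T / 2).
  have h0 : 0 < h by rewrite lt_min !divr_gt0.
  have hd : h <= d / 2 by rewrite ge_min lexx.
  have hT : h <= T / 2 by rewrite ge_min lexx orbT.
  exists (x + h); apply: dP.
  - by rewrite addrAC subrr add0r gtr0_norm//; lra.
  - by rewrite -subr_eq0 addrAC subrr add0r gt_eqF.
  - by apply/andP; split; lra.
pose h := Num.min (d / 2) (T / 2).
have h0 : 0 < h by rewrite lt_min !divr_gt0.
have hd : h <= d / 2 by rewrite ge_min lexx.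
have hT : h <= T / 2 by rewrite ge_min lexx orbT.
exists (x - h); apply: dP.
- by rewrite addrAC subrr add0r normrN gtr0_norm//; lra.
- by rewrite -subr_eq0 addrAC subrr add0r oppr_eq0 gt_eqF.
- by apply/andP; split; lra.
Qed.

End Balls.

Section Continuity.
Context {R : realType}.
Local Notation C := R[i].

Definition cont_at (D : set C) (f : C -> C) (z : C) : Prop :=
  forall e : R, 0 < e -> exists2 d : R, 0 < d &
    forall w, D w -> modC (w - z) < d -> modC (f w - f z) < e.

Lemma within_continuousP (E : set C) (f : C -> C) :
  {within E, continuous f} <-> forall z, E z -> cont_at E f z.
Proof.
rewrite subspace_continuousP; split=> h z Ez.
  move=> e e0; have /cvg_modC/(_ e e0) := h z Ez.
  rewrite /within /= => /nbhs_modC[d d0 dd]; exists d => // w Ew wz; exact: dd.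
apply/cvg_modC => e e0; have [d d0 dd] := h z Ez e e0.
by apply/nbhs_modC; exists d => // w wz Ew; exact: dd.
Qed.

Lemma within_slab_continuousP (E : set (C * R)) (f : C * R -> C) :
  {within E, continuous f} <-> forall z t, E (z, t) -> forall e : R, 0 < e ->
    exists2 d : R, 0 < d & forall w s, E (w, s) -> modC (w - z) < d -> `|s - t| < d ->
      modC (f (w, s) - f (z, t)) < e.
Proof.
rewrite subspace_continuousP; split=> h.
  move=> z t Ez e e0; have /cvg_modC/(_ e e0) := h _ Ez.
  rewrite /within /= => /nbhs_plane_time[d d0 dd]; exists d => // w s Ew wz st; exact: dd.
move=> [z t] Ez; apply/cvg_modC => e e0; have [d d0 dd] := h _ _ Ez e e0.
by apply/nbhs_plane_time; exists d => // w s wz st Ew; exact: dd.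
Qed.

Lemma continuous_realP (f : C -> R) :
  (forall z w, `|f w - f z| <= modC (w - z)) -> continuous f.
Proof.
move=> h z A /nbhs_realE[d d0 dA]; apply/nbhs_modC; exists d => // w wz.
by apply: dA; rewrite (le_lt_trans (h _ _)).
Qed.

Lemma continuous_modC : continuous (@modC R).
Proof.
apply: continuous_realP => z w; rewrite ler_norml modC_triB andbT.
by rewrite lerNl opprB modC_sub modC_triB.
Qed.

Lemma continuous_Re : continuous (@complex.Re R).
Proof.
by apply: continuous_realP => z w; rewrite -reN -reD Re_le_modC.
Qed.

Lemma continuous_Im : continuous (@complex.Im R).
Proof.
by apply: continuous_realP => z w; rewrite -imN -imD Im_le_modC.
Qed.

Lemma continuous_Complex : continuous (fun p : R * R => Complex p.1 p.2).
Proof.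
move=> [x y] A /nbhs_modC[d d0 dA].
have d20 : 0 < d / 2 by rewrite divr_gt0.
exists ([set u | `|u - x| < d / 2], [set v | `|v - y| < d / 2]).
  by split; apply/nbhs_realE; exists (d / 2).
move=> [u v] /= [ux vy]; apply: dA.
by rewrite (le_lt_trans (modC_le _))//= (splitr d) ltrD.
Qed.

Lemma compact_rect (M : R) :
  compact [set z : C | `|complex.Re z| <= M /\ `|complex.Im z| <= M].
Proof.
have -> : [set z : C | `|complex.Re z| <= M /\ `|complex.Im z| <= M] =
    (fun p : R * R => Complex p.1 p.2) @` (`[- M, M] `*` `[- M, M]).
  apply/seteqP; split=> [[a b] /= [aM bM]|_ [[a b] /= [aM bM] <-]] /=.
    exists (a, b) => //=; split; rewrite /= in_itv /=; first by rewrite -ler_norml.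
    by rewrite -ler_norml.
  by move: aM bM; rewrite !in_itv /= -!ler_norml.
apply: continuous_compact; first exact/continuous_subspaceT/continuous_Complex.
by apply: compact_setX; exact: segment_compact.
Qed.

Lemma compact_bounded_closed (K : set C) (M : R) :
  closed K -> (forall z, K z -> modC z <= M) -> compact K.
Proof.
move=> cK KM; apply: (subclosed_compact cK (compact_rect (M := M))) => z /KM zM /=.
by split; rewrite (le_trans _ zM)// ?Re_le_modC ?Im_le_modC.
Qed.

Lemma closed_disc (c : C) (r : R) : closed [set z | modC (z - c) <= r].
Proof.
have -> : [set z | modC (z - c) <= r] = (fun z => modC (z - c)) @^-1` [set x | x <= r] by [].
apply: preimage_closed => [z _|]; last exact: closed_le.
move: z; apply: continuous_realP => z w; have h := @continuous_modC.
rewrite (_ : w - z = (w - c) - (z - c)); last by ring.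
rewrite ler_norml modC_triB andbT lerNl opprB -modC_sub; apply: le_trans (modC_triB _ _) _.
by rewrite modC_sub modC_sub.
Qed.

Lemma closed_lowerbar : closed (@lowerbar R).
Proof.
have -> : @lowerbar R = @complex.Im R @^-1` [set x | x <= 0] by [].
by apply: preimage_closed => [z _|]; [exact: continuous_Im|exact: closed_le].
Qed.

Lemma compact_disc (c : C) (r : R) : compact [set z | modC (z - c) <= r].
Proof.
apply: (@compact_bounded_closed _ (r + modC c)); first exact: closed_disc.
by move=> z /= zr; rewrite -[z](subrK c) (le_trans (modCD _ _))// lerD2r.
Qed.

(** A Lebesgue number argument: [h] runs through the right neighbourhoods of 0, and compactness
    makes one threshold serve all points of [K]. *)
Lemma compact_uniform (K : set C) (P : R -> C -> Prop) : compact K ->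
  (forall z, K z -> exists2 d : R, 0 < d &
     forall w h, K w -> modC (w - z) < d -> 0 < h < d -> P h w) ->
  exists2 d : R, 0 < d & forall w h, K w -> 0 < h < d -> P h w.
Proof.
move=> /compact_near_coveringP cK H.
have := cK R (0 : R)^'+ (fun h w => K w -> P h w) _ _; case.
  move=> z Kz; have [d d0 dP] := H z Kz.
  exists ([set w | modC (w - z) < d], [set h | 0 < h < d]).
    split => /=; first by apply/nbhs_modC; exists d.
    rewrite /at_right /within /=; apply/nbhs_realE; exists d => // y; rewrite subr0 => yd y0.
    by apply/andP; split => //; apply: le_lt_trans yd; exact: ler_norm.
  by move=> [w h] /= [wz hd] Kw; apply: (dP w h).
move=> d d0 dP; exists d => // w h Kw /andP[h0 hd]; apply: (dP h) => //=.
by rewrite sub0r normrN gtr0_norm.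
Qed.

(** Heine's theorem in the form where the second point may leave [K] and range over [D], as
    differentiation under an integral over [K] requires. *)
Lemma uniform_cont_at (K D : set C) (f : C -> C) : compact K ->
  (forall z, K z -> D z /\ cont_at D f z) ->
  forall e : R, 0 < e -> exists2 d : R, 0 < d &
    forall z w, K z -> D w -> modC (w - z) < d -> modC (f w - f z) < e.
Proof.
move=> cK fD e e0.
pose P h z := forall w, D w -> modC (w - z) < h -> modC (f w - f z) < e.
have [z Kz|d d0 dP] := @compact_uniform K P cK.
  have e20 : 0 < e / 2 by rewrite divr_gt0.
  have [Dz /(_ _ e20)[d d0 dd]] := fD z Kz; exists (d / 2); first by rewrite divr_gt0.
  move=> u h Ku uz /andP[h0 hd] w Dw wu.
  have [Du _] := fD u Ku.
  rewrite (le_lt_trans (modC_tri _ (f z) _))// (splitr e) ltrD//.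
    apply: dd => //; rewrite (le_lt_trans (modC_tri _ u _))// (splitr d) ltrD//.
    exact: lt_trans hd.
  rewrite modC_sub; apply: dd => //; apply: lt_trans uz _; lra.
exists (d / 2); first by rewrite divr_gt0.
by move=> z w Kz Dw wz; apply: (dP z (d / 2)) => //; apply/andP; split; lra.
Qed.

End Continuity.

(** * The mean value inequality for complex-valued functions *)

Section MeanValue.
Context {R : realType}.
Local Notation C := R[i].

Lemma is_derive_eps (r : R -> R) (x l : R) :
  (forall e : R, 0 < e -> exists2 d : R, 0 < d &
    forall y, `|y - x| < d -> `|r y - r x - l * (y - x)| <= e * `|y - x|) ->
  is_derive x 1 r l.
Proof.
move=> h.
have H : h^-1 *: ((r \o shift x) (h *: (1 : R^o)) - r x) @[h --> 0^'] --> (l : R^o).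
  apply/cvgrPdist_lt => e e0; have e20 : 0 < e / 2 by rewrite divr_gt0.
  have [d d0 dd] := h _ e20; apply/nbhs_realE; exists d => // y; rewrite subr0 => yd y0 /=.
  have := dd (y + x); rewrite addrK => /(_ yd).
  have yp : 0 < `|y| by rewrite normr_gt0.
  have -> : y *: (1 : R^o) = y by rewrite /GRing.scale /= mulr1.
  have -> : l - y^-1 *: (r (y + x) - r x) = - (y^-1 * (r (y + x) - r x - l * y)).
    by rewrite /GRing.scale /= ; field.
  rewrite normrN normrM normfV => h1.
  rewrite mulrC ltr_pdivrMr//; apply: le_lt_trans h1 _.
  by rewrite ltr_pM2r// ltr_pdivrMr// ltr_pMr// ltr1n.
apply: DeriveDef; first by apply/cvg_ex; exists l.
by apply: cvg_lim => //; exact: norm_hausdorff.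
Qed.

(** There is no mean value equality for complex values, so the defect is rotated onto the positive
    axis and the real theorem is applied to a real part. Derivatives relative to [I] are two-sided
    at interior points of the segment; at its ends continuity is enough. *)
Lemma mean_value_inequality (I : set R) (f : R -> C) (l : C) (M a b : R) :
  a <= b -> (forall x, a <= x <= b -> I x) ->
  (forall x, a <= x <= b -> exists2 l', is_rderiv I f x l' & modC (l' - l) <= M) ->
  modC (f b - f a - l * toC (b - a)) <= M * (b - a).
Proof.
move=> ab abI df.
set D := f b - f a - l * toC (b - a).
have [D0|D0] := eqVneq D 0.
  rewrite D0 modC0 mulr_ge0 ?subr_ge0//.
  by have [|l' _] := df a _; [rewrite lexx|apply: le_trans; exact: modC_ge0].
have Dp : 0 < modC D by rewrite modC_gt0.
pose u : C := Num.conj D / toC (modC D).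
have u1 : modC u = 1.
  by rewrite modCM modC_conj modCV modC_toC gtr0_norm// mulfV// gt_eqF.
have uD : u * D = toC (modC D).
  rewrite /u mulrAC (_ : Num.conj D * D = toC (modC D) * toC (modC D)).
    by rewrite mulfK// toC_eq0 gt_eqF.
  rewrite -toCM -expr2 modC_sqr conjE; case: (D) => c d; apply: complexP => /=; ring.
(* The increment of [r] over the segment is exactly the modulus of [D], while its derivative is at
   most [M] because [u] has modulus 1. *)
pose r x := complex.Re (u * (f x - l * toC x)).
have key x l' y : r y - r x - complex.Re (u * (l' - l)) * (y - x) =
    complex.Re (u * (f y - f x - l' * toC (y - x))).
  rewrite -[RHS]addr0 /r toCB; move: (f x) (f y) => p q.
  case: u {uD u1 r} => ? ?; case: p => ? ?; case: q => ? ?; case: l' => ? ?; case: l {df D D0 Dp} => ? ? /=; ring.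
have bnd x l' : is_rderiv I f x l' -> forall e : R, 0 < e -> exists2 d : R, 0 < d &
    forall y, I y -> `|y - x| < d -> `|r y - r x - complex.Re (u * (l' - l)) * (y - x)| <= e * `|y - x|.
  move=> /is_rderivP h e e0; have [d d0 dd] := h e e0; exists d => // y Iy yx.
  by rewrite key (le_trans (Re_le_modC _))// modCM u1 mul1r dd.
have df' : forall x, exists l', a <= x <= b -> is_rderiv I f x l' /\ modC (l' - l) <= M.
  move=> x; have [/df[l' h1 h2]|_] := boolP (a <= x <= b); first by exists l'.
  by exists 0.
have [l' dl'] := choice df'.
have [||c] := @MVT_segment R r (fun x => complex.Re (u * (l' x - l))) a b ab.
- move=> x; rewrite in_itv /= => /andP[ax xb]; apply: is_derive_eps => e e0.
  have axb : a <= x <= b by rewrite !ltW.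
  have [dx _] := dl' x axb; have [d d0 dd] := bnd _ _ dx e e0.
  exists (Num.min d (Num.min (x - a) (b - x))); first by rewrite !lt_min d0 !subr_gt0 ax.
  move=> y; rewrite !lt_min => /and3P[yd]; rewrite !ltr_norml => /andP[y1 _] /andP[_ y2].
  by apply: dd => //; apply: abI; apply/andP; split; lra.
- apply/subspace_continuousP => x; rewrite /= in_itv /= => axb.
  have [dx _] := dl' x axb; apply/cvgrPdist_lt => e e0.
  set k := complex.Re (u * (l' x - l)).
  have k1 : 0 < `|k| + 1 by rewrite ltr_wpDl.
  have [d d0 dd] := bnd _ _ dx 1 ltr01.
  apply/nbhs_realE; exists (Num.min d (e / (`|k| + 1))); first by rewrite lt_min d0 divr_gt0.
  move=> y; rewrite lt_min => /andP[yd ye]; rewrite /= in_itv /= => ayb.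
  have := dd y (abI _ ayb) yd; rewrite -/k mul1r => h.
  rewrite distrC; rewrite ltr_pdivlMr// in ye; apply: le_lt_trans ye.
  rewrite mulrDr mulr1 -lerBlDl; apply: le_trans h; rewrite mulrC -normrM; exact: lerB_dist.
rewrite in_itv /= => cab rE.
have : r b - r a = modC D.
  by rewrite /r -raddfB -mulrBr (_ : f b - l * toC b - _ = D) ?uD// /D toCB; ring.
rewrite rE => <-; rewrite ler_wpM2r ?subr_ge0//.
have [_] := dl' c cab; apply: le_trans.
by rewrite -[X in _ <= X]mul1r -u1 -modCM (le_trans (ler_norm _))// Re_le_modC.
Qed.

End MeanValue.

(** * Complex derivatives and integrals *)

Section ComplexDerivative.
Context {R : realType}.
Local Notation C := R[i].
Implicit Types (f g : C -> C) (z l m : C).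

(** Differentiability with real moduli and no division, in the shape of [is_rderivP], so that it
    composes directly with paths. *)
Definition cdiff f z l : Prop := forall e : R, 0 < e -> exists2 d : R, 0 < d &
  forall w, modC (w - z) < d -> modC (f w - f z - l * (w - z)) <= e * modC (w - z).

Lemma cdiff_lip f z l : cdiff f z l -> exists2 d : R, 0 < d &
  forall w, modC (w - z) < d -> modC (f w - f z) <= (modC l + 1) * modC (w - z).
Proof.
move=> /(_ 1 ltr01)[d d0 dd]; exists d => // w wz.
rewrite -(subrK (l * (w - z)) (f w - f z)) (le_trans (modCD _ _))// modCM.
by rewrite mulrDl addrC lerD2l dd.
Qed.

Lemma cdiff_cont (D : set C) f z l : cdiff f z l -> cont_at D f z.
Proof.
move=> /cdiff_lip[d d0 dd] e e0.
have l0 : 0 < modC l + 1 by rewrite ltr_wpDl ?modC_ge0.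
exists (Num.min d (e / (modC l + 1))); first by rewrite lt_min d0 divr_gt0.
move=> w _; rewrite lt_min => /andP[/dd wd]; rewrite ltr_pdivlMr// mulrC.
exact: le_lt_trans.
Qed.

Lemma cdiff_cst c z : cdiff (fun=> c) z 0.
Proof.
by move=> e e0; exists 1 => // w _; rewrite subrr mul0r subrr modC0 mulr_ge0 ?modC_ge0// ltW.
Qed.

Lemma cdiff_id z : cdiff id z 1.
Proof.
by move=> e e0; exists 1 => // w _; rewrite mul1r subrr modC0 mulr_ge0 ?modC_ge0// ltW.
Qed.

Lemma cdiffD f g z l m : cdiff f z l -> cdiff g z m -> cdiff (fun w => f w + g w) z (l + m).
Proof.
move=> hf hg e e0; have e20 : 0 < e / 2 by rewrite divr_gt0.
have [d d0 dd] := hf _ e20; have [d' d'0 dd'] := hg _ e20.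
exists (Num.min d d'); first by rewrite lt_min d0.
move=> w; rewrite lt_min => /andP[/dd h /dd' h'].
rewrite (_ : _ - _ - _ = (f w - f z - l * (w - z)) + (g w - g z - m * (w - z))); last by ring.
by rewrite (le_trans (modCD _ _))// (splitr e) mulrDl lerD.
Qed.

Lemma cdiffM f g z l m : cdiff f z l -> cdiff g z m ->
  cdiff (fun w => f w * g w) z (l * g z + f z * m).
Proof.
move=> hf hg e e0.
have [d1 d10 lf] := cdiff_lip hf.
pose B := modC l + 1; pose A := modC (g z) + 1; pose D := modC (f z) + 1.
have B0 : 0 < B by rewrite ltr_wpDl ?modC_ge0.
have A0 : 0 < A by rewrite ltr_wpDl ?modC_ge0.
have D0 : 0 < D by rewrite ltr_wpDl ?modC_ge0.
have e1 : 0 < e / 3 / A by rewrite !divr_gt0.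
have e2 : 0 < e / 3 / D by rewrite !divr_gt0.
have e3 : 0 < e / 3 / B by rewrite !divr_gt0.
have [d2 d20 h2] := hf _ e1; have [d3 d30 h3] := hg _ e2.
have [d4 d40 h4] := @cdiff_cont setT _ _ _ hg _ e3.
exists (Num.min (Num.min d1 d2) (Num.min d3 d4)); first by rewrite !lt_min d10 d20 d30.
move=> w; rewrite !lt_min => /andP[/andP[/lf k1 /h2 k2] /andP[/h3 k3 /(h4 w I) k4]].
rewrite (_ : _ - _ - _ = (f w - f z - l * (w - z)) * g z +
   (f w - f z) * (g w - g z) + f z * (g w - g z - m * (w - z))); last by ring.
rewrite (le_trans (modCD _ _))// (_ : e = e / 3 + e / 3 + e / 3); last by field.
rewrite [leRHS]mulrDl [in leRHS]mulrDl; apply: lerD; first (apply: le_trans (modCD _ _) _; apply: lerD).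
- rewrite modCM; have k5 : modC (g z) <= A by rewrite lerDl.
  apply: le_trans (_ : e / 3 / A * modC (w - z) * A <= _); first by rewrite ler_pM ?modC_ge0.
  by rewrite mulrAC mulfVK// gt_eqF.
- rewrite modCM; apply: le_trans (_ : B * modC (w - z) * (e / 3 / B) <= _).
    by rewrite ler_pM ?modC_ge0// ltW.
  by rewrite mulrC mulrA mulfVK// gt_eqF.
rewrite modCM; have k5 : modC (f z) <= D by rewrite lerDl.
apply: le_trans (_ : D * (e / 3 / D * modC (w - z)) <= _); first by rewrite ler_pM ?modC_ge0.
by rewrite mulrA (mulrC D) mulfVK// gt_eqF.
Qed.

Lemma cdiffN f z l : cdiff f z l -> cdiff (fun w => - f w) z (- l).
Proof.
move=> h e e0; have [d d0 dd] := h e e0; exists d => // w /dd.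
by rewrite -modCN; congr (modC _ <= _); ring.
Qed.

Lemma cdiffB f g z l m : cdiff f z l -> cdiff g z m -> cdiff (fun w => f w - g w) z (l - m).
Proof. by move=> hf hg; apply: cdiffD => //; exact: cdiffN. Qed.

Lemma cdiffZ c f z l : cdiff f z l -> cdiff (fun w => c * f w) z (c * l).
Proof.
move=> h; rewrite -[c * l]add0r -[0](mul0r (f z)).
by apply: cdiffM h; exact: cdiff_cst.
Qed.

Lemma cdiffV f z l : f z != 0 -> cdiff f z l -> cdiff (fun w => (f w)^-1) z (- l / f z ^+ 2).
Proof.
move=> fz0 hf e e0.
have a0 : 0 < modC (f z) by rewrite modC_gt0.
set a := modC (f z) in a0.
have [d1 d10 lf] := cdiff_lip hf.
have a20 : 0 < a / 2 by rewrite divr_gt0.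
have [d2 d20 h2] := @cdiff_cont setT _ _ _ hf _ a20.
pose B := modC l + 1.
have B0 : 0 < B by rewrite ltr_wpDl ?modC_ge0.
have e1 : 0 < e * a ^+ 2 / 4 by rewrite divr_gt0// mulr_gt0// exprn_gt0.
have e2 : 0 < e * a ^+ 3 / 4 / B / B by rewrite !divr_gt0// mulr_gt0// exprn_gt0.
have [d3 d30 h3] := hf _ e1.
exists (Num.min (Num.min d1 d2) (Num.min d3 (e * a ^+ 3 / 4 / B / B))).
  by rewrite !lt_min d10 d20 d30.
move=> w; rewrite !lt_min => /andP[/andP[/lf k1 /(h2 w I) k2] /andP[/h3 k3 k4]].
have fw : a / 2 < modC (f w).
  have := modC_triB (f z) (f w); rewrite -/a modC_sub; lra.
have fw0 : f w != 0 by rewrite -modC_gt0 (lt_trans _ fw).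
rewrite (_ : _ - _ - _ = (f w * f z ^+ 2)^-1 *
   (- (f z) * (f w - f z - l * (w - z)) + l * (w - z) * (f w - f z))); last by field; apply/andP.
rewrite modCM modCV mulrC ler_pdivrMr; last by rewrite modCM modCX mulr_gt0 ?exprn_gt0// (lt_trans _ fw).
set h := modC (w - z) in k1 k3 k4 *.
have h0 : 0 <= h by exact: modC_ge0.
apply: le_trans (modCD _ _) _; rewrite [modC (f w * _)]modCM modCX !modCM modCN -/a -/h.
have s1 : a * modC (f w - f z - l * (w - z)) <= e * a ^+ 3 / 4 * h.
  rewrite (_ : _ / 4 * h = a * (e * a ^+ 2 / 4 * h)); last by ring.
  by rewrite ler_pM2l.
have s2 : modC l * h * modC (f w - f z) <= e * a ^+ 3 / 4 * h.
  apply: le_trans (_ : B * h * (B * h) <= _).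
    rewrite ler_pM ?modC_ge0 ?mulr_ge0 ?modC_ge0// ler_wpM2r// lerDl//.
  have := ltW k4; rewrite 2?ler_pdivlMr// => k5.
  rewrite (_ : B * h * (B * h) = h * B * B * h); last by ring.
  by rewrite ler_wpM2r.
have s3 : e * a ^+ 3 / 2 * h <= e * h * (modC (f w) * a ^+ 2).
  rewrite (_ : _ / 2 * h = e * h * (a / 2 * a ^+ 2)); last by field.
  apply: ler_wpM2l; first by rewrite mulr_ge0// ltW.
  by apply: ler_wpM2r; [exact: sqr_ge0|exact: ltW].
apply: le_trans s3; apply: le_trans (lerD s1 s2) _.
by rewrite le_eqVlt; apply/orP; left; apply/eqP; field.
Qed.

Lemma cdiff_near f g z l (d : R) : 0 < d -> (forall w, modC (w - z) < d -> f w = g w) ->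
  cdiff f z l -> cdiff g z l.
Proof.
move=> d0 fg h e e0; have [d' d'0 dd] := h e e0.
exists (Num.min d d'); first by rewrite lt_min d0.
move=> w; rewrite lt_min => /andP[wd wd']; rewrite -!fg ?subrr ?modC0//; exact: dd.
Qed.

(** Derivatives along horizontal and vertical lines, circles and straight segments are all instances
    of this chain rule. *)
Lemma cdiff_path (I : set R) f (p : R -> C) x l m :
  is_rderiv I p x m -> cdiff f (p x) l -> is_rderiv I (f \o p) x (l * m).
Proof.
move=> /is_rderivP hp hf; apply/is_rderivP => e e0.
pose A := modC l + 1; pose B := modC m + 1.
have A0 : 0 < A by rewrite ltr_wpDl ?modC_ge0.
have B0 : 0 < B by rewrite ltr_wpDl ?modC_ge0.
have e1 : 0 < e / 2 / A by rewrite !divr_gt0.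
have e2 : 0 < e / 2 / B by rewrite !divr_gt0.
have [d1 d10 h1] := hp 1 ltr01; have [d2 d20 h2] := hp _ e1.
have [d3 d30 h3] := hf _ e2.
exists (Num.min (Num.min d1 d2) (d3 / B)); first by rewrite !lt_min d10 d20 divr_gt0.
move=> y Iy; rewrite !lt_min => /andP[/andP[/(h1 y Iy) k1 /(h2 y Iy) k2]].
rewrite ltr_pdivlMr// => k3.
have k4 : modC (p y - p x) <= B * `|y - x|.
  rewrite -(subrK (m * toC (y - x)) (p y - p x)) (le_trans (modCD _ _))//.
  by rewrite modCM modC_toC mulrDl addrC lerD2l.
have k5 : modC (p y - p x) < d3 by apply: le_lt_trans k4 _; rewrite mulrC.
rewrite /= (_ : _ - _ - _ = (f (p y) - f (p x) - l * (p y - p x)) +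
  l * (p y - p x - m * toC (y - x))); last by ring.
rewrite (le_trans (modCD _ _))// (splitr e) mulrDl lerD//.
  apply: le_trans (h3 _ k5) _.
  apply: le_trans (_ : e / 2 / B * (B * `|y - x|) <= _); first by rewrite ler_wpM2l// ltW.
  by rewrite mulrA mulfVK// gt_eqF.
rewrite modCM; apply: le_trans (_ : A * (e / 2 / A * `|y - x|) <= _).
  by rewrite ler_pM ?modC_ge0// lerDl.
by rewrite mulrA (mulrC A) mulfVK// gt_eqF.
Qed.

Lemma is_rderiv_affine (I : set R) (a b : C) x : is_rderiv I (fun s => a + b * toC s) x b.
Proof.
apply/is_rderivP => e e0; exists 1 => // y _ _.
by rewrite /= toCB (_ : a + b * toC y - _ - _ = 0) ?modC0 ?mulr_ge0 ?(ltW e0)//; ring.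
Qed.

Lemma is_rderiv_eq (I : set R) (p q : R -> C) x l : p =1 q -> is_rderiv I p x l -> is_rderiv I q x l.
Proof. by move=> /funext ->. Qed.

Lemma cdiff_horizontal (I : set R) f z l : cdiff f z l ->
  is_rderiv I (fun s => f (Complex s (complex.Im z))) (complex.Re z) l.
Proof.
move=> h; rewrite -[l]mulr1; pose p s := iC * toC (complex.Im z) + 1 * toC s : C.
have pE s : p s = Complex s (complex.Im z) by apply: complexP => /=; ring.
apply: (@is_rderiv_eq _ (f \o p)) => [s|]; first by rewrite /= pE.
apply: cdiff_path; first exact: is_rderiv_affine.
by rewrite pE; case: z h {p pE}.
Qed.

Lemma cdiff_vertical (I : set R) f z l : cdiff f z l ->
  is_rderiv I (fun s => f (Complex (complex.Re z) s)) (complex.Im z) (iC * l).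
Proof.
move=> h; rewrite mulrC; pose p s := toC (complex.Re z) + iC * toC s : C.
have pE s : p s = Complex (complex.Re z) s by apply: complexP => /=; ring.
apply: (@is_rderiv_eq _ (f \o p)) => [s|]; first by rewrite /= pE.
apply: cdiff_path; first exact: is_rderiv_affine.
by rewrite pE; case: z h {p pE}.
Qed.

(** The Cauchy-Riemann equations: the vertical derivative is [i] times the horizontal one, so the
    two halves of [dz] add up to [l]. *)
Lemma cdiff_dz (F : C * R -> C) z t l : cdiff (fun w => F (w, t)) z l ->
  [/\ dx F (z, t) = l, dy F (z, t) = iC * l & dz F (z, t) = l].
Proof.
move=> h.
have hx : dx F (z, t) = l.
  exact: (is_rderiv_val (proper_setT _) (cdiff_horizontal setT h)).
have hy : dy F (z, t) = iC * l.
  exact: (is_rderiv_val (proper_setT _) (cdiff_vertical setT h)).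
split => //; rewrite /dz hx hy mulrA iCi; by field.
Qed.

Lemma cdiff_uniq f z l m : cdiff f z l -> cdiff f z m -> l = m.
Proof.
move=> h1 h2.
have [<- _ _] := @cdiff_dz (fun p => f p.1) z 0 l h1.
by have [<- _ _] := @cdiff_dz (fun p => f p.1) z 0 m h2.
Qed.

Lemma derivable_cdiff f z : derivable f z 1 -> cdiff f z (derive1 f z).
Proof.
move=> df e e0.
have : h^-1 *: (f (h + z) - f z) @[h --> 0^'] --> derive1 f z.
  have -> : derive1 f z = lim (h^-1 *: (f (h + z) - f z) @[h --> 0^']) by [].
  move: df; rewrite /derivable.
  suff -> : (fun h : C => h^-1 *: ((f \o shift z) (h *: 1) - f z)) =
            (fun h => h^-1 *: (f (h + z) - f z)) by [].
  by apply/funext => h /=; rewrite /GRing.scale /= mulr1.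
move=> /cvg_modC/(_ e e0); rewrite /dnbhs /within /= => /nbhs_modC[d d0 dd].
exists d => // w wz; have [->|wNz] := eqVneq w z; first by rewrite !subrr mulr0 subrr modC0 mulr0.
have wz0 : w - z != 0 by rewrite subr_eq0.
have := dd (w - z); rewrite subr0 subrK => /(_ wz wz0) h.
have := ltW h; rewrite /GRing.scale /= => {}h.
rewrite (_ : _ - _ - _ = ((w - z)^-1 * (f w - f z) - derive1 f z) * (w - z)).
  by rewrite modCM ler_wpM2r ?modC_ge0.
by field.
Qed.

End ComplexDerivative.

(** * Joint differentiability in space and time *)

Section Slab.
Context {R : realType}.
Local Notation C := R[i].

(** The increment is split into time at fixed [z], then a horizontal and a vertical step at time
    [s]. The time derivative thus enters at [(z, t)] only, and the space derivatives at nearby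
    points and times, whence their continuity. *)
Lemma slab_differentiable (T : R) (f fx fy : C * R -> C) (z : C) (t : R) (ft : C) :
  slab T (z, t) ->
  (forall p, slab T p -> is_partial T dirx f p (fx p) /\ is_partial T diry f p (fy p)) ->
  is_partial T dirt f (z, t) ft ->
  (forall e : R, 0 < e -> exists2 d : R, 0 < d & forall w s, slab T (w, s) ->
     modC (w - z) < d -> `|s - t| < d ->
     modC (fx (w, s) - fx (z, t)) < e /\ modC (fy (w, s) - fy (z, t)) < e) ->
  forall e : R, 0 < e -> exists2 d : R, 0 < d & forall w s, time T s ->
    modC (w - z) < d -> `|s - t| < d ->
    modC (f (w, s) - f (z, t) - fx (z, t) * toC (complex.Re (w - z))
          - fy (z, t) * toC (complex.Im (w - z)) - ft * toC (s - t))
      <= e * (modC (w - z) + `|s - t|).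
Proof.
move=> [/= zl tT] pf /is_rderivP pt cf e e0.
have e30 : 0 < e / 3 by rewrite divr_gt0.
have [d1 d10 h1] := pt _ e30; have [d2 d20 h2] := cf _ e30.
have zl0 : 0 < - complex.Im z by rewrite oppr_gt0.
(* [d2 / 2] keeps the corner of the path within [d2] of [z], and the depth of [z] keeps it in the
   half plane. *)
exists (Num.min (Num.min d1 (d2 / 2)) (- complex.Im z)); first by rewrite !lt_min d10 divr_gt0.
move=> w s sT; rewrite !lt_min => /andP[/andP[wd1 wd2] wl] /andP[/andP[sd1 sd2] _].
have aux (a b : R) : `|a - complex.Re z| <= modC (w - z) -> `|b - complex.Im z| <= modC (w - z) ->
    slab T (Complex a b, s) /\ modC (Complex a b - z) < d2.
  move=> ha hb; split.
    split=> //=; rewrite /lower /=; have := le_lt_trans (ler_norm _) (le_lt_trans hb wl); lra.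
  apply: le_lt_trans (modC_le _) _; rewrite reD imD reN imN /=; lra.
have hRe : `|complex.Re w - complex.Re z| <= modC (w - z) by rewrite -reN -reD Re_le_modC.
have hIm : `|complex.Im w - complex.Im z| <= modC (w - z) by rewrite -imN -imD Im_le_modC.
have mid (a b x : R) : a <= x <= b \/ b <= x <= a -> `|x - a| <= `|b - a|.
  by move=> h; rewrite ler_norml; have := ler_norm (b - a); have := lerNnormlW (lexx `|b - a|);
    case: h => /andP[? ?] ? ?; apply/andP; split; lra.
have mvi (g dg : R -> C) (l : C) (a b : R) : (forall x, a <= x <= b \/ b <= x <= a ->
      is_rderiv setT g x (dg x) /\ modC (dg x - l) <= e / 3) ->
    modC (g b - g a - l * toC (b - a)) <= e / 3 * `|b - a|.
  move=> hg; have [ab|ba] := lerP a b.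
    apply: (@mean_value_inequality _ setT) => // x xab.
    by have [] := hg x (or_introl xab); exists (dg x).
  have := @mean_value_inequality R setT g l (e / 3) b a (ltW ba) (fun _ _ => Logic.I).
  have /[swap]/[apply] : forall x, b <= x <= a -> exists2 l', is_rderiv setT g x l' & modC (l' - l) <= e / 3.
    by move=> x xab; have [] := hg x (or_intror xab); exists (dg x).
  by apply: le_trans; rewrite -modCN !toCB le_eqVlt; apply/orP; left; apply/eqP; congr modC; ring.
have k1 : modC (f (Complex (complex.Re w) (complex.Im z), s) - f (z, s)
    - fx (z, t) * toC (complex.Re w - complex.Re z)) <= e / 3 * `|complex.Re w - complex.Re z|.
  pose g x := f (Complex x (complex.Im z), s).
  have -> : f (z, s) = g (complex.Re z) by rewrite /g; case: (z).
  apply: (mvi g (fun x => fx (Complex x (complex.Im z), s))) => x hx.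
  have [||hs hd] := aux x (complex.Im z).
  - by apply: le_trans hRe; exact: mid.
  - by rewrite subrr normr0 modC_ge0.
  split; last by have [|/ltW] := h2 _ _ hs hd => //; lra.
  have [h _] := pf _ hs; exact h.
have k2 : modC (f (w, s) - f (Complex (complex.Re w) (complex.Im z), s)
    - fy (z, t) * toC (complex.Im w - complex.Im z)) <= e / 3 * `|complex.Im w - complex.Im z|.
  pose g x := f (Complex (complex.Re w) x, s).
  have -> : f (w, s) = g (complex.Im w) by rewrite /g; case: (w).
  apply: (mvi g (fun x => fy (Complex (complex.Re w) x, s))) => x hx.
  have [||hs hd] := aux (complex.Re w) x; first exact: hRe.
  - by apply: le_trans hIm; exact: mid.
  split; last by have [|_ /ltW] := h2 _ _ hs hd => //; lra.
  have [_ h] := pf _ hs; exact h.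
have k3 : modC (f (z, s) - f (z, t) - ft * toC (s - t)) <= e / 3 * `|s - t|.
  exact: (h1 s sT sd1).
rewrite !reD !imD !reN !imN.
set A := f (Complex _ _, s) in k1 k2.
rewrite (_ : _ - _ - _ - _ - _ = (A - f (z, s) - fx (z, t) * toC (complex.Re w - complex.Re z)) +
  (f (w, s) - A - fy (z, t) * toC (complex.Im w - complex.Im z)) +
  (f (z, s) - f (z, t) - ft * toC (s - t))); last by ring.
apply: le_trans (modCD _ _) _; apply: le_trans (lerD (modCD _ _) (lexx _)) _.
apply: le_trans (lerD (lerD k1 k2) k3) _.
have m0 := modC_ge0 (w - z).
have : e / 3 * `|complex.Re w - complex.Re z| <= e / 3 * modC (w - z) by rewrite ler_wpM2l// ltW.
have : e / 3 * `|complex.Im w - complex.Im z| <= e / 3 * modC (w - z) by rewrite ler_wpM2l// ltW.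
have : 0 <= e * modC (w - z) by rewrite mulr_ge0// ltW.
have : 0 <= e * `|s - t| by rewrite mulr_ge0// ltW.
by rewrite mulrDr; lra.
Qed.

End Slab.

Section ContAt.
Context {R : realType}.
Local Notation C := R[i].

Lemma cont_atM (D : set C) (f g : C -> C) z : cont_at D f z -> cont_at D g z ->
  cont_at D (fun w => f w * g w) z.
Proof.
move=> cf cg e e0; pose A := modC (f z) + 1; pose B := modC (g z) + 1.
have A0 : 0 < A by rewrite ltr_wpDl ?modC_ge0.
have B0 : 0 < B by rewrite ltr_wpDl ?modC_ge0.
have e1 : 0 < e / 2 / A by rewrite !divr_gt0.
have e2 : 0 < e / 2 / B by rewrite !divr_gt0.
have [d1 d10 h1] := cf _ e2; have [d2 d20 h2] := cg _ e1; have [d3 d30 h3] := cg _ ltr01.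
exists (Num.min d1 (Num.min d2 d3)); first by rewrite !lt_min d10 d20.
move=> w Dw; rewrite !lt_min => /and3P[/(h1 w Dw) k1 /(h2 w Dw) k2 /(h3 w Dw) k3].
have k4 : modC (g w) <= B.
  by rewrite -(subrK (g z) (g w)) (le_trans (modCD _ _))// addrC lerD2l ltW.
rewrite (_ : _ - _ = (f w - f z) * g w + f z * (g w - g z)); last by ring.
apply: le_lt_trans (modCD _ _) _; rewrite !modCM (splitr e).
apply: ler_ltD; last first.
  apply: le_lt_trans (_ : A * modC (g w - g z) < _); first by rewrite ler_wpM2r ?modC_ge0// lerDl.
  by rewrite mulrC -ltr_pdivlMr.
by apply: le_trans (_ : e / 2 / B * B <= _); [rewrite ler_pM ?modC_ge0// ltW|rewrite mulfVK// gt_eqF].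
Qed.

Lemma cont_atD (D : set C) (f g : C -> C) z : cont_at D f z -> cont_at D g z ->
  cont_at D (fun w => f w + g w) z.
Proof.
move=> cf cg e e0; have e2 : 0 < e / 2 by rewrite divr_gt0.
have [d1 d10 h1] := cf _ e2; have [d2 d20 h2] := cg _ e2.
exists (Num.min d1 d2); first by rewrite !lt_min d10.
move=> w Dw; rewrite !lt_min => /andP[/(h1 w Dw) k1 /(h2 w Dw) k2].
rewrite (_ : _ - _ = (f w - f z) + (g w - g z)); last by ring.
by rewrite (le_lt_trans (modCD _ _))// (splitr e) ltrD.
Qed.

Lemma cont_at_cst (D : set C) (c : C) z : cont_at D (fun=> c) z.
Proof. by move=> e e0; exists 1 => // w _ _; rewrite subrr modC0. Qed.

Lemma cont_atN (D : set C) (f : C -> C) z : cont_at D f z -> cont_at D (fun w => - f w) z.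
Proof.
by move=> h e e0; have [d d0 dd] := h e e0; exists d => // w Dw /(dd w Dw); rewrite -opprD modCN.
Qed.

Lemma cont_atB (D : set C) (f g : C -> C) z : cont_at D f z -> cont_at D g z ->
  cont_at D (fun w => f w - g w) z.
Proof. by move=> cf cg; apply: cont_atD => //; exact: cont_atN. Qed.

Lemma cont_at_conj (D : set C) (f : C -> C) z : cont_at D f z -> cont_at D (fun w => Num.conj (f w)) z.
Proof.
move=> h e e0; have [d d0 dd] := h e e0; exists d => // w Dw /(dd w Dw).
by rewrite -rmorphB /= modC_conj.
Qed.

Lemma cont_at_id (D : set C) z : cont_at D id z.
Proof. by move=> e e0; exists e. Qed.

Lemma cont_atV (D : set C) (f : C -> C) z : f z != 0 -> cont_at D f z ->
  cont_at D (fun w => (f w)^-1) z.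
Proof.
move=> fz0 cf e e0; have a0 : 0 < modC (f z) by rewrite modC_gt0.
set a := modC (f z) in a0.
have a20 : 0 < a / 2 by rewrite divr_gt0.
have e1 : 0 < e * (a ^+ 2 / 2) by rewrite mulr_gt0// divr_gt0// exprn_gt0.
have [d1 d10 h1] := cf _ a20; have [d2 d20 h2] := cf _ e1.
exists (Num.min d1 d2); first by rewrite lt_min d10.
move=> w Dw; rewrite lt_min => /andP[/(h1 w Dw) k1 /(h2 w Dw) k2].
have fw : a / 2 < modC (f w).
  have := modC_triB (f z) (f w); rewrite -/a modC_sub; lra.
have fw0 : f w != 0 by rewrite -modC_gt0 (lt_trans _ fw).
rewrite (_ : _ - _ = (f z - f w) / (f w * f z)); last by field; exact/andP.
rewrite modCM modCV modC_sub ltr_pdivrMr; last by rewrite modC_gt0 mulf_neq0.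
apply: lt_le_trans k2 _; rewrite ler_pM2l// modCM -/a expr2 -mulrA mulrC ler_pM2r//.
have : a * a / 2 <= modC (f w) * a by rewrite mulrAC ler_pM2r// ltW.
lra.
Qed.

End ContAt.

(** * Integrals of continuous functions over segments *)

Section RealIntegral.
Context {R : realType}.
Local Notation mu := (@lebesgue_measure R).
Implicit Types (f g : R -> R) (a b : R).

Definition rint a b f : R := \int[mu]_(x in `[a, b]) f x.

Lemma rint_integrable a b f : continuous f -> mu.-integrable `[a, b] (EFin \o f).
Proof.
move=> cf; apply: continuous_compact_integrable; first exact: segment_compact.
exact: continuous_subspaceT.
Qed.

Lemma rintD a b f g : continuous f -> continuous g ->
  rint a b (fun x => f x + g x) = rint a b f + rint a b g.
Proof. by move=> cf cg; apply: RintegralD => //; exact: rint_integrable. Qed.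

Lemma rintZ a b k f : continuous f -> rint a b (fun x => k * f x) = k * rint a b f.
Proof. by move=> cf; apply: RintegralZl => //; exact: rint_integrable. Qed.

Lemma le_rint a b f g : continuous f -> continuous g ->
  (forall x, a <= x <= b -> f x <= g x) -> rint a b f <= rint a b g.
Proof.
move=> cf cg fg; apply: le_Rintegral => //; exact: rint_integrable.
Qed.

Lemma rint_ge0 a b f : (forall x, a <= x <= b -> 0 <= f x) -> 0 <= rint a b f.
Proof. by move=> f0; apply: Rintegral_ge0 => x /= /itvP h; apply: f0; rewrite !h. Qed.

Lemma rint_cst a b k : a <= b -> rint a b (fun=> k) = k * (b - a).
Proof.
move=> ab; rewrite /rint Rintegral_cst//= lebesgue_measure_itv/= lte_fin.
by move: ab; rewrite le_eqVlt => /predU1P[->|->//]; rewrite ltxx subrr.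
Qed.

Lemma rint_FTC a b f (F : R -> R) : a < b -> continuous f -> (forall x : R, is_derive x 1 F (f x)) ->
  rint a b f = F b - F a.
Proof.
move=> ab cf dF; rewrite /rint /Rintegral.
have cF : continuous F by move=> x; apply: differentiable_continuous; apply/derivable1_diffP.
rewrite (@continuous_FTC2 _ f F a b ab)//.
- exact: continuous_subspaceT.
- split; first by move=> x _.
  + exact/cvg_at_right_filter/cF.
  + exact/cvg_at_left_filter/cF.
- by move=> x _; rewrite derive1E derive_val.
Qed.

Lemma rint_subset a b c d f : continuous f -> (forall x, 0 <= f x) ->
  c <= a -> b <= d -> rint a b f <= rint c d f.
Proof.
move=> cf f0 ca bd; rewrite /rint /Rintegral.
have sub : `[a, b]%classic `<=` `[c, d]%classic.
  by move=> x /=; rewrite !in_itv /= => /andP[h1 h2]; rewrite (le_trans ca h1) (le_trans h2 bd).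
apply: fine_le.
- by apply: integrable_fin_num => //; exact: rint_integrable.
- by apply: integrable_fin_num => //; exact: rint_integrable.
apply: ge0_subset_integral => //; last by move=> x _; rewrite lee_fin.
by have /integrableP[] := @rint_integrable c d f cf.
Qed.

(** A substitute for Cauchy-Schwarz without square roots of integrals: integrate [(k f - g)^2 >= 0],
    the weight [k] being chosen at each use. *)
Lemma rint_amgm a b f g (k : R) : 0 < k -> continuous f -> continuous g ->
  2 * rint a b (fun x => f x * g x) <=
  k * rint a b (fun x => f x ^+ 2) + k^-1 * rint a b (fun x => g x ^+ 2).
Proof.
move=> k0 cf cg.
have cM (u v : R -> R) : continuous u -> continuous v -> continuous (fun x => u x * v x).
  by move=> cu cv x; apply: cvgM; [exact: cu|exact: cv].
have cS (u : R -> R) : continuous u -> continuous (fun x => u x ^+ 2).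
  by move=> cu; under [X in continuous X]funext => x do rewrite expr2; exact: cM.
have cZ (u : R -> R) (c : R) : continuous u -> continuous (fun x => c * u x).
  by move=> cu; apply: cM => //; exact: cst_continuous.
rewrite -(rintZ _ _ _ (cM _ _ cf cg)) -(rintZ _ _ _ (cS _ cf)) -(rintZ _ _ _ (cS _ cg)).
rewrite -rintD; [|exact/cZ/cS..].
apply: le_rint; [exact/cZ/cM|move=> x; apply: cvgD; [exact: (cZ _ _ (cS _ cf))|exact: (cZ _ _ (cS _ cg))]|].
move=> x _ /=; have := sqr_ge0 (k * f x - g x).
rewrite (_ : (k * f x - g x) ^+ 2 = k * (k * f x ^+ 2 + k^-1 * g x ^+ 2 - 2 * (f x * g x))); last by field; rewrite gt_eqF.
by rewrite pmulr_rge0// subr_ge0.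
Qed.

End RealIntegral.

Section ComplexIntegral.
Context {R : realType}.
Local Notation C := R[i].
Implicit Types (f g : R -> C) (a b : R).

Definition rcont f : Prop := forall x (e : R), 0 < e -> exists2 d : R, 0 < d &
  forall y, `|y - x| < d -> modC (f y - f x) < e.

Lemma rcontP f : rcont f <-> continuous f.
Proof.
split=> cf x.
  apply/cvg_modC => e e0; have [d d0 dd] := cf x e e0; apply/nbhs_realE; exists d => //.
move=> e e0; have /cvg_modC/(_ e e0) := cf x.
by move/nbhs_realE => -[d d0 dd]; exists d.
Qed.

Lemma rcont_comp (G : C -> R) f : continuous G -> rcont f -> continuous (G \o f).
Proof. by move=> cG /rcontP cf x; apply: continuous_comp; [exact: cf|exact: cG]. Qed.

Lemma rcontM f g : rcont f -> rcont g -> rcont (fun x => f x * g x).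
Proof.
move=> /rcontP cf /rcontP cg; apply/rcontP => x.
by apply: (@cvgM R[i]); [exact: cf|exact: cg].
Qed.

Lemma rcontD f g : rcont f -> rcont g -> rcont (fun x => f x + g x).
Proof.
move=> /rcontP cf /rcontP cg; apply/rcontP => x.
by apply: cvgD; [exact: cf|exact: cg].
Qed.

Lemma rcont_cst (c : C) : rcont (fun=> c).
Proof. by apply/rcontP; exact: cst_continuous. Qed.

Lemma rcontN f : rcont f -> rcont (fun x => - f x).
Proof. by move=> /rcontP cf; apply/rcontP => x; apply: cvgN; exact: cf. Qed.

Lemma rcont_conj f : rcont f -> rcont (fun x => Num.conj (f x)).
Proof.
move=> cf x e e0; have [d d0 dd] := cf x e e0; exists d => // y /dd.
by rewrite -rmorphB /= modC_conj.
Qed.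

Lemma is_rderiv_rcont f (f' : R -> C) : (forall x, is_rderiv setT f x (f' x)) -> rcont f.
Proof.
move=> df x e e0; have /is_rderivP/(_ 1 ltr01)[d d0 dd] := df x.
have k0 : 0 < modC (f' x) + 1 by rewrite ltr_wpDl ?modC_ge0.
exists (Num.min d (e / (modC (f' x) + 1))); first by rewrite lt_min d0 divr_gt0.
move=> y; rewrite lt_min ltr_pdivlMr// => /andP[/(dd y I) h ye].
rewrite -(subrK (f' x * toC (y - x)) (f y - f x)); apply: le_lt_trans (modCD _ _) _.
apply: le_lt_trans ye; rewrite mulrDr addrC modCM modC_toC mulrC lerD2l.
by rewrite mulr1; rewrite mul1r in h.
Qed.

Definition cint a b f : C := cintegral `[a, b] f.

Lemma cint_Re a b f : complex.Re (cint a b f) = rint a b (fun x => complex.Re (f x)).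
Proof. by []. Qed.
Lemma cint_Im a b f : complex.Im (cint a b f) = rint a b (fun x => complex.Im (f x)).
Proof. by []. Qed.

Let cRe f : rcont f -> continuous (fun x => complex.Re (f x)).
Proof. exact/rcont_comp/continuous_Re. Qed.
Let cIm f : rcont f -> continuous (fun x => complex.Im (f x)).
Proof. exact/rcont_comp/continuous_Im. Qed.

Lemma cintD a b f g : rcont f -> rcont g ->
  cint a b (fun x => f x + g x) = cint a b f + cint a b g.
Proof.
move=> cf cg; apply: complexP; rewrite ?reD ?imD ?cint_Re ?cint_Im.
  by rewrite -(rintD _ _ (cRe cf) (cRe cg)); congr rint; apply/funext => x; rewrite reD.
by rewrite -(rintD _ _ (cIm cf) (cIm cg)); congr rint; apply/funext => x; rewrite imD.
Qed.

Let cZr (k : R) (h : R -> R) : continuous h -> continuous (fun x => k * h x).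
Proof. by move=> ch x; apply: cvgM; [exact: cvg_cst|exact: ch]. Qed.

Lemma cintZ a b c f : rcont f -> cint a b (fun x => c * f x) = c * cint a b f.
Proof.
move=> cf; have r := cRe cf; have i := cIm cf.
apply: complexP.
  rewrite reM (cint_Re _ _ f) (cint_Im _ _ f) cint_Re -mulNr -!(rintZ _ _ _ r) -!(rintZ _ _ _ i) -rintD; [|exact: cZr..].
  by congr rint; apply/funext => x; rewrite reM mulNr.
rewrite imM (cint_Re _ _ f) (cint_Im _ _ f) cint_Im -!(rintZ _ _ _ r) -!(rintZ _ _ _ i) -rintD; [|exact: cZr..].
by congr rint; apply/funext => x; rewrite imM.
Qed.

Lemma cintB a b f g : rcont f -> rcont g ->
  cint a b (fun x => f x - g x) = cint a b f - cint a b g.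
Proof.
move=> cf cg; rewrite (cintD _ _ cf (rcontN cg)); congr (_ + _).
rewrite -mulN1r -cintZ//; congr cint; apply/funext => x; by rewrite mulN1r.
Qed.

Lemma cint_cst a b c : a <= b -> cint a b (fun=> c) = c * toC (b - a).
Proof. by move=> ab; apply: complexP; rewrite ?reM ?imM ?cint_Re ?cint_Im rint_cst//=; ring. Qed.

Lemma cint_FTC a b f F : a < b -> rcont f -> (forall x, is_rderiv setT F x (f x)) ->
  cint a b f = F b - F a.
Proof.
move=> ab cf dF.
have dRI (G : C -> R) : (forall z w, G (z - w) = G z - G w) -> (forall z, `|G z| <= modC z) ->
    (forall z x, G (z * toC x) = G z * x) -> forall x : R, is_derive x 1 (G \o F) (G (f x)).
  move=> GB Gle GZ x; apply: is_derive_eps => e e0.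
  have /is_rderivP/(_ e e0)[d d0 dd] := dF x; exists d => // y yx.
  by rewrite /= -GB -GZ -GB (le_trans (Gle _))// dd.
have dRe : forall x : R, is_derive x 1 (@complex.Re R \o F) (complex.Re (f x)).
  by apply: dRI => [z w|z|z x]; rewrite ?reD ?reN ?Re_le_modC ?reM //= mulr0 subr0.
have dIm : forall x : R, is_derive x 1 (@complex.Im R \o F) (complex.Im (f x)).
  by apply: dRI => [z w|z|z x]; rewrite ?imD ?imN ?Im_le_modC ?imM //= mulr0 add0r.
apply: complexP.
  by rewrite cint_Re (rint_FTC ab (cRe cf) dRe) reD reN.
by rewrite cint_Im (rint_FTC ab (cIm cf) dIm) imD imN.
Qed.

(** Rotating the integral onto the positive axis reduces the claim to a real part, where integration
    is monotone. *)
Lemma cint_le a b f (h : R -> R) : a <= b -> rcont f -> continuous h ->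
  (forall x, a <= x <= b -> modC (f x) <= h x) -> modC (cint a b f) <= rint a b h.
Proof.
move=> ab cf ch fh; set I := cint a b f.
have [I0|I0] := eqVneq I 0.
  by rewrite I0 modC0 rint_ge0// => x /fh; apply: le_trans; exact: modC_ge0.
have Ip : 0 < modC I by rewrite modC_gt0.
pose u : C := Num.conj I / toC (modC I).
have u1 : modC u = 1.
  by rewrite modCM modC_conj modCV modC_toC gtr0_norm// mulfV// gt_eqF.
have uI : u * I = toC (modC I).
  rewrite /u mulrAC (_ : Num.conj I * I = toC (modC I) * toC (modC I)).
    by rewrite mulfK// toC_eq0 gt_eqF.
  rewrite -toCM -expr2 modC_sqr conjE; case: (I) => c d; apply: complexP => /=; ring.
have -> : modC I = complex.Re (u * I) by rewrite uI.
rewrite -cintZ// cint_Re; apply: le_rint => //.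
  by apply: cRe; apply: rcontM => //; exact: rcont_cst.
move=> x /fh; apply: le_trans; rewrite (le_trans (ler_norm _))//.
by rewrite (le_trans (Re_le_modC _))// modCM u1 mul1r.
Qed.

Lemma cint_bound a b f (M : R) : a <= b -> rcont f ->
  (forall x, a <= x <= b -> modC (f x) <= M) -> modC (cint a b f) <= M * (b - a).
Proof.
by move=> ab cf fM; rewrite -rint_cst//; apply: cint_le => //; exact: cst_continuous.
Qed.

Lemma compact_horizontal (a b s : R) : compact [set z : C | a <= complex.Re z <= b /\ complex.Im z = s].
Proof.
have -> : [set z : C | a <= complex.Re z <= b /\ complex.Im z = s] = (fun x => Complex x s) @` `[a, b].
  apply/seteqP; split=> [[x y] /= [h <-]|_ [x h <-]] /=; first by exists x => //=; rewrite in_itv.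
  by move: h; rewrite /= in_itv.
apply: continuous_compact; last exact: segment_compact.
apply: continuous_subspaceT => x A /nbhs_modC[d d0 dA]; apply/nbhs_realE; exists d => // y yx.
by apply: dA; apply: le_lt_trans (modC_le _) _; rewrite /= subrr normr0 addr0.
Qed.

(* The derivative in the parameter is proportional to the derivative in the
   integration variable, so that its integral reduces to the end points. *)
Lemma cint_shift (phi psi : C -> C) (c : R -> C) (a b s1 s2 M : R) :
  a < b -> s1 <= s2 ->
  (forall z, s1 <= complex.Im z <= s2 ->
     [/\ is_rderiv setT (fun x => phi (Complex x (complex.Im z))) (complex.Re z) (psi z),
         is_rderiv setT (fun s => phi (Complex (complex.Re z) s)) (complex.Im z)
           (c (complex.Im z) * psi z),
         cont_at [set w | s1 <= complex.Im w <= s2] psi z &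
         cont_at [set w | s1 <= complex.Im w <= s2] (fun w => c (complex.Im w)) z]) ->
  (forall s, s1 <= s <= s2 -> modC (c s * (phi (Complex b s) - phi (Complex a s))) <= M) ->
  modC (cint a b (fun x => phi (Complex x s2)) - cint a b (fun x => phi (Complex x s1)))
    <= M * (s2 - s1).
Proof.
move=> ab s12 H bd.
pose D := [set w : C | s1 <= complex.Im w <= s2].
pose I := [set s : R | s1 <= s <= s2].
pose J s := cint a b (fun x => phi (Complex x s)).
have cphi s : I s -> rcont (fun x => phi (Complex x s)).
  by move=> Is; apply: (@is_rderiv_rcont _ (fun x => psi (Complex x s))) => x;
    have [h _ _ _] := H (Complex x s) Is; exact: h.
have cpsi s : I s -> rcont (fun x => psi (Complex x s)).
  move=> Is x e e0; have [_ _ /(_ e e0)[d d0 dd] _] := H (Complex x s) Is.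
  exists d => // y yx; apply: dd => //; apply: le_lt_trans (modC_le _) _.
  by rewrite /= subrr normr0 addr0.
have cmul z : D z -> cont_at D (fun w => c (complex.Im w) * psi w) z.
  move=> Dz; have [_ _ h1 h2] := H z Dz.
  have {h1} /within_continuousP c1 : forall w, D w -> cont_at D psi w by move=> w /H[].
  have {h2} /within_continuousP c2 : forall w, D w -> cont_at D (fun w => c (complex.Im w)) w by move=> w /H[].
  suff : {within D, continuous (fun w => c (complex.Im w) * psi w)} by move/within_continuousP; apply.
  by move=> w; apply: (@cvgM C); [exact: c2|exact: c1].
have dJ s : I s -> is_rderiv I J s (c s * (phi (Complex b s) - phi (Complex a s))).
  move=> Is; have FTC : cint a b (fun x => psi (Complex x s)) = phi (Complex b s) - phi (Complex a s).
    apply: (@cint_FTC a b _ (fun x => phi (Complex x s)) ab (cpsi _ Is)) => x.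
    by have [h _ _ _] := H (Complex x s) Is; exact: h.
  rewrite -FTC.
  (* Differentiation under the integral: uniform continuity near the segment at height [s], and the
     mean value inequality in the height for each fixed [x]. The bound [e / (b - a)] integrates to
     [e]. *)
  apply/is_rderivP => e e0; have e1 : 0 < e / (b - a) by rewrite divr_gt0// subr_gt0.
  have cK : forall z, [set z : C | a <= complex.Re z <= b /\ complex.Im z = s] z ->
      D z /\ cont_at D (fun w => c (complex.Im w) * psi w) z.
    by move=> z [_ zs]; have Dz : D z; [rewrite /D /= zs|split => //; exact: cmul].
  have [d d0 dd] := uniform_cont_at (@compact_horizontal a b s) cK e1.
  exists d => // s' Is' ss'.
  have cA : rcont (fun x => phi (Complex x s') - phi (Complex x s)).
    exact: (rcontD (cphi _ Is') (rcontN (cphi _ Is))).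
  have cB' : rcont (fun x => c s * psi (Complex x s)).
    exact: (rcontM (rcont_cst (c s)) (cpsi _ Is)).
  have cB : rcont (fun x => toC (s' - s) * (c s * psi (Complex x s))).
    exact: (rcontM (rcont_cst (toC (s' - s))) cB').
  have -> : J s' - J s - c s * cint a b (fun x => psi (Complex x s)) * toC (s' - s) =
      cint a b (fun x => phi (Complex x s') - phi (Complex x s) - toC (s' - s) * (c s * psi (Complex x s))).
    rewrite (cintB _ _ cA cB) (cintB _ _ (cphi _ Is') (cphi _ Is)) (cintZ _ _ _ cB') (cintZ _ _ _ (cpsi _ Is)).
    by rewrite (mulrC (toC _)).
  have -> : e * `|s' - s| = e / (b - a) * `|s' - s| * (b - a) by field; lra.
  apply: (cint_bound (ltW ab) (rcontD cA (rcontN cB))) => x xab.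
  have mv (s3 s4 : R) : I s3 -> I s4 -> s3 <= s4 -> `|s3 - s| <= `|s' - s| -> `|s4 - s| <= `|s' - s| ->
      modC (phi (Complex x s4) - phi (Complex x s3) - c s * psi (Complex x s) * toC (s4 - s3))
        <= e / (b - a) * (s4 - s3).
    move=> /andP[h1 h2] /andP[h3 h4] s34 n3 n4.
    apply: (@mean_value_inequality _ setT (fun s => phi (Complex x s))) => // s5 /andP[h5 h6].
    have Is5 : I s5 by rewrite /I /=; apply/andP; split; lra.
    exists (c s5 * psi (Complex x s5)); first by have [_ h _ _] := H (Complex x s5) Is5; exact: h.
    apply/ltW/(dd (Complex x s) (Complex x s5)) => //.
    apply: le_lt_trans (modC_le _) _; rewrite /= subrr normr0 add0r; apply: le_lt_trans ss'.
    move: n3 n4; rewrite !ler_norml => /andP[? ?] /andP[? ?]; apply/andP; split; lra.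
  have [ss|ss] := lerP s s'.
    rewrite ger0_norm ?subr_ge0// in mv.
    have := mv s s' Is Is' ss; rewrite subrr normr0 subr_ge0 ger0_norm ?subr_ge0//.
    by move=> /(_ ss (lexx _)); rewrite (mulrC (toC _)).
  have := mv s' s Is' Is (ltW ss) (lexx _); rewrite subrr normr0 normr_ge0 => /(_ isT).
  apply: le_trans; rewrite -modCN !toCB le_eqVlt; apply/orP; left; apply/eqP; congr modC; ring.
have := @mean_value_inequality R I J 0 M s1 s2 s12 (fun _ h => h).
rewrite mul0r subr0; apply => s Is; exists (c s * (phi (Complex b s) - phi (Complex a s))); first exact: dJ.
by rewrite subr0; exact: bd.
Qed.

End ComplexIntegral.

(** * Holomorphic functions on the lower half plane *)

Section Circle.
Context {R : realType}.
Local Notation C := R[i].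

Lemma derive_eps (r : R -> R) (x l : R) : is_derive x 1 r l ->
  forall e : R, 0 < e -> exists2 d : R, 0 < d &
    forall y, `|y - x| < d -> `|r y - r x - l * (y - x)| <= e * `|y - x|.
Proof.
move=> [dr <-] e e0.
have : h^-1 *: ((r \o shift x) (h *: (1 : R^o)) - r x) @[h --> 0^'] --> ('D_1 r x : R^o) by exact: dr.
move=> /cvgrPdist_lt/(_ e e0)/nbhs_realE[d d0 dd]; exists d => // y yx.
have [->|yNx] := eqVneq y x; first by rewrite !subrr mulr0 subrr normr0 mulr0.
have yx0 : y - x != 0 by rewrite subr_eq0.
have := dd (y - x); rewrite subr0 => /(_ yx yx0) /=.
have -> : (y - x) *: (1 : R^o) = y - x by rewrite /GRing.scale /= mulr1.
rewrite subrK => /ltW h.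
have -> : r y - r x - 'D_1 r x * (y - x) = - (('D_1 r x - (y - x)^-1 *: (r y - r x)) * (y - x)).
  by rewrite /GRing.scale /=; field.
by rewrite normrN normrM ler_wpM2r.
Qed.

Lemma is_rderiv_Complex (u v : R -> R) (x du dv : R) :
  is_derive x 1 u du -> is_derive x 1 v dv ->
  is_rderiv setT (fun y => Complex (u y) (v y)) x (Complex du dv).
Proof.
move=> /derive_eps hu /derive_eps hv; apply/is_rderivP => e e0.
have e20 : 0 < e / 2 by rewrite divr_gt0.
have [d d0 dd] := hu _ e20; have [d' d'0 dd'] := hv _ e20.
exists (Num.min d d'); first by rewrite lt_min d0.
move=> y _; rewrite lt_min => /andP[/dd h1 /dd' h2].
apply: le_trans (modC_le _) _; rewrite (splitr e) mulrDl lerD//=.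
  by move: h1; congr (`| _ | <= _); ring.
by move: h2; congr (`| _ | <= _); ring.
Qed.

Lemma modC_expi (x : R) : modC (expi x) = 1.
Proof.
by apply/eqP; rewrite -(@eqrXn2 _ 2)// ?modC_ge0// modC_sqr expr1n /= cos2Dsin2.
Qed.

Lemma expi_rderiv (x : R) : is_rderiv setT expi x (iC * expi x).
Proof.
rewrite (_ : iC * expi x = Complex (- sin x) (cos x)); last by apply: complexP => /=; ring.
exact: is_rderiv_Complex.
Qed.

Lemma expiN (x : R) : expi (- x) * expi x = 1.
Proof.
rewrite /expi cosN sinN; apply: complexP => /=; last by ring.
by rewrite mulNr opprK -!expr2 cos2Dsin2.
Qed.

Lemma expi_0 : expi (0 : R) = 1. Proof. by rewrite /expi cos0 sin0. Qed.
Lemma expi_2pi : expi (2 * pi) = 1 :> C.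
Proof. by rewrite /expi mulr_natl cos2pi sin2pi. Qed.

Lemma rcont_expi : rcont (@expi R).
Proof. exact: is_rderiv_rcont expi_rderiv. Qed.

Lemma expiNE (x : R) : expi (- x) = Num.conj (expi x).
Proof. by rewrite /expi cosN sinN conjE. Qed.

Lemma rcont_expiN : rcont (fun x : R => expi (- x)).
Proof.
have := rcont_conj rcont_expi.
by rewrite (_ : (fun x : R => expi (- x)) = (fun x => Num.conj (expi x)))//; apply/funext => x; rewrite expiNE.
Qed.

Lemma is_rderivM (I : set R) (f g : R -> C) (x : R) (l m : C) :
  is_rderiv I f x l -> is_rderiv I g x m -> is_rderiv I (fun y => f y * g y) x (l * g x + f x * m).
Proof.
move=> /is_rderivP hf /is_rderivP hg; apply/is_rderivP => e e0.
pose B := modC l + 1; pose A := modC (g x) + 1; pose D := modC (f x) + 1.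
pose E := modC m + 1.
have B0 : 0 < B by rewrite ltr_wpDl ?modC_ge0.
have A0 : 0 < A by rewrite ltr_wpDl ?modC_ge0.
have D0 : 0 < D by rewrite ltr_wpDl ?modC_ge0.
have E0 : 0 < E by rewrite ltr_wpDl ?modC_ge0.
have e1 : 0 < e / 3 / A by rewrite !divr_gt0.
have e2 : 0 < e / 3 / D by rewrite !divr_gt0.
have e3 : 0 < e / 3 / B / E by rewrite !divr_gt0.
have [d1 d10 h1] := hf _ e1; have [d2 d20 h2] := hg _ e2.
have [d3 d30 h3] := hf _ ltr01; have [d4 d40 h4] := hg _ ltr01.
exists (Num.min (Num.min (Num.min d1 d2) (Num.min d3 d4)) (e / 3 / B / E)).
  by rewrite !lt_min d10 d20 d30 d40.
move=> y Iy; rewrite !lt_min => /andP[/andP[/andP[/(h1 y Iy) k1 /(h2 y Iy) k2]]].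
move=> /andP[/(h3 y Iy) k3 /(h4 y Iy) k4] k5.
set h := `|y - x| in k1 k2 k3 k4 k5 *; have h0 : 0 <= h by exact: normr_ge0.
have hM (k u : C) (q : R) : modC (u - k * toC (y - x)) <= 1 * h -> q = modC k + 1 -> modC u <= q * h.
  move=> hu ->; rewrite -(subrK (k * toC (y - x)) u); apply: le_trans (modCD _ _) _.
  by rewrite modCM modC_toC mulrDl addrC lerD2l.
have k6 := hM _ _ B k3 erefl; have k7 := hM _ _ E k4 erefl.
rewrite (_ : f y * g y - _ - _ = (f y - f x - l * toC (y - x)) * g x +
   (f y - f x) * (g y - g x) + f x * (g y - g x - m * toC (y - x))); last by ring.
apply: le_trans (modCD _ _) _; apply: le_trans (lerD (modCD _ _) (lexx _)) _.
have t1 : modC ((f y - f x - l * toC (y - x)) * g x) <= e / 3 * h.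
  rewrite modCM; apply: le_trans (_ : e / 3 / A * h * A <= _).
    by rewrite ler_pM ?modC_ge0// lerDl.
  by rewrite mulrAC mulfVK// gt_eqF.
have t2 : modC ((f y - f x) * (g y - g x)) <= e / 3 * h.
  rewrite modCM; apply: le_trans (_ : B * h * (E * h) <= _); first by rewrite ler_pM ?modC_ge0.
  rewrite (_ : B * h * (E * h) = h * E * B * h); last by ring.
  by rewrite ler_wpM2r// -ler_pdivlMr// -ler_pdivlMr// ltW.
have t3 : modC (f x * (g y - g x - m * toC (y - x))) <= e / 3 * h.
  rewrite modCM; apply: le_trans (_ : D * (e / 3 / D * h) <= _); first by rewrite ler_pM ?modC_ge0// lerDl.
  by rewrite mulrA (mulrC D) mulfVK// gt_eqF.
lra.
Qed.

Lemma is_rderiv_cst (I : set R) (c : C) x : is_rderiv I (fun=> c) x 0.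
Proof.
apply/is_rderivP => e e0; exists 1 => // y _ _.
by rewrite subrr mul0r subrr modC0 mulr_ge0// ltW.
Qed.

Lemma is_rderivD (I : set R) (f g : R -> C) (x : R) (l m : C) :
  is_rderiv I f x l -> is_rderiv I g x m -> is_rderiv I (fun y => f y + g y) x (l + m).
Proof.
move=> /is_rderivP hf /is_rderivP hg; apply/is_rderivP => e e0.
have e20 : 0 < e / 2 by rewrite divr_gt0.
have [d d0 dd] := hf _ e20; have [d' d'0 dd'] := hg _ e20.
exists (Num.min d d'); first by rewrite lt_min d0.
move=> y Iy; rewrite lt_min => /andP[/(dd y Iy) h /(dd' y Iy) h'].
rewrite (_ : f y + g y - _ - _ = (f y - f x - l * toC (y - x)) + (g y - g x - m * toC (y - x))); last by ring.
by rewrite (le_trans (modCD _ _))// (splitr e) mulrDl lerD.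
Qed.

Lemma is_rderivC (I : set R) (f : R -> C) (x : R) (l m : C) : l = m ->
  is_rderiv I f x l -> is_rderiv I f x m.
Proof. by move=> ->. Qed.

End Circle.

(** * Circle means and Cauchy's formula *)

Section Holomorphic.
Context {R : realType}.
Local Notation C := R[i].
Local Notation lower := (@lower R).
Implicit Types (f : C -> C).

(** The derivative is carried as data; its continuity is what [cint_shift] and [cint_FTC] use along
    circles and lines, and [holo_deriv] then produces the further derivatives. *)
Definition holo f (f' : C -> C) : Prop :=
  forall z, lower z -> cdiff f z (f' z) /\ cont_at lower f' z.

Lemma lower_ball (z : C) (r : R) w : complex.Im z + r < 0 -> modC (w - z) <= r -> lower w.
Proof.
move=> zr wz; rewrite /Defs.lower /=; have := Im_le_modC (w - z); rewrite imD imN.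
by move=> /(le_trans (ler_norm _)); lra.
Qed.

Lemma circle_mod (z : C) (r x : R) : 0 <= r -> modC (z + toC r * expi x - z) = r.
Proof. by move=> r0; rewrite addrAC subrr add0r modCM modC_expi mulr1 modC_toC ger0_norm. Qed.

Lemma circle_lower (z : C) (r x : R) : 0 <= r -> complex.Im z + r < 0 -> lower (z + toC r * expi x).
Proof. by move=> r0 zr; apply: (lower_ball zr); rewrite circle_mod. Qed.

Lemma circle_rderiv (z : C) (r x : R) :
  is_rderiv setT (fun x => z + toC r * expi x) x (toC r * (iC * expi x)).
Proof.
have h := is_rderivD (is_rderiv_cst setT z x) (is_rderivM (is_rderiv_cst setT (toC r) x) (@expi_rderiv R x)).
by move: h; rewrite mul0r !add0r.
Qed.

Lemma rcont_circle f (z : C) (r : R) : 0 <= r -> complex.Im z + r < 0 ->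
  (forall w, lower w -> cont_at lower f w) -> rcont (fun x => f (z + toC r * expi x)).
Proof.
move=> r0 zr cf x e e0; have [d d0 dd] := cf _ (circle_lower x r0 zr) e e0.
have [d' d'0 dd'] := is_rderiv_rcont (@circle_rderiv z r) x d0.
by exists d' => // y yx; apply: dd; [exact: circle_lower|exact: dd'].
Qed.

Lemma holo_cont f f' : holo f f' -> forall z, lower z -> cont_at lower f z.
Proof. by move=> h z /h[/cdiff_cont + _]; exact. Qed.

Lemma pi2_gt0 : 0 < 2 * pi :> R. Proof. by rewrite mulr_gt0// pi_gt0. Qed.

(** In polar coordinates the radial derivative is [(i s)^-1] times the angular one, so [cint_shift]
    applies, and its end terms cancel after a full turn. The mean is therefore independent of the
    radius, and small radii give [f z]. *)
Lemma mean_value_circle f f' (z : C) (r : R) : holo f f' -> 0 < r -> complex.Im z + r < 0 ->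
  cint 0 (2 * pi) (fun x => f (z + toC r * expi x)) = toC (2 * pi) * f z.
Proof.
move=> hf r0 zr.
pose phi w := f (z + toC (complex.Im w) * expi (complex.Re w)).
pose psi w := f' (z + toC (complex.Im w) * expi (complex.Re w)) *
  (toC (complex.Im w) * (iC * expi (complex.Re w))).
pose J s := cint 0 (2 * pi) (fun x => f (z + toC s * expi x)).
have const s : 0 < s -> s <= r -> J r = J s.
  move=> s0 sr; apply/eqP; rewrite -subr_eq0 -modC_eq0; apply/eqP/le_anti; rewrite modC_ge0 andbT.
  rewrite -(mul0r (r - s)).
  apply: (@cint_shift _ phi psi (fun s => (toC s * iC)^-1) 0 (2 * pi) s r 0 pi2_gt0 sr); last first.
    by move=> u _; rewrite /phi /= expi_0 expi_2pi subrr mulr0 modC0.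
  move=> [x y] /= /andP[sy yr].
  have y0 : 0 < y by exact: lt_le_trans sy.
  have iy : toC y * iC != 0 by rewrite mulf_neq0 ?iC_neq0// toC_eq0 gt_eqF.
  have zy : complex.Im z + y < 0 by lra.
  have [df cf'] := hf _ (circle_lower x (ltW y0) zy).
  have cpath : cont_at setT (fun w : C => z + toC (complex.Im w) * expi (complex.Re w)) (Complex x y).
    apply: cont_atD; first exact: cont_at_cst.
    apply: cont_atM => e e0.
      exists e => // w _ wz; rewrite -toCB modC_toC; apply: le_lt_trans wz.
      by apply: le_trans (Im_le_modC _); rewrite imD imN.
    have [d d0 dd] := @rcont_expi R x e e0; exists d => // w _ wz; apply: dd.
    by apply: le_lt_trans wz; apply: le_trans (Re_le_modC _); rewrite reD reN.
  split.
  - exact: (cdiff_path (@circle_rderiv z y x) df).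
  - have hp : is_rderiv setT (fun s => z + toC s * expi x) y (expi x).
      have := @is_rderiv_affine R setT z (expi x) y; apply: is_rderiv_eq => u /=; by rewrite mulrC.
    have := cdiff_path hp df; apply: is_rderivC; rewrite /psi /=; field; by rewrite ?iC_neq0 ?toC_eq0 ?(gt_eqF y0).
  - have c1 : cont_at [set w : C | s <= complex.Im w <= r]
        (fun w => f' (z + toC (complex.Im w) * expi (complex.Re w))) (Complex x y).
      move=> e e0; have [d d0 dd] := cf' e e0; have [d' d'0 dd'] := cpath d d0.
      exists d' => // w /andP[sw wr] wz; apply: dd; last exact: dd'.
      by apply: circle_lower; lra.
    have c2 : cont_at [set w : C | s <= complex.Im w <= r]
        (fun w => toC (complex.Im w) * (iC * expi (complex.Re w))) (Complex x y).
      move=> e e0; have [d d0 dd] := cpath e e0; exists d => // w _ wz; have := dd w I wz.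
      rewrite (_ : toC (complex.Im w) * (iC * expi (complex.Re w)) - _ = iC * (z + toC (complex.Im w) * expi (complex.Re w) -
        (z + toC (complex.Im (Complex x y)) * expi (complex.Re (Complex x y))))); last by rewrite /=; ring.
      by rewrite modCM modC_iC mul1r.
    exact: (cont_atM c1 c2).
  - apply: cont_atV => //.
    move=> e e0; exists e => // w _ wz; rewrite -mulrBl -toCB modCM modC_iC mulr1 modC_toC.
    by apply: le_lt_trans wz; apply: le_trans (Im_le_modC _); rewrite imD imN.
rewrite -/(J r); apply/eqP; rewrite -subr_eq0 -modC_eq0; apply/eqP/le_anti; rewrite modC_ge0 andbT.
apply/ler_addgt0Pl => e e0; rewrite addr0.
have lz : lower z by apply: (lower_ball zr); rewrite subrr modC0 ltW.
have e1 : 0 < e / (2 * pi) by rewrite divr_gt0// pi2_gt0.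
have [d d0 dd] := holo_cont hf lz e1.
pose s := Num.min r (d / 2).
have s0 : 0 < s by rewrite lt_min r0 divr_gt0.
have sr : s <= r by rewrite ge_min lexx.
have sd : s < d by apply: le_lt_trans (_ : d / 2 < _); [rewrite ge_min lexx orbT|lra].
have zs : complex.Im z + s < 0 by lra.
rewrite (const s s0 sr).
rewrite (_ : toC (2 * pi) * f z = cint 0 (2 * pi) (fun=> f z)); last first.
  by rewrite (cint_cst _ (ltW pi2_gt0)) subr0 mulrC.
have c1 := rcont_circle (ltW s0) zs (holo_cont hf).
rewrite /J -(cintB _ _ c1 (rcont_cst (f z))).
have -> : e = e / (2 * pi) * (2 * pi - 0) by rewrite subr0 mulfVK// gt_eqF// pi2_gt0.
apply: (cint_bound (ltW pi2_gt0) (rcontD c1 (rcontN (rcont_cst (f z))))) => x _.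
apply/ltW/dd; first exact: (circle_lower x (ltW s0) zs).
by rewrite circle_mod// ltW.
Qed.

(** Differentiation under the integral with respect to the centre. The remainder is estimated by the
    mean value inequality from [z + c] to [w + c], using uniform continuity of [f'] on the closed
    disc. *)
Lemma cdiff_circle f f' (k : R -> C) (z : C) (r : R) : holo f f' -> 0 < r -> complex.Im z + r < 0 ->
  rcont k -> (forall x, modC (k x) <= 1) ->
  cdiff (fun w => cint 0 (2 * pi) (fun x => f (w + toC r * expi x) * k x)) z
    (cint 0 (2 * pi) (fun x => f' (z + toC r * expi x) * k x)).
Proof.
move=> hf r0 zr ck k1 e e0.
have e1 : 0 < e / (2 * pi) by rewrite divr_gt0// pi2_gt0.
pose K := [set w : C | modC (w - z) <= r].
have Kl w : K w -> lower w by exact: lower_ball.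
have [d d0 dd] := @uniform_cont_at _ K lower f' (compact_disc (c := z) (r := r))
   (fun w Kw => conj (Kl w Kw) (proj2 (hf w (Kl w Kw)))) _ e1.
have zr0 : 0 < - (complex.Im z + r) by rewrite oppr_gt0.
exists (Num.min d (- (complex.Im z + r) / 2)); first by rewrite lt_min d0 divr_gt0.
move=> w; rewrite lt_min => /andP[wd wr].
have wl : complex.Im w + r < 0.
  have := Im_le_modC (w - z); rewrite imD imN => /(le_trans (ler_norm _)); lra.
have cf u : complex.Im u + r < 0 -> rcont (fun x => f (u + toC r * expi x) * k x).
  by move=> h; exact: (rcontM (rcont_circle (ltW r0) h (holo_cont hf)) ck).
have cf' : rcont (fun x => f' (z + toC r * expi x) * k x).
  by apply: (rcontM _ ck); apply: (rcont_circle (ltW r0) zr) => u /hf[].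
have cA := rcontD (cf w wl) (rcontN (cf z zr)).
have cB : rcont (fun x => (w - z) * (f' (z + toC r * expi x) * k x)) := rcontM (rcont_cst (w - z)) cf'.
rewrite -(cintB _ _ (cf w wl) (cf z zr)) (mulrC (cint _ _ _)) -(cintZ _ _ _ cf') -(cintB _ _ cA cB).
have -> : e * modC (w - z) = e / (2 * pi) * modC (w - z) * (2 * pi - 0).
  by rewrite subr0 mulrAC mulfVK// gt_eqF// pi2_gt0.
apply: (cint_bound (ltW pi2_gt0) (rcontD cA (rcontN cB))) => x _.
set c := toC r * expi x.
rewrite (_ : f (w + c) * k x - _ - _ = (f (w + c) - f (z + c) - f' (z + c) * (w - z)) * k x); last by ring.
rewrite modCM; apply: le_trans (_ : modC (f (w + c) - f (z + c) - f' (z + c) * (w - z)) * 1 <= _).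
  by rewrite ler_wpM2l ?modC_ge0.
rewrite mulr1.
pose p s := z + c + (w - z) * toC s.
have hp s : is_rderiv setT p s (w - z) by exact: is_rderiv_affine.
have pl s : 0 <= s <= 1 -> lower (p s) /\ modC (p s - (z + c)) <= modC (w - z).
  move=> /andP[s0 s1]; have ps : modC (p s - (z + c)) <= modC (w - z).
    by rewrite /p addrAC subrr add0r modCM modC_toC ger0_norm// ler_piMr ?modC_ge0.
  split => //; apply: (@lower_ball z (r + modC (w - z))); first by lra.
  rewrite (_ : p s - z = (p s - (z + c)) + c); last by ring.
  by apply: le_trans (modCD _ _) _; rewrite addrC lerD// /c modCM modC_expi mulr1 modC_toC gtr0_norm.
have := @mean_value_inequality R setT (f \o p) (f' (z + c) * (w - z)) (e / (2 * pi) * modC (w - z)) 0 1 ler01 (fun _ _ => I).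
rewrite /= /p toC0 toC1 mulr0 addr0 mulr1 (_ : z + c + (w - z) = w + c); last by ring.
rewrite subr0 toC1 !mulr1; apply => s s01.
have [ls ps] := pl s s01; have [df _] := hf _ ls.
exists (f' (p s) * (w - z)); first exact: cdiff_path (hp s) df.
rewrite -mulrBl modCM ler_wpM2r ?modC_ge0//; apply: ltW; apply: dd => //.
  by rewrite /K /= /c circle_mod// ltW.
exact: le_lt_trans ps wd.
Qed.

(** [f'] is not yet known to be differentiable, so its mean value property is obtained by
    differentiating that of [f] in the centre. *)
Lemma mean_value_circle_deriv f f' (z : C) (r : R) : holo f f' -> 0 < r -> complex.Im z + r < 0 ->
  cint 0 (2 * pi) (fun x => f' (z + toC r * expi x)) = toC (2 * pi) * f' z.
Proof.
move=> hf r0 zr.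
have lz : lower z by apply: (lower_ball zr); rewrite subrr modC0 ltW.
have := @cdiff_circle f f' (fun=> 1) z r hf r0 zr (rcont_cst 1) (fun=> _).
rewrite modC1 => /(_ (fun=> lexx _)).
have -> : (fun x => f' (z + toC r * expi x) * 1) = (fun x => f' (z + toC r * expi x)).
  by apply/funext => x; rewrite mulr1.
move=> h; apply: (cdiff_uniq h).
have zr0 : 0 < - (complex.Im z + r) by rewrite oppr_gt0.
apply: (@cdiff_near _ (fun w => toC (2 * pi) * f w) _ _ _ (- (complex.Im z + r)) zr0); last first.
  by apply: cdiffZ; have [] := hf z lz.
move=> w wz; rewrite -(mean_value_circle hf r0).
  by congr cint; apply/funext => x; rewrite mulr1.
have := Im_le_modC (w - z); rewrite imD imN => /(le_trans (ler_norm _)); lra.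
Qed.

(** The angular derivative of [f(z + r e^(ix)) e^(-ix)] integrates to 0 over a full turn. It equals
    [i r f'] minus [i] times the integrand, and the mean of [f'] is known. *)
Lemma cauchy_deriv f f' (z : C) (r : R) : holo f f' -> 0 < r -> complex.Im z + r < 0 ->
  cint 0 (2 * pi) (fun x => f (z + toC r * expi x) * expi (- x)) = toC (2 * pi * r) * f' z.
Proof.
move=> hf r0 zr.
have c1 := rcontM (rcont_circle (ltW r0) zr (holo_cont hf)) rcont_expiN.
have c2 : rcont (fun x => f' (z + toC r * expi x)).
  by apply: (rcont_circle (ltW r0) zr) => u /hf[].
have c3 := rcontM (rcont_cst (toC r * iC)) c2.
have c4 := rcontM (rcont_cst (- iC)) c1.
have : cint 0 (2 * pi) (fun x => toC r * iC * f' (z + toC r * expi x) +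
    (- iC) * (f (z + toC r * expi x) * expi (- x))) = 0.
  rewrite (@cint_FTC _ _ _ _ (fun x => f (z + toC r * expi x) * expi (- x)) pi2_gt0 (rcontD c3 c4)).
    by rewrite !expiNE expi_0 expi_2pi subrr.
  move=> x; have [df _] := hf _ (circle_lower x (ltW r0) zr).
  have dE : is_rderiv setT (fun x : R => expi (- x)) x (- iC * expi (- x)).
    apply: (is_rderiv_eq (p := fun x => Num.conj (expi x))) => [u|]; first by rewrite expiNE.
    have /is_rderivP h := @expi_rderiv R x; apply/is_rderivP => e e0.
    have [d d0 dd] := h e e0; exists d => // y Iy yx; apply: le_trans (dd y Iy yx).
    rewrite -[leRHS]modC_conj le_eqVlt; apply/orP; left; apply/eqP; congr modC.
    rewrite expiNE !rmorphB rmorphM /=; congr (_ - _).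
    by rewrite rmorphM /= (_ : Num.conj iC = - iC) 1?(_ : Num.conj (toC (y - x)) = toC (y - x))//;
      rewrite conjE; apply: complexP => //=; ring.
  have := is_rderivM (cdiff_path (@circle_rderiv z r x) df) dE; apply: is_rderivC.
  rewrite /=; have := expiN x => hE.
  rewrite (_ : f' (z + toC r * expi x) * (toC r * (iC * expi x)) * expi (- x) =
    toC r * iC * f' (z + toC r * expi x) * (expi (- x) * expi x)); last by ring.
  by rewrite hE; ring.
rewrite (cintD _ _ c3 c4) (cintZ _ _ _ c1) (cintZ _ _ _ c2) (mean_value_circle_deriv hf r0 zr).
set A := cint _ _ _ => h.
have : iC * (toC (2 * pi * r) * f' z - A) = 0 by rewrite -h [toC (2 * pi * r)]toCM; ring.
by move/eqP; rewrite mulf_eq0 (negbTE iC_neq0) /= subr_eq0 => /eqP.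
Qed.

Lemma cauchy_estimate f f' (z : C) (r M : R) : holo f f' -> 0 < r -> complex.Im z + r < 0 ->
  (forall w, modC (w - z) = r -> modC (f w) <= M) -> modC (f' z) <= M / r.
Proof.
move=> hf r0 zr fM; have := cauchy_deriv hf r0 zr.
have c1 := rcontM (rcont_circle (ltW r0) zr (holo_cont hf)) rcont_expiN.
have bd : modC (cint 0 (2 * pi) (fun x => f (z + toC r * expi x) * expi (- x))) <= M * (2 * pi - 0).
  apply: (cint_bound (ltW pi2_gt0) c1) => x _.
  by rewrite modCM modC_expi mulr1 fM// circle_mod// ltW.
move=> E; move: bd; rewrite E modCM modC_toC gtr0_norm ?mulr_gt0// ?pi_gt0// subr0.
move=> h; rewrite ler_pdivlMr// -(ler_pM2r pi2_gt0); apply: le_trans h.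
by rewrite le_eqVlt; apply/orP; left; apply/eqP; ring.
Qed.

(** Cauchy's formula writes [f'] near [z] as a circle integral of [f] with a fixed radius, and such
    integrals can be differentiated in the centre. *)
Lemma holo_deriv f f' : holo f f' -> exists f'', holo f' f''.
Proof.
move=> hf.
pose g r z := (toC (2 * pi * r))^-1 * cint 0 (2 * pi) (fun x => f' (z + toC r * expi x) * expi (- x)).
have n0 (r : R) : 0 < r -> toC (2 * pi * r) != 0.
  by move=> r0; rewrite toC_eq0 gt_eqF// mulr_gt0// pi2_gt0.
have key z r : 0 < r -> complex.Im z + r < 0 -> cdiff f' z (g r z).
  move=> r0 zr.
  have zr0 : 0 < - (complex.Im z + r) by rewrite oppr_gt0.
  apply: (@cdiff_near _ (fun w => (toC (2 * pi * r))^-1 * cint 0 (2 * pi) (fun x => f (w + toC r * expi x) * expi (- x))) _ _ _ _ zr0); last first.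
    by apply: cdiffZ; apply: (cdiff_circle hf r0 zr rcont_expiN) => x; rewrite modC_expi.
  move=> w wz; rewrite (cauchy_deriv hf r0); first by rewrite mulrA mulVf ?mul1r// n0.
  have := Im_le_modC (w - z); rewrite imD imN => /(le_trans (ler_norm _)); lra.
(* The radius varies with [z]. By uniqueness of the derivative every admissible radius gives the
   same value, which lets the continuity proof compare [z] and [w] on circles of one radius. *)
pose f'' z := g (- complex.Im z / 2) z.
have df' z : lower z -> cdiff f' z (f'' z).
  rewrite /Defs.lower /= => zl; apply: key; lra.
exists f'' => z zl; split; first exact: df'.
move=> e e0; have zl' : complex.Im z < 0 by [].
pose r := - complex.Im z / 2; have r0 : 0 < r by rewrite /r; lra.
have zr : complex.Im z + r < 0 by rewrite /r; lra.
pose K := [set w : C | modC (w - z) <= r].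
have Kl w : K w -> lower w by exact: lower_ball.
have er : 0 < e * r / 2 by rewrite divr_gt0// mulr_gt0.
have [d d0 dd] := @uniform_cont_at _ K lower f' (compact_disc (c := z) (r := r))
   (fun w Kw => conj (Kl w Kw) (proj2 (hf w (Kl w Kw)))) _ er.
exists (Num.min d (r / 2)); first by rewrite lt_min d0 divr_gt0.
move=> w wl; rewrite lt_min => /andP[wd wr].
have wzr : complex.Im w + r < 0.
  have := Im_le_modC (w - z); rewrite imD imN => /(le_trans (ler_norm _)); rewrite /r in wr *; lra.
rewrite (cdiff_uniq (df' w wl) (key w r r0 wzr)) (_ : f'' z = g r z)//.
have cc u : complex.Im u + r < 0 -> rcont (fun x => f' (u + toC r * expi x) * expi (- x)).
  by move=> h; apply: (rcontM _ rcont_expiN); apply: (rcont_circle (ltW r0) h) => v /hf[].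
have pr0 : 0 < 2 * pi * r by rewrite mulr_gt0// pi2_gt0.
rewrite /g -mulrBr -(cintB _ _ (cc w wzr) (cc z zr)) modCM modCV modC_toC (gtr0_norm pr0).
rewrite mulrC (ltr_pdivrMr _ _ pr0).
apply: le_lt_trans (_ : e * r / 2 * (2 * pi - 0) < _).
  apply: (cint_bound (ltW pi2_gt0) (rcontD (cc w wzr) (rcontN (cc z zr)))) => x _.
  rewrite -mulrBl modCM modC_expi mulr1; apply/ltW/dd.
  - by rewrite /K /= circle_mod// ltW.
  - by apply: circle_lower => //; exact: ltW.
  - by rewrite (_ : _ - _ = w - z)//; ring.
rewrite subr0; have pp := @pi_gt0 R; have : 0 < e * r * pi by rewrite mulr_gt0// mulr_gt0.
rewrite (_ : e * r / 2 * (2 * pi) = e * r * pi); last by field.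
rewrite (_ : e * (2 * pi * r) = 2 * (e * r * pi)); last by ring.
lra.
Qed.

End Holomorphic.

(** * Maximum principle and boundary control *)

Section MaximumPrinciple.
Context {R : realType}.
Local Notation C := R[i].
Local Notation lower := (@lower R).
Local Notation lowerbar := (@lowerbar R).
Implicit Types (f : C -> C).

Lemma compact_max (K : set C) (g : C -> R) : compact K -> K !=set0 ->
  (forall z, K z -> forall e : R, 0 < e -> exists2 d : R, 0 < d &
     forall w, K w -> modC (w - z) < d -> `|g w - g z| < e) ->
  exists2 c, K c & forall z, K z -> g z <= g c.
Proof.
move=> cK K0 cg; have [|c] := @compact_EVT_max _ R g K K0 cK.
  rewrite subspace_continuousP => z Kz A /nbhs_realE[e e0 eA].
  have [d d0 dd] := cg z Kz e e0; apply/nbhs_modC; exists d => // w wz Kw.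
  by apply: eA; exact: dd.
by rewrite inE => Kc h; exists c => // z Kz; apply: h; rewrite inE.
Qed.

Lemma modC_cont (D : set C) f z (e : R) : cont_at D f z -> 0 < e ->
  exists2 d : R, 0 < d & forall w, D w -> modC (w - z) < d -> `|modC (f w) - modC (f z)| < e.
Proof.
move=> cf e0; have [d d0 dd] := cf e e0; exists d => // w Dw /(dd w Dw); apply: le_lt_trans.
by rewrite ler_norml modC_triB andbT lerNl opprB modC_sub modC_triB.
Qed.

Lemma modC_sqrD (c v : C) :
  modC (c + v) ^+ 2 = modC c ^+ 2 + modC v ^+ 2 + 2 * complex.Re (Num.conj c * v).
Proof. by rewrite !modC_sqr conjE; case: c => a b; case: v => x y /=; ring. Qed.

Lemma unit_factor (z : C) : exists2 u : C, modC u = 1 & u * z = toC (modC z).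
Proof.
have [->|z0] := eqVneq z 0; first by exists 1; rewrite ?modC1// modC0 mulr0.
have zp : 0 < modC z by rewrite modC_gt0.
exists (Num.conj z / toC (modC z)).
  by rewrite modCM modC_conj modCV modC_toC gtr0_norm// mulfV// gt_eqF.
rewrite mulrAC (_ : Num.conj z * z = toC (modC z) * toC (modC z)).
  by rewrite mulfK// toC_eq0 gt_eqF.
by rewrite -toCM -expr2 modC_sqr conjE; case: (z) => c d; apply: complexP => /=; ring.
Qed.

Definition half_disc (r : R) : set C := [set z | complex.Im z <= 0 /\ modC z <= r].

Lemma half_disc_compact (r : R) : compact (half_disc r).
Proof.
apply: (@compact_bounded_closed _ _ r); last by move=> z [].
have -> : half_disc r = lowerbar `&` [set z | modC (z - 0) <= r].
  by apply/seteqP; split => z /=; rewrite subr0.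
by apply: closedI; [exact: closed_lowerbar|exact: closed_disc].
Qed.

(* Adding a small multiple of |z|^2 makes the modulus strictly subharmonic, so
   that it has no interior maximum. *)
Lemma maximum_principle f f' (r M : R) : holo f f' -> 0 < r ->
  (forall z, half_disc r z -> cont_at lowerbar f z) ->
  (forall z, half_disc r z -> complex.Im z = 0 \/ modC z = r -> modC (f z) <= M) ->
  forall z, half_disc r z -> modC (f z) <= M.
Proof.
move=> hf r0 cf bd z0 Kz0; rewrite leNgt; apply/negP => Mz.
(* [dl r^2] is half the excess of [|f z0|] over [M], so the perturbation cannot push the maximum of
   [g] to the boundary. *)
pose dl := (modC (f z0) - M) / (2 * r ^+ 2).
have dl0 : 0 < dl by rewrite divr_gt0 ?subr_gt0// mulr_gt0// exprn_gt0.
have dlr : dl * r ^+ 2 = (modC (f z0) - M) / 2 by rewrite /dl; field; rewrite gt_eqF.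
pose g z := modC (f z) + dl * modC z ^+ 2.
have [||c [cl cr] cmax] := @compact_max (half_disc r) g (@half_disc_compact r).
- by exists z0.
- move=> z Kz e e0; have e20 : 0 < e / 2 by rewrite divr_gt0.
  have [d d0 dd] := modC_cont (cf z Kz) e20.
  have e30 : 0 < e / (4 * dl * r) by rewrite divr_gt0// mulr_gt0// mulr_gt0.
  exists (Num.min d (e / (4 * dl * r))); first by rewrite lt_min d0.
  move=> w [wl wr]; rewrite lt_min => /andP[/(dd w wl) h1 h2].
  rewrite (_ : g w - g z = (modC (f w) - modC (f z)) + dl * ((modC w - modC z) * (modC w + modC z))); last by rewrite /g; ring.
  rewrite (le_lt_trans (ler_normD _ _))// (splitr e) ltr_leD//.
  rewrite normrM (gtr0_norm dl0) normrM.
  have h3 : `|modC w + modC z| <= 2 * r.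
    by case: Kz => _ zr; rewrite ger0_norm ?addr_ge0 ?modC_ge0//; lra.
  have h4 : `|modC w - modC z| <= e / (4 * dl * r).
    apply: le_trans (ltW h2); rewrite ler_norml modC_triB andbT lerNl opprB modC_sub; exact: modC_triB.
  apply: le_trans (_ : dl * (e / (4 * dl * r) * (2 * r)) <= _).
    by rewrite ler_wpM2l ?(ltW dl0)// ler_pM.
  by rewrite le_eqVlt; apply/orP; left; apply/eqP; field; rewrite !gt_eqF.
have gz0 := cmax _ Kz0.
have gz0M : M + dl * r ^+ 2 < g z0.
  rewrite dlr /g; have : 0 <= dl * modC z0 ^+ 2 by rewrite mulr_ge0 ?sqr_ge0// ltW.
  lra.
have cM : M < modC (f c).
  have : dl * modC c ^+ 2 <= dl * r ^+ 2.
    by rewrite ler_wpM2l ?(ltW dl0)// ler_sqr ?nnegrE ?modC_ge0 ?(ltW r0).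
  rewrite /g in gz0 gz0M *; lra.
have cl0 : complex.Im c < 0.
  rewrite lt_neqAle cl andbT; apply/eqP => c0.
  by have := bd c (conj cl cr) (or_introl c0); rewrite leNgt cM.
have cr0 : modC c < r.
  rewrite lt_neqAle cr andbT; apply/eqP => c0.
  by have := bd c (conj cl cr) (or_intror c0); rewrite leNgt cM.
have [s s0 [s1 s2]] : exists2 s : R, 0 < s & complex.Im c + s < 0 /\ modC c + s <= r.
  exists (Num.min (- complex.Im c / 2) (r - modC c)); first by rewrite lt_min subr_gt0 cr0 andbT; lra.
  split.
    have : Num.min (- complex.Im c / 2) (r - modC c) <= - complex.Im c / 2 by rewrite ge_min lexx.
    lra.
  have : Num.min (- complex.Im c / 2) (r - modC c) <= r - modC c by rewrite ge_min lexx orbT.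
  lra.
have [u u1 uf] := unit_factor (f c).
(* The term [k (w - c)] reproduces the linear part of [dl |c + v|^2] holomorphically and vanishes at
   [c]. On the circle the real part of [G] is then at most [|f c| - dl s^2], although its mean is
   [|f c|]. *)
pose k := toC (2 * dl) * Num.conj c.
pose G w := u * f w + k * (w - c).
have hG : holo G (fun w => u * f' w + k).
  move=> w wl; have [df cf'] := hf w wl; split.
    apply: cdiffD; first exact: cdiffZ.
    rewrite -[X in cdiff _ _ X]mulr1; apply: cdiffZ; rewrite -[1]subr0.
    by apply: cdiffB; [exact: cdiff_id|exact: cdiff_cst].
  apply: cont_atD; last exact: cont_at_cst.
  by apply: cont_atM => //; exact: cont_at_cst.
have mv := mean_value_circle hG s0 s1.
have cG := rcont_circle (ltW s0) s1 (holo_cont hG).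
have : rint 0 (2 * pi) (fun x => complex.Re (G (c + toC s * expi x))) <=
       rint 0 (2 * pi) (fun=> modC (f c) - dl * s ^+ 2).
  apply: le_rint; first exact: (rcont_comp (@continuous_Re R) cG).
    exact: cst_continuous.
  move=> x _; set v := toC s * expi x.
  have vs : modC v = s by rewrite /v modCM modC_expi mulr1 modC_toC gtr0_norm.
  have Kcv : half_disc r (c + v).
    split; first by apply/ltW/(lower_ball s1); rewrite addrAC subrr add0r vs.
    by rewrite (le_trans (modCD _ _))// vs.
  have := cmax _ Kcv; rewrite /g modC_sqrD vs => h.
  rewrite /G reD (_ : c + v - c = v); last by ring.
  have h1 : complex.Re (u * f (c + v)) <= modC (f (c + v)).
    by rewrite (le_trans (ler_norm _))// (le_trans (Re_le_modC _))// modCM u1 mul1r.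
  have h2 : complex.Re (k * v) = 2 * dl * complex.Re (Num.conj c * v).
    by rewrite /k -mulrA reM /= mul0r subr0.
  by rewrite h2; lra.
rewrite (rint_cst _ (ltW (@pi2_gt0 R))) -cint_Re mv reM /= mul0r !subr0.
have -> : complex.Re (G c) = modC (f c) by rewrite /G subrr mulr0 addr0 uf.
rewrite mulrC ler_pM2r ?pi2_gt0//.
have : 0 < dl * s ^+ 2 by rewrite mulr_gt0// exprn_gt0.
lra.
Qed.

(* The factor z^2 - r^2 vanishes at the end points of the half circle and there
   absorbs a singularity of order 1 at the real axis. *)
Lemma phragmen_lindelof f f' (M R0 B : R) : holo f f' ->
  (forall z, lowerbar z -> cont_at lowerbar f z) ->
  (forall x : R, modC (f (toC x)) <= M) ->
  (forall z, lower z -> R0 <= modC z -> modC (f z) <= B / - complex.Im z) ->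
  forall z, lower z -> modC (f z) <= M.
Proof.
move=> hf cf bd gr z zl; rewrite leNgt; apply/negP => Mz.
have M0 : 0 <= M by apply: le_trans (bd 0); exact: modC_ge0.
set e := modC (f z) - M; have e0 : 0 < e by rewrite subr_gt0.
pose A := modC (f z) * modC z ^+ 2.
have A0 : 0 <= A by rewrite mulr_ge0 ?sqr_ge0 ?modC_ge0.
(* Large enough that [e r] exceeds [2 |B| + A]: then [e r^2] dominates both the contribution
   [2 |B| r] of the arc and the loss [A] at [z]. *)
pose r := 1 + `|R0| + modC z + (2 * `|B| + A) / e.
have q0 : 0 <= (2 * `|B| + A) / e by rewrite divr_ge0 ?(ltW e0)// addr_ge0// mulr_ge0.
have zp := modC_ge0 z; have Rp := normr_ge0 R0; have Bp := normr_ge0 B.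
have r1 : 1 <= r by rewrite /r; lra.
have r0 : 0 < r by lra.
have rR : R0 <= r by have := ler_norm R0; rewrite /r; lra.
have rz : modC z <= r by rewrite /r; lra.
have re : 2 * `|B| + A < e * r.
  have -> : e * r = e * (1 + `|R0| + modC z) + (2 * `|B| + A) by rewrite /r; field; rewrite gt_eqF.
  by rewrite ltrDr mulr_gt0//; lra.
pose h w := f w * (w * w - toC (r ^+ 2)).
have hh : holo h (fun w => f' w * (w * w - toC (r ^+ 2)) + f w * (1 * w + w * 1)).
  move=> w wl; have [df cf'] := hf w wl; split.
    apply: cdiffM => //; rewrite -[X in cdiff _ _ X]subr0.
    by apply: cdiffB; [apply: cdiffM; exact: cdiff_id|exact: cdiff_cst].
  have ci := @cont_at_id R lower w; have c1 := @cont_at_cst R lower.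
  apply: cont_atD; apply: cont_atM => //.
  - by apply: cont_atB => //; exact: cont_atM.
  - exact: (holo_cont hf).
  - by apply: cont_atD; apply: cont_atM.
have ch w : half_disc r w -> cont_at lowerbar h w.
  move=> [wl _]; apply: cont_atM; first exact: cf.
  apply: cont_atB; last exact: cont_at_cst.
  by apply: cont_atM; exact: cont_at_id.
have := @maximum_principle h _ r (M * r ^+ 2 + 2 * `|B| * r) hh r0 ch.
have Bnd w : half_disc r w -> complex.Im w = 0 \/ modC w = r -> modC (h w) <= M * r ^+ 2 + 2 * `|B| * r.
  move=> [wl wr] [w0|wr'].
    have wE : w = toC (complex.Re w) by apply: complexP => //=.
    have t : modC (h w) <= M * r ^+ 2.
      rewrite /h modCM wE -toCM -toCB modC_toC ler_pM ?modC_ge0//.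
      have : complex.Re w * complex.Re w <= r ^+ 2.
        rewrite -expr2 -real_normK ?num_real// ler_sqr ?nnegrE ?(ltW r0)//.
        exact: le_trans (Re_le_modC _) wr.
      by move=> k; rewrite ler_norml; have := sqr_ge0 (complex.Re w); rewrite expr2 => ?; apply/andP; split; lra.
    by apply: le_trans t _; rewrite lerDl mulr_ge0// ?mulr_ge0// ltW.
  (* On the arc [r^2] is [w] times its conjugate, so the factor has modulus [2 r |Im w|] and cancels
     the growth [B / |Im w|]. *)
  have wE : w * w - toC (r ^+ 2) = w * (iC * toC (2 * complex.Im w)).
    by rewrite -wr' modC_sqr; case: (w) => a b; apply: complexP => /=; ring.
  have [w0|w0] := eqVneq (complex.Im w) 0.
    by rewrite /h wE w0 !mulr0 modC0 addr_ge0// !mulr_ge0 ?sqr_ge0// ltW.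
  have wl' : lower w by rewrite /Defs.lower /= lt_neqAle w0.
  have y0 : 0 < - complex.Im w by rewrite oppr_gt0.
  rewrite /h wE !modCM modC_iC mul1r modC_toC normrM (ger0_norm (ler0n _ 2)) wr' (ler0_norm wl).
  apply: le_trans (_ : `|B| / (- complex.Im w) * (r * (2 * - complex.Im w)) <= _).
    rewrite ler_pM ?modC_ge0 ?mulr_ge0 ?(ltW r0) ?(ltW y0)//.
    have := gr w wl'; rewrite wr' => /(_ rR) /le_trans; apply.
    by rewrite ler_pM2r ?invr_gt0// ler_norm.
  rewrite (_ : `|B| / (- complex.Im w) * (r * (2 * - complex.Im w)) = 2 * `|B| * r); last first.
    by field.
  by rewrite lerDr mulr_ge0// sqr_ge0.
move=> /(_ Bnd z (conj (ltW zl) rz)); rewrite /h modCM => hz.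
have t1 : r ^+ 2 - modC z ^+ 2 <= modC (z * z - toC (r ^+ 2)).
  have := modC_triB (toC (r ^+ 2)) (z * z); rewrite modC_toC ger0_norm ?sqr_ge0// modC_sub.
  by rewrite modCM expr2.
have t2 : modC (f z) * (r ^+ 2 - modC z ^+ 2) <= M * r ^+ 2 + 2 * `|B| * r.
  by apply: le_trans hz; rewrite ler_wpM2l ?modC_ge0.
have t3 : e * r ^+ 2 <= 2 * `|B| * r + A.
  by rewrite /e /A; lra.
have t4 : 2 * `|B| * r + A <= (2 * `|B| + A) * r.
  rewrite [leRHS]mulrDl lerD2l; exact: ler_peMr.
have t5 : (2 * `|B| + A) * r < e * r ^+ 2 by rewrite expr2 mulrA ltr_pM2r.
lra.
Qed.

(* Multiplication by the peak function -is/(z - a - is), equal to 1 at [a] and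
   small on the real axis away from [a]. *)
Lemma boundary_control f f' (a e d M R0 B : R) (k : C) : holo f f' ->
  (forall z, lowerbar z -> cont_at lowerbar f z) ->
  0 < e -> 0 < d -> 0 < M ->
  (forall x : R, modC (f (toC x) - k) <= M) ->
  (forall x : R, `|x - a| < d -> modC (f (toC x) - k) <= e) ->
  (forall z, lower z -> R0 <= modC z -> modC (f z) <= B + B / - complex.Im z) ->
  forall z, lower z -> modC (z - toC a) <= e * d / M -> modC (f z - k) <= 2 * e.
Proof.
move=> hf cf e0 d0 M0 fM fe gr z zl za.
(* At this scale the peak function is at most [s / d = e / M] at distance [d] from [a], which brings
   the global bound [M] down to [e]. *)
set s := e * d / M in za; have s0 : 0 < s by rewrite divr_gt0// mulr_gt0.
pose D w := w - toC a - iC * toC s.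
have Dim w : complex.Im (D w) = complex.Im w - s.
  by rewrite /D !imD !imN /=; case: (w) => ? ? /=; ring.
have D0 w : lowerbar w -> D w != 0.
  move=> wl; apply/eqP => h; have := Dim w; rewrite h /= => h2.
  have : complex.Im w <= 0 by []. lra.
have Dge w : lowerbar w -> s <= modC (D w) /\ - complex.Im w <= modC (D w).
  move=> wl; have := Im_le_modC (D w); rewrite Dim.
  have wl' : complex.Im w <= 0 by [].
  by rewrite ler0_norm; [split; lra|lra].
have sD w : lowerbar w -> 0 <= s / modC (D w).
  by move=> _; apply: mulr_ge0; [exact: ltW|rewrite invr_ge0 modC_ge0].
pose P w := (f w - k) * (- (iC * toC s) * (D w)^-1).
have hP : holo P (fun w => (f' w - 0) * (- (iC * toC s) * (D w)^-1) +
     (f w - k) * (- (iC * toC s) * (- (1 - 0 - 0) / D w ^+ 2))).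
  move=> w wl; have [df cf'] := hf w wl; have D0w := D0 _ (ltW wl).
  have cD : cont_at lower D w.
    by apply: cont_atB; [apply: cont_atB|]; [exact: cont_at_id|exact: cont_at_cst..].
  split.
    apply: cdiffM; first by apply: cdiffB => //; exact: cdiff_cst.
    apply: cdiffZ; apply: cdiffV => //.
    by apply: cdiffB; [apply: cdiffB|]; [exact: cdiff_id|exact: cdiff_cst..].
  have c1 := @cont_at_cst R lower.
  apply: cont_atD; apply: cont_atM.
  - exact: cont_atB.
  - by apply: cont_atM => //; exact: cont_atV.
  - by apply: cont_atB => //; exact: (holo_cont hf).
  - apply: cont_atM => //; apply: cont_atM => //; apply: cont_atV; last exact: cont_atM.
    by rewrite expf_neq0.
have cP w : lowerbar w -> cont_at lowerbar P w.
  move=> wl; apply: cont_atM; first by apply: cont_atB; [exact: cf|exact: cont_at_cst].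
  apply: cont_atM; first exact: cont_at_cst.
  apply: cont_atV; first exact: D0.
  by apply: cont_atB; [apply: cont_atB|]; [exact: cont_at_id|exact: cont_at_cst..].
have mE w : modC (P w) = modC (f w - k) * (s / modC (D w)).
  by rewrite /P modCM modCM modCN modCM modC_iC mul1r modC_toC gtr0_norm// modCV.
have := @phragmen_lindelof P _ e R0 ((`|B| + modC k) * s + `|B|) hP cP.
have bdP (x : R) : modC (P (toC x)) <= e.
  have xl : lowerbar (toC x : C) by rewrite /Defs.lowerbar /=.
  have [Ds _] := Dge _ xl; have Dp : 0 < modC (D (toC x)) by exact: lt_le_trans Ds.
  rewrite mE; have [xa|xa] := ltrP `|x - a| d.
    rewrite -[leRHS]mulr1 ler_pM ?modC_ge0 ?sD//; first exact: fe.
    by rewrite ler_pdivrMr// mul1r.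
  have dD : d <= modC (D (toC x)).
    apply: le_trans xa _; apply: le_trans (Re_le_modC _).
    by rewrite /D !reD !reN /= le_eqVlt; apply/orP; left; apply/eqP; congr (`|_|); ring.
  apply: le_trans (_ : M * (s / d) <= _).
    rewrite ler_pM ?modC_ge0 ?sD//.
    by rewrite ler_pM2l// lef_pV2.
  by rewrite le_eqVlt; apply/orP; left; apply/eqP; rewrite /s; field; rewrite !gt_eqF.
have grP w : lower w -> R0 <= modC w -> modC (P w) <= ((`|B| + modC k) * s + `|B|) / - complex.Im w.
  move=> wl wR; have [Ds Dy] := Dge _ (ltW wl).
  have Dp : 0 < modC (D w) by exact: lt_le_trans Ds.
  have y0 : 0 < - complex.Im w by rewrite oppr_gt0.
  have h1 : modC (f w - k) <= (`|B| + modC k) + `|B| / - complex.Im w.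
    apply: le_trans (modCB _ _) _; rewrite -addrA (addrC (modC k)) addrA lerD2r.
    apply: le_trans (gr w wl wR) _; apply: lerD; first exact: ler_norm.
    by rewrite ler_pM2r ?invr_gt0// ler_norm.
  rewrite mE; apply: le_trans (_ : ((`|B| + modC k) + `|B| / - complex.Im w) * (s / modC (D w)) <= _).
    by rewrite ler_wpM2r// sD//; exact: ltW.
  (* The bounded part of the growth is damped by the decay [s / |Im w|] of the peak function, as
     [phragmen_lindelof] requires. *)
  have t1 : s / modC (D w) <= s / - complex.Im w by rewrite ler_pM2l// lef_pV2.
  have t2 : s / modC (D w) <= 1 by rewrite ler_pdivrMr// mul1r.
  rewrite (mulrDl (_ * s)) mulrDl lerD//.
    by rewrite -mulrA ler_wpM2l// addr_ge0 ?modC_ge0.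
  by rewrite ler_piMr// divr_ge0// ltW.
move=> /(_ bdP grP z zl); rewrite mE => hz.
have [Ds _] := Dge _ (ltW zl); have Dp : 0 < modC (D z) by exact: lt_le_trans Ds.
(* Within distance [s] of [a] the peak function has modulus at least 1/2, whence the factor 2 in the
   conclusion. *)
have D2 : modC (D z) <= 2 * s.
  by rewrite /D (le_trans (modCB _ _))// modCM modC_iC mul1r modC_toC gtr0_norm//; lra.
have : 2^-1 <= s / modC (D z).
  by rewrite ler_pdivlMr// mulrC ler_pdivrMr// mulrC.
move=> h; have : modC (f z - k) * 2^-1 <= e by apply: le_trans hz; rewrite ler_wpM2l ?modC_ge0.
by rewrite ler_pdivrMr// mulrC.
Qed.

(* Averaging over horizontal segments turns control of horizontal oscillation
   into control of vertical oscillation. *)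
Lemma vertical_oscillation f f' (a r y1 y2 k : R) : holo f f' -> 0 < r -> y1 <= y2 -> y2 < 0 ->
  (forall x y, `|x - a| <= r -> y1 <= y <= y2 ->
     modC (f (Complex x y) - f (Complex a y)) <= k) ->
  modC (f (Complex a y2) - f (Complex a y1)) <= k * (2 + (y2 - y1) / r).
Proof.
move=> hf r0 y12 y20 osc.
pose J y := cint (a - r) (a + r) (fun x => f (Complex x y)).
have ab : a - r < a + r by lra.
have cf y : y < 0 -> rcont (fun x => f (Complex x y)).
  move=> yl; apply: (@is_rderiv_rcont _ _ (fun x => f' (Complex x y))) => x.
  have [df _] := hf (Complex x y) yl; exact: (cdiff_horizontal setT df).
have k0 : 0 <= k.
  apply: le_trans (modC_ge0 _) (osc a y1 _ _); first by rewrite subrr normr0 ltW.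
  by rewrite lexx.
(* The derivative of [J] in the height is [i] times the difference of [f] between the two ends, each
   within [k] of the value over the midpoint. *)
have hJ : modC (J y2 - J y1) <= 2 * k * (y2 - y1).
  apply: (@cint_shift R f f' (fun=> iC) (a - r) (a + r) y1 y2 (2 * k) ab y12).
    move=> z /andP[z1 z2]; have zl : lower z by apply: le_lt_trans y20.
    have [df cf'] := hf z zl; split.
    - exact: (cdiff_horizontal setT df).
    - exact: (cdiff_vertical setT df).
    - move=> e e0; have [d d0 dd] := cf' e e0; exists d => // w /andP[w1 w2]; apply: dd.
      exact: le_lt_trans y20.
    - exact: cont_at_cst.
  move=> s s12; rewrite modCM modC_iC mul1r mulr_natl mulr2n.
  apply: le_trans (modC_tri _ (f (Complex a s)) _) _; rewrite lerD//.
    by apply: osc => //; rewrite addrAC subrr add0r gtr0_norm.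
  by rewrite modC_sub; apply: osc => //; rewrite addrAC subrr add0r normrN gtr0_norm.
have hA y : y1 <= y <= y2 -> modC (J y - f (Complex a y) * toC (2 * r)) <= k * (2 * r).
  move=> /andP[h1 h2]; have yl : y < 0 by exact: le_lt_trans y20.
  have rE : 2 * r = (a + r) - (a - r) by ring.
  rewrite rE -(cint_cst _ (ltW ab)) -(cintB _ _ (cf y yl) (rcont_cst _)).
  apply: (cint_bound (ltW ab) (rcontD (cf y yl) (rcontN (rcont_cst _)))) => x /andP[x1 x2].
  by apply: osc; [rewrite ler_norml; apply/andP; split; lra|rewrite h1].
have r20 : 0 < 2 * r by rewrite mulr_gt0.
rewrite -(ler_pM2r r20) -{1}(gtr0_norm r20) -modC_toC -modCM.
rewrite (_ : (f (Complex a y2) - f (Complex a y1)) * toC (2 * r) =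
  (J y2 - J y1) + (J y1 - f (Complex a y1) * toC (2 * r)) - (J y2 - f (Complex a y2) * toC (2 * r))); last by ring.
apply: le_trans (modCB _ _) _; apply: le_trans (lerD (modCD _ _) (lexx _)) _.
have h1 := hA y1; have h2 := hA y2; rewrite !lexx !y12 /= in h1 h2.
have {}h1 := h1 isT; have {}h2 := h2 isT.
rewrite (_ : k * (2 + (y2 - y1) / r) * (2 * r) = 2 * k * (y2 - y1) + k * (2 * r) + k * (2 * r)); last first.
  by field; rewrite gt_eqF.
lra.
Qed.

(** The approach is unrestricted within the open half plane, not only along the normal; this makes
    the glued function of [cont_at_glue] continuous. *)
Definition tends_lower (f : C -> C) (a : R) (l : C) : Prop :=
  forall e : R, 0 < e -> exists2 d : R, 0 < d &
    forall z, lower z -> modC (z - toC a) < d -> modC (f z - l) < e.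

(** Real and imaginary parts converge along [a - i / (n + 1)] by completeness of the reals, and the
    Cauchy condition carries the limit over to every approach. *)
Lemma cauchy_tends_lower f (a : R) :
  (forall e : R, 0 < e -> exists2 d : R, 0 < d & forall z w, lower z -> lower w ->
     modC (z - toC a) < d -> modC (w - toC a) < d -> modC (f z - f w) < e) ->
  exists l, tends_lower f a l.
Proof.
move=> h.
pose p (n : nat) : C := Complex a (- n.+1%:R^-1).
have pl n : lower (p n) by rewrite /Defs.lower /p /= oppr_lt0 invr_gt0.
have pa n : modC (p n - toC a) = n.+1%:R^-1.
  rewrite (_ : p n - toC a = iC * toC (- n.+1%:R^-1)); last by apply: complexP => /=; ring.
  by rewrite modCM modC_iC mul1r modC_toC normrN gtr0_norm// invr_gt0.
have small (d : R) : 0 < d -> \forall n \near \oo, modC (p n - toC a) < d.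
  move=> d0; have := near_infty_natSinv_lt (PosNum d0).
  by apply: filterS => n hn; change (modC (p n - toC a) < d); rewrite pa; exact: hn.
have cr (G : C -> R) : (forall z w, `|G z - G w| <= modC (z - w)) ->
    cvg (G (f (p n)) @[n --> \oo]).
  move=> GL; apply: cauchy_cvg; apply: cauchy_exP => e e0.
  have [d d0 dd] := h e e0.
  have /small[N _ hN] := d0.
  exists (G (f (p N))); exists N => // n /= Nn; rewrite -ball_normE /ball_ /=.
  by apply: le_lt_trans (GL _ _) _; apply: dd => //; apply: hN => /=.
have [x hx] : exists x : R, complex.Re (f (p n)) @[n --> \oo] --> x.
  by exists (lim (complex.Re (f (p n)) @[n --> \oo])); apply: cr => z w; rewrite -reN -reD Re_le_modC.
have [y hy] : exists y : R, complex.Im (f (p n)) @[n --> \oo] --> y.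
  by exists (lim (complex.Im (f (p n)) @[n --> \oo])); apply: cr => z w; rewrite -imN -imD Im_le_modC.
exists (Complex x y) => e e0; have e30 : 0 < e / 3 by rewrite divr_gt0.
have [d d0 dd] := h _ e30; exists d => // z zl za.
have /small[N1 _ h1] := d0.
have /cvgrPdist_lt/(_ _ e30)[N2 _ h2] := hx.
have /cvgrPdist_lt/(_ _ e30)[N3 _ h3] := hy.
pose n := maxn N1 (maxn N2 N3).
have k1 := h1 n (leq_maxl _ _).
have k2 := h2 n (leq_trans (leq_maxl N2 N3) (leq_maxr N1 _)).
have k3 := h3 n (leq_trans (leq_maxr N2 N3) (leq_maxr N1 _)).
have k4 := dd z (p n) zl (pl n) za k1.
apply: le_lt_trans (modC_tri _ (f (p n)) _) _.
have k5 : modC (f (p n) - Complex x y) <= `|x - complex.Re (f (p n))| + `|y - complex.Im (f (p n))|.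
  apply: le_trans (modC_le _) _; rewrite reD reN imD imN /=.
  by rewrite (distrC x) (distrC y).
move: k2 k3 => /= k2 k3; lra.
Qed.

End MaximumPrinciple.

(** * L^2 traces and boundary limits *)

Section HorizontalLines.
Context {R : realType}.
Local Notation C := R[i].
Local Notation lower := (@lower R).
Implicit Types (f g u : C -> C).

Lemma holo_rcont f f' y : holo f f' -> y < 0 -> rcont (fun x => f (Complex x y)).
Proof.
move=> hf yl; apply: (@is_rderiv_rcont _ _ (fun x => f' (Complex x y))) => x.
have [df _] := hf (Complex x y) yl; exact: (cdiff_horizontal setT df).
Qed.

Lemma holo_rcont_deriv f f' y : holo f f' -> y < 0 -> rcont (fun x => f' (Complex x y)).
Proof.
move=> hf yl x e e0; have [_ /(_ e e0)[d d0 dd]] := hf (Complex x y) yl.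
exists d => // x' xx'; apply: dd => //; apply: le_lt_trans (modC_le _) _.
by rewrite /= subrr normr0 addr0.
Qed.

Lemma rcont_modC (f : R -> C) : rcont f -> continuous (fun x => modC (f x)).
Proof. exact/rcont_comp/continuous_modC. Qed.

Lemma continuous_sqr (h : R -> R) : continuous h -> continuous (fun x => h x ^+ 2).
Proof. by move=> ch x; rewrite (_ : (fun x => h x ^+ 2) = (fun x => h x * h x))//; apply: cvgM; exact: ch. Qed.

Lemma rcont_modC_sqr (f : R -> C) : rcont f -> continuous (fun x => modC (f x) ^+ 2).
Proof. by move=> cf; apply: continuous_sqr; exact: rcont_modC. Qed.

Lemma horizontal_increment f f' (x1 x2 y : R) : holo f f' -> y < 0 -> x1 <= x2 ->
  modC (f (Complex x2 y) - f (Complex x1 y)) <= rint x1 x2 (fun x => modC (f' (Complex x y))).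
Proof.
move=> hf yl; rewrite le_eqVlt => /predU1P[->|x12].
  by rewrite subrr modC0; apply: rint_ge0 => x _; exact: modC_ge0.
have cf' := holo_rcont_deriv hf yl.
rewrite -(@cint_FTC _ x1 x2 (fun x => f' (Complex x y)) (fun x => f (Complex x y)) x12 cf').
  by apply: cint_le => //; [exact: ltW|exact: rcont_modC].
by move=> x; have [df _] := hf (Complex x y) yl; exact: (cdiff_horizontal setT df).
Qed.

(** The integral is taken over the whole segment whatever [x] is, so one small integral controls all
    its points. *)
Lemma horizontal_oscillation f f' (a d x y : R) (h : R -> R) : holo f f' -> y < 0 -> continuous h ->
  (forall s, `|s - a| <= d -> modC (f' (Complex s y)) <= h s) ->
  (forall s, 0 <= h s) ->
  `|x - a| <= d -> modC (f (Complex x y) - f (Complex a y)) <= rint (a - d) (a + d) h.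
Proof.
move=> hf yl ch fh h0 xa; have d0 : 0 <= d by apply: le_trans xa.
have cf' := rcont_modC (holo_rcont_deriv hf yl).
move: (xa); rewrite ler_norml => /andP[xa1 xa2].
have sub (x1 x2 : R) : a - d <= x1 -> x2 <= a + d ->
    rint x1 x2 (fun x => modC (f' (Complex x y))) <= rint (a - d) (a + d) h.
  move=> h1 h2; apply: le_trans (_ : rint x1 x2 h <= _).
    apply: le_rint => // s /andP[s1 s2]; apply: fh; rewrite ler_norml; apply/andP; split; lra.
  by apply: rint_subset.
have [ax|xa'] := lerP a x.
  by apply: le_trans (horizontal_increment hf yl ax) _; apply: sub; lra.
rewrite modC_sub; apply: le_trans (horizontal_increment hf yl (ltW xa')) _; apply: sub; lra.
Qed.

(** Horizontal control suffices: on a box of half-width and depth [d], [vertical_oscillation] bounds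
    the variation along the vertical line at [a] by three times the horizontal one. Joining two
    points through that line costs [(1 + 3 + 1) e / 9]. *)
Lemma horizontal_limit u u' (a : R) : holo u u' ->
  (forall e : R, 0 < e -> exists2 d : R, 0 < d & forall x y, - d < y < 0 -> `|x - a| <= d ->
     modC (u (Complex x y) - u (Complex a y)) <= e) ->
  exists l, tends_lower u a l.
Proof.
move=> hu osc; apply: cauchy_tends_lower => e e0.
have e9 : 0 < e / 9 by rewrite divr_gt0.
have [d d0 dd] := osc _ e9; exists d => //.
have vert y1 y2 : y1 <= y2 -> - d < y1 -> y2 < 0 ->
    modC (u (Complex a y2) - u (Complex a y1)) <= 3 * (e / 9).
  move=> y12 y1d y20; apply: le_trans (_ : e / 9 * (2 + (y2 - y1) / d) <= _).
    apply: (vertical_oscillation hu d0 y12 y20) => x y xa /andP[h1 h2].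
    by apply: dd => //; apply/andP; split; lra.
  rewrite mulrC ler_wpM2r ?(ltW e9)//.
  have : (y2 - y1) / d <= 1 by rewrite ler_pdivrMr//; lra.
  lra.
move=> [x1 y1] [x2 y2]; rewrite /Defs.lower /= => y1l y2l z1 z2.
have near (x y : R) : modC (Complex x y - toC a) < d -> `|x - a| <= d /\ - d < y.
  move=> h; split.
    apply/ltW; apply: le_lt_trans h; apply: le_trans (Re_le_modC _); by rewrite reD reN.
  have := le_lt_trans (Im_le_modC _) h; rewrite imD imN /= subr0 ltr_norml => /andP[]; lra.
have [x1a y1d] := near _ _ z1; have [x2a y2d] := near _ _ z2.
have k1 : modC (u (Complex x1 y1) - u (Complex a y1)) <= e / 9.
  by apply: dd => //; rewrite y1d.
have k2 : modC (u (Complex x2 y2) - u (Complex a y2)) <= e / 9.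
  by apply: dd => //; rewrite y2d.
have k3 : modC (u (Complex a y1) - u (Complex a y2)) <= 3 * (e / 9).
  have [y12|y21] := lerP y1 y2; first by rewrite modC_sub; exact: vert.
  by apply: vert => //; exact: ltW.
apply: le_lt_trans (modC_tri _ (u (Complex a y1)) _) _.
apply: le_lt_trans (lerD k1 (modC_tri _ (u (Complex a y2)) _)) _.
rewrite (modC_sub (u (Complex a y2))); lra.
Qed.

Lemma is_rderiv_conj (I : set R) (f : R -> C) (x : R) (l : C) :
  is_rderiv I f x l -> is_rderiv I (fun y => Num.conj (f y)) x (Num.conj l).
Proof.
move=> /is_rderivP h; apply/is_rderivP => e e0; have [d d0 dd] := h e e0.
exists d => // y Iy yx; apply: le_trans (dd y Iy yx).
rewrite -[leRHS]modC_conj le_eqVlt; apply/orP; left; apply/eqP; congr modC.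
rewrite !rmorphB rmorphM /=; congr (_ - _ * _).
by rewrite conjE; apply: complexP => //=; rewrite oppr0.
Qed.

Lemma mul_conj (z : C) : z * Num.conj z = toC (modC z ^+ 2).
Proof. by rewrite modC_sqr conjE; case: z => c d; apply: complexP => /=; ring. Qed.

End HorizontalLines.

(** * Convergence in L^2 of the traces on horizontal lines *)

Section Hardy.
Context {R : realType}.
Local Notation C := R[i].
Local Notation lower := (@lower R).
Variables (f f' : C -> C) (B K : R).
Hypothesis hf : holo f f'.
Hypothesis fB : forall y N, y < 0 -> rint (- N) N (fun x => modC (f (Complex x y)) ^+ 2) <= B.
Hypothesis K0 : 0 <= K.
Hypothesis fdecay : forall x y, y < 0 -> modC (f (Complex x y)) * `|x| <= K / - y.

Let W y N := rint (- N) N (fun x => modC (f (Complex x y)) ^+ 2).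
(** The squared L^2 norm at height [y], written as a supremum of truncations so that only integrals
    of continuous functions over segments occur. *)
Let phi y := sup [set W y N | N in [set: R]].

Let Wphi y N : y < 0 -> W y N <= phi y.
Proof.
move=> yl; apply: ub_le_sup; last by exists N.
by exists B => _ [N' _ <-]; exact: fB.
Qed.

Let phiB y : y < 0 -> phi y <= B.
Proof. by move=> yl; apply: ge_sup => [|_ [N _ <-]]; [exists (W y 0), 0|exact: fB]. Qed.

Let Wmono y N N' : y < 0 -> N <= N' -> W y N <= W y N'.
Proof.
move=> yl NN'; apply: rint_subset; [exact/rcont_modC_sqr/(holo_rcont hf)|by move=> x; exact: sqr_ge0|by rewrite lerN2|by []].
Qed.

Let phi_approx y e : y < 0 -> 0 < e -> exists N, phi y - e < W y N.
Proof.
move=> yl e0; have hs : has_sup [set W y N | N in [set: R]].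
  by split; [exists (W y 0), 0|exists B => _ [N' _ <-]; exact: fB].
by have [_ [N _ <-] h] := sup_adherent e0 hs; exists N.
Qed.

(* The inner product of the traces at heights [y] and [s] depends on [y + s] only,
   up to boundary terms at the ends of the segment. *)
Let shift y s N : s <= y -> y < 0 -> 0 < N ->
  modC (cint (- N) N (fun x => f (Complex x y) * Num.conj (f (Complex x s))) -
        toC (W ((y + s) / 2) N)) <= 2 * (K / - y / N) ^+ 2 * ((y - s) / 2).
Proof.
move=> sy y0 N0; pose m := (y + s) / 2; pose t := (y - s) / 2.
have t0 : 0 <= t by rewrite /t; lra.
have mty : m + t = y by rewrite /m /t; lra.
have mts : m - t = s by rewrite /m /t; lra.
(* The heights [m + r] and [m - r] keep their sum fixed. Conjugation turns [-i] into [i], so the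
   derivative in [r] is [i] times the derivative in [x]; at [r = 0] the product is [|f|^2] at the
   middle height. *)
pose Phi (z : C) := f (z + iC * toC m) * Num.conj (f (Num.conj z + iC * toC m)).
pose Psi (z : C) := f' (z + iC * toC m) * Num.conj (f (Num.conj z + iC * toC m)) +
  f (z + iC * toC m) * Num.conj (f' (Num.conj z + iC * toC m)).
have E1 x r : (Complex x r + iC * toC m : C) = Complex x (m + r).
  by apply: complexP => /=; ring.
have E2 x r : Num.conj (Complex x r : C) + iC * toC m = Complex x (m - r).
  by rewrite conjE; apply: complexP => /=; ring.
have H : modC (cint (- N) N (fun x => Phi (Complex x t)) - cint (- N) N (fun x => Phi (Complex x 0)))
    <= 2 * (K / - y / N) ^+ 2 * (t - 0).
  have NN : - N < N by lra.
  apply: (@cint_shift R Phi Psi (fun=> iC) (- N) N 0 t _ NN t0).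
    move=> [x r] /= /andP[r0 rt].
    have l1 : m + r < 0 by lra.
    have l2 : m - r < 0 by lra.
    have [d1 c1] := hf (z := Complex x (m + r)) l1; have [d2 c2] := hf (z := Complex x (m - r)) l2.
    have cf := holo_cont hf.
    split.
    - have h := is_rderivM (cdiff_horizontal setT d1) (is_rderiv_conj (cdiff_horizontal setT d2)).
      rewrite /Psi E1 E2; apply: (is_rderiv_eq _ h) => u /=; by rewrite /Phi E1 E2.
    - have p1 : is_rderiv setT (fun u => Complex x m + iC * toC u) r (iC : C) by exact: is_rderiv_affine.
      have p2 : is_rderiv setT (fun u => Complex x m + (- iC) * toC u) r (- iC : C) by exact: is_rderiv_affine.
      have F1 u : (Complex x m + iC * toC u : C) = Complex x (m + u) by apply: complexP => /=; ring.
      have F2 u : (Complex x m + (- iC) * toC u : C) = Complex x (m - u) by apply: complexP => /=; ring.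
      have d1' : cdiff f (Complex x m + iC * toC r) (f' (Complex x (m + r))) by rewrite F1.
      have d2' : cdiff f (Complex x m + (- iC) * toC r) (f' (Complex x (m - r))) by rewrite F2.
      have h := is_rderivM (cdiff_path p1 d1') (is_rderiv_conj (cdiff_path p2 d2')).
      have e : f' (Complex x (m + r)) * iC * Num.conj ((f \o (fun u => Complex x m + (- iC) * toC u)) r) +
        (f \o (fun u => Complex x m + iC * toC u)) r * Num.conj (f' (Complex x (m - r)) * - iC) = iC * Psi (Complex x r).
        rewrite /Psi E1 E2 /= F1 F2 rmorphM rmorphN /= (_ : Num.conj iC = - iC); last first.
          by rewrite conjE; apply: complexP => /=; ring.
        by ring.
      rewrite -e; apply: (is_rderiv_eq _ h) => u /=; by rewrite /Phi E1 E2 F1 F2.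
    - pose D := [set w : C | 0 <= complex.Im w <= t].
      have comp1 (g : C -> C) : cont_at lower g (Complex x (m + r)) -> cont_at D (fun z => g (z + iC * toC m)) (Complex x r).
        move=> cg e e0; have [d d0 dd] := cg e e0; exists d => // w /andP[w0 wt] wz.
        rewrite E1; apply: dd.
          by rewrite /Defs.lower /=; case: (w) w0 wt => a b /= ? ?; lra.
        rewrite (_ : w + iC * toC m - Complex x (m + r) = w - Complex x r)//.
        by rewrite -E1; ring.
      have comp2 (g : C -> C) : cont_at lower g (Complex x (m - r)) -> cont_at D (fun z => Num.conj (g (Num.conj z + iC * toC m))) (Complex x r).
        move=> cg e e0; have [d d0 dd] := cg e e0; exists d => // w /andP[w0 wt] wz.
        rewrite E2 -rmorphB /= modC_conj; apply: dd.
          by rewrite /Defs.lower conjE /=; case: (w) w0 wt => a b /= ? ?; lra.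
        rewrite (_ : Num.conj w + iC * toC m - Complex x (m - r) = Num.conj (w - Complex x r)) ?modC_conj//.
        by rewrite -E2 rmorphB /=; ring.
      apply: cont_atD; apply: cont_atM.
      + exact: comp1.
      + by apply: comp2; exact: cf.
      + by apply: comp1; exact: cf.
      + exact: comp2.
    - exact: cont_at_cst.
  have end_bound x r : `|x| = N -> 0 <= r <= t -> modC (Phi (Complex x r)) <= (K / - y / N) ^+ 2.
    move=> xN /andP[r0 rt]; rewrite /Phi E1 E2 modCM modC_conj.
    have pt p : p <= y -> modC (f (Complex x p)) <= K / - y / N.
      move=> py; have p0 : p < 0 by lra.
      have := fdecay x p0; rewrite xN -ler_pdivlMr// => /le_trans; apply.
      by rewrite ler_pM2r ?invr_gt0// ler_wpM2l// lef_pV2 ?posrE; lra.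
    rewrite expr2; apply: ler_pM; [exact: modC_ge0|exact: modC_ge0| |]; apply: pt; lra.
  move=> r rt; rewrite modCM modC_iC mul1r; apply: le_trans (modCB _ _) _.
  rewrite (_ : 2 * (K / - y / N) ^+ 2 = (K / - y / N) ^+ 2 + (K / - y / N) ^+ 2); last by ring.
  by apply: lerD; apply: end_bound => //; rewrite ?normrN gtr0_norm.
rewrite subr0 in H; apply: le_trans H; rewrite le_eqVlt; apply/orP; left; apply/eqP.
congr (modC (_ - _)).
  by congr cint; apply/funext => x; rewrite /Phi E1 E2 mty mts.
have -> : (fun x => Phi (Complex x 0)) = (fun x => toC (modC (f (Complex x m)) ^+ 2)).
  by apply/funext => x; rewrite /Phi E1 E2 addr0 subr0 mul_conj.
apply: complexP; rewrite ?cint_Re ?cint_Im//=.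
by rewrite /rint /Rintegral integral0.
Qed.

(** In the expanded square the cross term is the squared norm at the middle height up to end terms
    of order [N^-2]; the truncation is therefore enlarged before the comparison with [phi]. *)
Let dist y s N : s <= y -> y < 0 ->
  rint (- N) N (fun x => modC (f (Complex x y) - f (Complex x s)) ^+ 2) <=
  phi y + phi s - 2 * phi ((y + s) / 2).
Proof.
move=> sy y0; have s0 : s < 0 by lra.
set m := (y + s) / 2; have m0 : m < 0 by rewrite /m; lra.
apply/ler_addgt0Pl => e e0; have e4 : 0 < e / 4 by rewrite divr_gt0.
have [N1 hN1] := phi_approx m0 e4.
pose Q := 2 * (K / - y) ^+ 2 * ((y - s) / 2).
have Q0 : 0 <= Q.
  by apply: mulr_ge0; [apply: mulr_ge0 => //; exact: sqr_ge0|lra].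
(* Beyond [N] and [N1], and so large that the end terms [Q / N2^2] are at most [e / 4]. *)
pose N2 := 1 + `|N| + `|N1| + 4 * Q / e.
have p0 := normr_ge0 N; have p1 := normr_ge0 N1.
have p2 : 0 <= 4 * Q / e by apply: divr_ge0; [exact: mulr_ge0|exact: ltW].
have N21 : 1 <= N2 by rewrite /N2; lra.
have N20 : 0 < N2 by lra.
have NN2 : N <= N2 by have := ler_norm N; rewrite /N2; lra.
have N1N2 : N1 <= N2 by have := ler_norm N1; rewrite /N2; lra.
have cy := holo_rcont hf y0; have cs := holo_rcont hf s0.
apply: le_trans (_ : rint (- N2) N2 (fun x => modC (f (Complex x y) - f (Complex x s)) ^+ 2) <= _).
  apply: rint_subset => //; first exact/rcont_modC_sqr/(rcontD cy (rcontN cs)).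
    by move=> x; exact: sqr_ge0.
  by rewrite lerN2.
have cI := rcontM cy (rcont_conj cs).
have cRI := rcont_comp (@continuous_Re R) cI.
have c2 : continuous (fun x => - 2 * complex.Re (f (Complex x y) * Num.conj (f (Complex x s)))).
  by move=> x; apply: cvgM; [exact: cvg_cst|exact: cRI].
have cyy := rcont_modC_sqr cy; have css := rcont_modC_sqr cs.
have -> : rint (- N2) N2 (fun x => modC (f (Complex x y) - f (Complex x s)) ^+ 2) =
    W y N2 + W s N2 - 2 * complex.Re (cint (- N2) N2 (fun x => f (Complex x y) * Num.conj (f (Complex x s)))).
  rewrite cint_Re -mulNr -(rintZ _ _ _ cRI) -(rintD _ _ cyy css) -(rintD _ _ _ c2); last first.
    by move=> x; apply: cvgD; [exact: cyy|exact: css].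
  congr rint; apply/funext => x; rewrite !modC_sqr conjE.
  by case: (f _) => a b; case: (f _) => c d /=; ring.
have := shift sy y0 N20; rewrite -/m.
set J := cint _ _ _ => hs.
have hQ : 2 * (K / - y / N2) ^+ 2 * ((y - s) / 2) <= e / 4.
  rewrite (_ : _ * _ * _ = Q / N2 ^+ 2); last first.
    rewrite /Q; field; by rewrite (lt_eqF y0) (gt_eqF N20).
  rewrite ler_pdivrMr ?exprn_gt0//.
  have : Q <= e / 4 * N2.
    have : 4 * Q <= e * N2.
      have -> : 4 * Q = e * (4 * Q / e) by field; rewrite gt_eqF.
      by rewrite ler_pM2l// /N2; lra.
    lra.
  move=> /le_trans; apply; by rewrite ler_pM2l// expr2 -[leLHS]mulr1 ler_pM2l.
have hre : W m N2 - e / 4 <= complex.Re J.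
  have := le_trans (Re_le_modC _) (le_trans hs hQ); rewrite reD reN /= ler_norml => /andP[]; lra.
have hW := lt_le_trans hN1 (Wmono m0 N1N2).
have := Wphi N2 y0; have := Wphi N2 s0; lra.
Qed.

Let phi_ge0 y : y < 0 -> 0 <= phi y.
Proof.
move=> y0; apply: le_trans (Wphi 0 y0); apply: rint_ge0 => x _; exact: sqr_ge0.
Qed.

Let midconvex y s : s <= y -> y < 0 -> 2 * phi ((y + s) / 2) <= phi y + phi s.
Proof.
move=> sy y0; have h := @dist y s 0 sy y0; rewrite -subr_ge0; apply: le_trans h.
apply: rint_ge0 => x _; exact: sqr_ge0.
Qed.

(** A midpoint convex function that drops by [D] between [s] and [y] gains at least [D] at each step
    of an arithmetic progression towards minus infinity, which the bound [B] forbids. *)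
Let phi_mono y s : s <= y -> y < 0 -> phi s <= phi y.
Proof.
move=> sy y0; rewrite leNgt; apply/negP => lt.
pose d := y - s; pose D := phi s - phi y; have D0 : 0 < D by rewrite subr_gt0.
have d0 : 0 <= d by rewrite subr_ge0.
have grow n : phi (s - n%:R * d) - phi (y - n%:R * d) >= D.
  elim: n => [|n IH]; first by rewrite mul0r !subr0.
  have nd : 0 <= n%:R * d by rewrite mulr_ge0.
  have := @midconvex (y - n%:R * d) (s - n.+1%:R * d).
  have -> : (y - n%:R * d + (s - n.+1%:R * d)) / 2 = s - n%:R * d.
    by rewrite -natr1 /d; field.
  have -> : y - n.+1%:R * d = s - n%:R * d by rewrite -natr1 /d; ring.
  have h1 : s - n.+1%:R * d <= y - n%:R * d by rewrite -natr1; lra.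
  have h2 : y - n%:R * d < 0 by lra.
  move=> /(_ h1 h2); lra.
have growth n : phi s + n%:R * D <= phi (s - n%:R * d).
  elim: n => [|n IH]; first by rewrite !mul0r subr0 addr0.
  have := grow n.+1.
  have -> : y - n.+1%:R * d = s - n%:R * d by rewrite -natr1 /d; ring.
  rewrite -(@natr1 R n) => h; move: IH h; lra.
have [n hn] : exists n : nat, B / D < n%:R.
  by exists (Num.truncn (B / D)).+1; exact: truncnS_gt.
have := growth n; rewrite ltr_pdivrMr// in hn.
have sn : s - n%:R * d < 0.
  have : 0 <= n%:R * d by rewrite mulr_ge0. lra.
have := phiB sn; have := phi_ge0 (le_lt_trans sy y0); lra.
Qed.

(** Take [s] with [phi s] close to the supremum of [phi]. By monotonicity the value at the middle
    height is at least [phi s], so the right-hand side of [dist] is at most [phi y - phi s]. *)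
Lemma traces_cauchy (e : R) : 0 < e -> exists2 s : R, s < 0 &
  forall y N, s <= y < 0 -> rint (- N) N (fun x => modC (f (Complex x y) - f (Complex x s)) ^+ 2) <= e.
Proof.
move=> e0; pose S := [set phi y | y in [set y | y < 0]].
have hS : has_sup S.
  split; first by exists (phi (-1)), (-1) => //=; rewrite oppr_lt0.
  by exists B => _ [y y0 <-]; exact: phiB.
have e2 : 0 < e / 2 by rewrite divr_gt0.
have [_ [s s0 <-] hs] := sup_adherent e2 hS.
exists s => // y N /andP[sy y0]; apply: le_trans (dist N sy y0) _.
have up z : z < 0 -> phi z <= sup S.
  by move=> z0; apply: ub_le_sup; [case: hS|exists z].
have h1 := up y y0; have h2 := up s s0.
have m1 : s <= (y + s) / 2 by lra.
have m2 : (y + s) / 2 < 0 by lra.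
have := phi_mono m1 m2; lra.
Qed.

End Hardy.

(** * Limits at a boundary point *)

Section BoundaryLimits.
Context {R : realType}.
Local Notation C := R[i].
Local Notation lower := (@lower R).
Implicit Types (f g u : C -> C).

Definition square_bounded f (B : R) : Prop :=
  forall y x1 x2, y < 0 -> rint x1 x2 (fun x => modC (f (Complex x y)) ^+ 2) <= B.

Lemma square_bounded_ge0 f B : square_bounded f B -> 0 <= B.
Proof.
move=> h; apply: le_trans (h (-1) 0 0 _); last by rewrite ltrN10.
by apply: rint_ge0 => x _; exact: sqr_ge0.
Qed.

(* Dividing by z - i makes the traces decay at infinity and leaves them comparable
   near [a]. *)
Lemma no_concentration f f' (B K a e : R) : holo f f' -> square_bounded f B -> 0 <= K ->
  (forall z, lower z -> modC (f z) <= K / - complex.Im z) -> 0 < e ->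
  exists2 d : R, 0 < d & forall y, - d < y < 0 ->
    rint (a - d) (a + d) (fun x => modC (f (Complex x y)) ^+ 2) <= e.
Proof.
move=> hf fB K0 fK e0.
pose h (z : C) := (z - iC)^-1.
have Dim (z : C) : complex.Im (z - iC) = complex.Im z - 1 by rewrite imD imN.
have D1 (z : C) : lower z -> 1 <= modC (z - iC).
  rewrite /Defs.lower /= => zl; have := Im_le_modC (z - iC); rewrite Dim ler0_norm; lra.
have D0 (z : C) : lower z -> z - iC != 0.
  by move=> zl; rewrite -modC_gt0; apply: lt_le_trans (D1 z zl).
have Dre (z : C) : `|complex.Re z| <= modC (z - iC).
  by have := Re_le_modC (z - iC); rewrite reD reN /= oppr0 addr0.
pose ft z := f z * h z.
pose ft' z := f' z * h z + f z * (- (1 - 0) / (z - iC) ^+ 2).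
have hft : holo ft ft'.
  move=> z zl; have [df cf'] := hf z zl; split.
    apply: cdiffM => //; apply: cdiffV; first exact: D0.
    by apply: cdiffB; [exact: cdiff_id|exact: cdiff_cst].
  have c1 := @cont_at_cst R lower; have ci : cont_at lower (fun w : C => w - iC) z.
    by apply: cont_atB => //; exact: cont_at_id.
  apply: cont_atD; apply: cont_atM => //.
  - by apply: cont_atV => //; exact: D0.
  - exact: (holo_cont hf).
  - apply: cont_atM => //; apply: cont_atV; last exact: cont_atM.
    by rewrite expf_neq0// D0.
have ft_mod z : modC (ft z) = modC (f z) / modC (z - iC) by rewrite /ft modCM modCV.
have ftle z : lower z -> modC (ft z) <= modC (f z).
  move=> zl; rewrite ft_mod ler_pdivrMr ?(lt_le_trans ltr01 (D1 z zl))//.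
  by rewrite ler_peMr ?modC_ge0// D1.
have ftB y N : y < 0 -> rint (- N) N (fun x => modC (ft (Complex x y)) ^+ 2) <= B.
  move=> yl; apply: le_trans (fB y (- N) N yl).
  apply: le_rint; [exact/rcont_modC_sqr/(holo_rcont hft)|exact/rcont_modC_sqr/(holo_rcont hf)|].
  by move=> x _; rewrite ler_sqr ?nnegrE ?modC_ge0// ftle.
have ftdecay x y : y < 0 -> modC (ft (Complex x y)) * `|x| <= K / - y.
  move=> yl; have zl : lower (Complex x y) by [].
  have Dp := lt_le_trans ltr01 (D1 _ zl).
  apply: le_trans (fK _ zl); rewrite ft_mod mulrAC ler_pdivrMr//.
  by rewrite ler_wpM2l ?modC_ge0// (Dre (Complex x y)).
(* Bounds [|z - i|] near [a]: [|x| <= |a| + 1], [|y| <= 1], and 1 for [i]. *)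
pose A := `|a| + 3; have A0 : 0 < A by rewrite ltr_wpDl.
have e1 : 0 < e / (4 * A ^+ 2) by rewrite divr_gt0// mulr_gt0// exprn_gt0.
have [s s0 hs] := traces_cauchy hft ftB K0 ftdecay e1.
have s1 : 0 < - s by rewrite oppr_gt0.
(* At the fixed height [s] the function is bounded, so its mass on a segment of length [2 d] is at
   most [2 Q d]. Taking [d] small handles this part; the traces nearer the line differ from it by
   little in L^2. *)
pose Q := (K / - s) ^+ 2 + 1.
have Q0 : 0 < Q by rewrite ltr_wpDl// sqr_ge0.
pose d := Num.min (Num.min 1 (- s)) (e / (8 * A ^+ 2 * Q)).
have d0 : 0 < d.
  by rewrite !lt_min ltr01 s1 divr_gt0// mulr_gt0// mulr_gt0// exprn_gt0.
have d1 : d <= 1 by rewrite !ge_min lexx.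
have ds : d <= - s by rewrite !ge_min lexx orbT.
have dQ : d <= e / (8 * A ^+ 2 * Q) by rewrite ge_min lexx orbT.
exists d => // y /andP[dy y0].
have cy := holo_rcont hft y0; have cs := holo_rcont hft s0.
pose N := `|a| + d.
have aN : - N <= a - d by have := ler_norm (- a); rewrite normrN /N; lra.
have aN' : a + d <= N by have := ler_norm a; rewrite /N; lra.
have c1 := rcont_modC_sqr (rcontD cy (rcontN cs)).
have h1 : rint (a - d) (a + d) (fun x => modC (ft (Complex x y) - ft (Complex x s)) ^+ 2) <= e / (4 * A ^+ 2).
  apply: le_trans (hs y N _); last by apply/andP; split => //; lra.
  by apply: rint_subset => // x; exact: sqr_ge0.
have h2 : rint (a - d) (a + d) (fun x => modC (ft (Complex x s)) ^+ 2) <= Q * (2 * d).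
  have -> : 2 * d = (a + d) - (a - d) by ring.
  rewrite -rint_cst; last by lra.
  apply: le_rint; [exact: rcont_modC_sqr|exact: cst_continuous|].
  move=> x _; rewrite /Q; apply: le_trans (_ : (K / - s) ^+ 2 <= _); last by rewrite lerDl.
  rewrite ler_sqr ?nnegrE ?modC_ge0 ?divr_ge0 ?(ltW s1)//.
  by apply: le_trans (ftle _ _) (fK (Complex x s) _).
have c2 : continuous (fun x => 2 * A ^+ 2 * modC (ft (Complex x y) - ft (Complex x s)) ^+ 2).
  by move=> x; apply: cvgM; [exact: cvg_cst|exact: c1].
have c3 := rcont_modC_sqr cs.
have c4 : continuous (fun x => 2 * A ^+ 2 * modC (ft (Complex x s)) ^+ 2).
  by move=> x; apply: cvgM; [exact: cvg_cst|exact: c3].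
apply: le_trans (_ : rint (a - d) (a + d) (fun x => 2 * A ^+ 2 * modC (ft (Complex x y) - ft (Complex x s)) ^+ 2 +
    2 * A ^+ 2 * modC (ft (Complex x s)) ^+ 2) <= _).
  apply: le_rint.
  - exact/rcont_modC_sqr/(holo_rcont hf).
  - by move=> x; apply: cvgD; [exact: c2|exact: c4].
  move=> x /andP[x1 x2]; have zl : lower (Complex x y) by [].
  have k1 : modC (Complex x y - iC) <= A.
    apply: le_trans (modCB _ _) _; rewrite modC_iC; apply: le_trans (lerD (modC_le _) (lexx _)) _ => /=.
    have : `|x| <= `|a| + 1.
      have := ler_norm a; have := ler_norm (- a); rewrite normrN => k2 k3.
      by rewrite ler_norml; apply/andP; split; lra.
    have : `|y| <= 1 by rewrite ler_norml; apply/andP; split; lra.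
    by rewrite /A; lra.
  have k2 : modC (f (Complex x y)) = modC (Complex x y - iC) * modC (ft (Complex x y)).
    by rewrite ft_mod mulrC mulfVK// gt_eqF// (lt_le_trans ltr01 (D1 _ zl)).
  rewrite k2 exprMn -mulrDr; set X := modC _ ^+ 2 + _.
  rewrite (_ : 2 * A ^+ 2 * X = A ^+ 2 * (2 * X)); last by ring.
  rewrite /X {X}.
  apply: ler_pM; rewrite ?sqr_ge0//; first by rewrite ler_sqr ?nnegrE ?modC_ge0 ?(ltW A0).
  have k3 := modC_triB (ft (Complex x y)) (ft (Complex x s)).
  have k4 := modC_ge0 (ft (Complex x y) - ft (Complex x s)).
  set p := modC (ft (Complex x y)) in k3 *.
  set q := modC (ft (Complex x s)) in k3 *.
  set t := modC (_ - _) in k3 k4 *.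
  have p0 : 0 <= p := modC_ge0 _.
  have q0 : 0 <= q := modC_ge0 _.
  have k5 := sqr_ge0 (t - q).
  apply: le_trans (_ : (t + q) ^+ 2 <= _); first by rewrite ler_sqr ?nnegrE//; lra.
  lra.
rewrite (rintD _ _ c2 c4) (rintZ _ _ _ c1) (rintZ _ _ _ c3).
have A2 : 0 < 2 * A ^+ 2 by rewrite mulr_gt0// exprn_gt0.
have t1 := ler_wpM2l (ltW A2) h1; have t2 := ler_wpM2l (ltW A2) h2.
have t3 : 2 * A ^+ 2 * (e / (4 * A ^+ 2)) = e / 2 by field; rewrite gt_eqF.
have t4 : 2 * A ^+ 2 * (Q * (2 * d)) <= e / 2.
  have -> : 2 * A ^+ 2 * (Q * (2 * d)) = 4 * A ^+ 2 * Q * d by ring.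
  apply: le_trans (_ : 4 * A ^+ 2 * Q * (e / (8 * A ^+ 2 * Q)) <= _).
    by rewrite ler_wpM2l// mulr_ge0 ?(ltW Q0)// mulr_ge0// sqr_ge0.
  by rewrite le_eqVlt; apply/orP; left; apply/eqP; field; rewrite !gt_eqF.
lra.
Qed.

(** A square-integrable derivative gives continuity of exponent 1/2: [rint_amgm] against the
    constant 1, with weight [sqrt r]. *)
Lemma horizontal_sqrt_bound w w' (B a r x y : R) : holo w w' -> square_bounded w' B ->
  0 < r -> y < 0 -> `|x - a| <= r ->
  modC (w (Complex x y) - w (Complex a y)) <= (B + 1) * Num.sqrt r.
Proof.
move=> hw wB r0 y0 xa; set k := Num.sqrt r.
have k0 : 0 < k by rewrite sqrtr_gt0.
have kk : k * k = r by rewrite -expr2 sqr_sqrtr// ltW.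
have cw := rcont_modC (holo_rcont_deriv hw y0).
apply: le_trans (horizontal_oscillation (h := fun x => modC (w' (Complex x y))) hw y0 cw (fun _ _ => lexx _) (fun _ => modC_ge0 _) xa) _.
have c1 : continuous (fun _ : R => 1 : R) by exact: cst_continuous.
have := rint_amgm (a - r) (a + r) k0 cw c1.
rewrite (_ : (fun x => modC (w' (Complex x y)) * 1) = (fun x => modC (w' (Complex x y)))); last first.
  by apply/funext => u; rewrite mulr1.
have ar : a - r <= a + r by lra.
rewrite (_ : (fun _ : R => 1 ^+ 2 : R) = (fun=> 1)); last by apply/funext => u; rewrite expr1n.
rewrite (rint_cst _ ar) mul1r => h.
have h1 : k * rint (a - r) (a + r) (fun x => modC (w' (Complex x y)) ^+ 2) <= k * B.
  by rewrite ler_pM2l// wB.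
have h2 : k^-1 * (a + r - (a - r)) = 2 * k by rewrite -kk; field; rewrite gt_eqF.
have B0 := square_bounded_ge0 wB.
have : 0 <= B * k by rewrite mulr_ge0// ltW.
by lra.
Qed.

Lemma tends_lower_mod u (a : R) (l : C) (e : R) : tends_lower u a l -> 0 < e ->
  exists2 d : R, 0 < d & forall z, lower z -> modC (z - toC a) < d ->
    modC l - e < modC (u z) < modC l + e.
Proof.
move=> h e0; have [d d0 dd] := h e e0; exists d => // z zl za.
have := dd z zl za; have := modC_triB (u z) l; have := modC_triB l (u z).
by rewrite (modC_sub l) => ? ? ?; apply/andP; split; lra.
Qed.

Lemma Complex_near (a x y d : R) : `|x - a| < d / 2 -> `|y| < d / 2 -> modC (Complex x y - toC a) < d.
Proof.
move=> xa yd; apply: le_lt_trans (modC_le _) _; rewrite reD reN imD imN /= subr0.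
by rewrite (splitr d) ltrD.
Qed.

(* With g = w f, g^2 has a limit since its derivative 2 f (w g') is
   equi-integrable, and the limit vanishes since |w|^2 = O(|z - a|) while |f|^2
   does not concentrate. *)
Lemma product_limit_singular f f' w w' g' (B K a : R) :
  holo f f' -> holo w w' -> holo (fun z => w z * f z) g' ->
  (forall z, lower z -> w z != 0) ->
  square_bounded f B -> square_bounded w' B -> square_bounded (fun z => w z * g' z) B ->
  0 <= K -> (forall z, lower z -> modC (f z) <= K / - complex.Im z) ->
  tends_lower w a 0 -> tends_lower (fun z => w z * f z) a 0.
Proof.
move=> hf hw hg w0 fB wB gB K0 fK wa.
have B0 := square_bounded_ge0 fB.
pose g z := w z * f z.
have hG : holo (fun z => g z * g z) (fun z => g' z * g z + g z * g' z).
  move=> z zl; have [dg cg'] := hg z zl; split; first exact: cdiffM.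
  have cg := holo_cont hg zl.
  by apply: cont_atD; apply: cont_atM.
have Gmod z : modC (g' z * g z + g z * g' z) = 2 * (modC (f z) * modC (w z * g' z)).
  rewrite (_ : g' z * g z + g z * g' z = toC 2 * (f z * (w z * g' z))).
    by rewrite modCM modC_toC ger0_norm// (modCM (f z)).
  rewrite (_ : toC 2 = 2%:R) /g; first by ring.
  by apply: complexP => /=; rewrite ?mulr2n ?reD ?imD /= ?addr0.
have [l hl] : exists l, tends_lower (fun z => g z * g z) a l.
  apply: (horizontal_limit hG) => e e0.
  (* This weight makes the term in [w g'] at most [e / 2]; non-concentration of [f] is then invoked
     at level [e / (2 k)]. *)
  pose k := 2 * (B + 1) / e; have k0 : 0 < k by rewrite divr_gt0// mulr_gt0// ltr_wpDl.
  have e1 : 0 < e / (2 * k) by rewrite divr_gt0// mulr_gt0.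
  have [d d0 dd] := @no_concentration f f' B K a _ hf fB K0 fK e1.
  exists d => // x y /andP[dy y0] xa.
  have cf := rcont_modC (holo_rcont hf y0).
  have cg := rcont_modC (rcontM (holo_rcont hw y0) (holo_rcont_deriv hg y0)).
  have ch : continuous (fun x => modC (f (Complex x y)) * modC (w (Complex x y) * g' (Complex x y))).
    by move=> u; apply: cvgM; [exact: cf|exact: cg].
  pose h x := 2 * (modC (f (Complex x y)) * modC (w (Complex x y) * g' (Complex x y))).
  have ch2 : continuous h by move=> u; apply: cvgM; [exact: cvg_cst|exact: ch].
  apply: le_trans (horizontal_oscillation (h := h) hG y0 ch2 _ _ xa) _.
  - by move=> s _; rewrite Gmod.
  - by move=> s; rewrite /h mulr_ge0// mulr_ge0// modC_ge0.
  rewrite /h (rintZ _ _ _ ch); apply: le_trans (rint_amgm _ _ k0 cf cg) _.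
  have h1 : k * rint (a - d) (a + d) (fun x => modC (f (Complex x y)) ^+ 2) <= e / 2.
    apply: le_trans (_ : k * (e / (2 * k)) <= _).
      by rewrite ler_pM2l// dd// dy.
    by rewrite le_eqVlt; apply/orP; left; apply/eqP; field; rewrite gt_eqF.
  have h2 : k^-1 * rint (a - d) (a + d) (fun x => modC (w (Complex x y) * g' (Complex x y)) ^+ 2) <= e / 2.
    apply: le_trans (_ : k^-1 * (B + 1) <= _).
      rewrite ler_pM2l ?invr_gt0//; apply: le_trans (gB y _ _ y0) _; by rewrite lerDl.
    rewrite le_eqVlt; apply/orP; left; apply/eqP; rewrite /k; field.
    by rewrite (gt_eqF e0) gt_eqF// ltr_wpDl.
  lra.
(* [|w|^2 = O(r)] at depth [r] within [r] of [a]: three units of oscillation along the vertical line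
   up to the limit 0, and one unit horizontally. *)
have wsmall r x : 0 < r -> `|x - a| <= r -> modC (w (Complex x (- r))) <= 4 * ((B + 1) * Num.sqrt r).
  move=> r0 xa; set k := (B + 1) * Num.sqrt r.
  have k0 : 0 < k by rewrite mulr_gt0 ?sqrtr_gt0// ltr_wpDl.
  have osc x' y : `|x' - a| <= r -> y < 0 -> modC (w (Complex x' y) - w (Complex a y)) <= k.
    by move=> h1 h2; exact: (horizontal_sqrt_bound hw wB r0 h2 h1).
  have h1 : modC (w (Complex a (- r))) <= 3 * k.
    apply/ler_addgt0Pl => e e0; have [d d0 dd] := wa e e0.
    pose y2 := - (Num.min r (d / 2)).
    have m1 : 0 < Num.min r (d / 2) by rewrite lt_min r0 divr_gt0.
    have m2 : Num.min r (d / 2) <= r by rewrite ge_min lexx.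
    have m3 : Num.min r (d / 2) <= d / 2 by rewrite ge_min lexx orbT.
    have y20 : y2 < 0 by rewrite /y2; lra.
    have ry2 : - r <= y2 by rewrite /y2; lra.
    have h2 : modC (w (Complex a y2) - w (Complex a (- r))) <= 3 * k.
      apply: le_trans (vertical_oscillation (k := k) hw r0 ry2 y20 _) _.
        by move=> x' y h3 /andP[_ h4]; apply: osc => //; lra.
      rewrite mulrC ler_wpM2r ?(ltW k0)//.
      have : (y2 - - r) / r <= 1 by rewrite ler_pdivrMr// /y2; lra.
      lra.
    have : modC (w (Complex a y2) - 0) < e.
      apply: dd => //; rewrite (_ : Complex a y2 - toC a = iC * toC y2); last by apply: complexP => /=; ring.
      by rewrite modCM modC_iC mul1r modC_toC ltr0_norm// /y2; lra.
    rewrite subr0 => h3; have := modC_triB (w (Complex a (- r))) (w (Complex a y2)).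
    rewrite modC_sub; lra.
  have h2 := osc x (- r) xa; have := modC_triB (w (Complex x (- r))) (w (Complex a (- r))).
  have {}h2 : modC (w (Complex x (- r)) - w (Complex a (- r))) <= k by apply: h2; lra.
  lra.
have l0 : l = 0.
  apply/eqP; rewrite -modC_eq0; apply/negPn/negP => ln0.
  have lp : 0 < modC l by rewrite lt_def ln0 modC_ge0.
  pose c := (4 * (B + 1)) ^+ 2; have c0 : 0 < c by rewrite exprn_gt0// mulr_gt0// ltr_wpDl.
  have e1 : 0 < modC l / 2 / c by rewrite !divr_gt0.
  have [d1 d10 h1] := @no_concentration f f' B K a _ hf fB K0 fK e1.
  have lp2 : 0 < modC l / 2 by rewrite divr_gt0.
  have [d2 d20 h2] := tends_lower_mod hl lp2.
  (* If [l] were nonzero, [|w f|^2 >= |l| / 2] and [|w|^2 <= c r] would give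
     [|f|^2 >= |l| / (2 c r)] on a segment of length [2 r]: mass at least [|l| / c], twice the level
     chosen for non-concentration. *)
  pose r := Num.min (d1 / 2) (d2 / 4).
  have r0 : 0 < r by rewrite lt_min !divr_gt0.
  have rd1 : r <= d1 / 2 by rewrite ge_min lexx.
  have rd2 : r <= d2 / 4 by rewrite ge_min lexx orbT.
  have y0 : - r < 0 by lra.
  have := h1 (- r); have -> : - d1 < - r < 0 by apply/andP; split; lra.
  move=> /(_ isT); apply/negP; rewrite -ltNge.
  have cf := rcont_modC_sqr (holo_rcont hf y0).
  apply: lt_le_trans (_ : rint (a - r) (a + r) (fun x => modC (f (Complex x (- r))) ^+ 2) <= _); last first.
    by apply: rint_subset => //; [move=> x; exact: sqr_ge0|lra|lra].
  apply: lt_le_trans (_ : rint (a - r) (a + r) (fun=> modC l / 2 / (c * r)) <= _).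
    rewrite rint_cst; last by lra.
    rewrite (_ : _ * (a + r - (a - r)) = 2 * (modC l / 2 / c)); last by field; rewrite !gt_eqF.
    lra.
  apply: le_rint => //; first exact: cst_continuous.
  move=> x xar; have xa : `|x - a| <= r.
    by case/andP: xar => ? ?; rewrite ler_norml; apply/andP; split; lra.
  have zl : lower (Complex x (- r)) by [].
  have := h2 _ zl (Complex_near (a := a) (d := d2) _ _); have -> : `|x - a| < d2 / 2 by lra.
  have -> : `|- r| < d2 / 2 by rewrite normrN gtr0_norm//; lra.
  move=> /(_ isT isT) /andP[h3 _].
  have h4 := wsmall r x r0 xa.
  set z := Complex x (- r) in h3 h4 zl *.
  have h5 : modC (g z * g z) = modC (w z) ^+ 2 * modC (f z) ^+ 2 by rewrite /g !modCM; ring.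
  have h6 : modC (w z) ^+ 2 <= c * r.
    rewrite (_ : c * r = (4 * ((B + 1) * Num.sqrt r)) ^+ 2); last first.
      by rewrite !exprMn sqr_sqrtr ?(ltW r0)// /c !exprMn; ring.
    rewrite ler_sqr ?nnegrE ?modC_ge0//; apply: le_trans h4; exact: modC_ge0.
  have cr0 : 0 < c * r by rewrite mulr_gt0.
  rewrite /= (ler_pdivrMr _ _ cr0) [leRHS]mulrC.
  have h7 : modC (w z) ^+ 2 * modC (f z) ^+ 2 <= c * r * modC (f z) ^+ 2.
    by rewrite ler_wpM2r ?sqr_ge0.
  apply: le_trans h7; rewrite -h5; lra.
rewrite l0 in hl => e e0; have e2 : 0 < e ^+ 2 by rewrite exprn_gt0.
have [d d0 dd] := hl _ e2; exists d => // z zl /(dd z zl); rewrite !subr0 modCM -expr2.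
by rewrite ltr_sqr ?nnegrE ?modC_ge0 ?(ltW e0).
Qed.

(** Where [|w|] stays above [c], the bound on [w g'] controls [g'] itself, and short segments have
    small oscillation by [rint_amgm] against 1. *)
Lemma product_limit_regular f w w' g' (B a : R) (l : C) :
  holo w w' -> holo (fun z => w z * f z) g' -> square_bounded (fun z => w z * g' z) B ->
  tends_lower w a l -> l != 0 -> exists m, tends_lower (fun z => w z * f z) a m.
Proof.
move=> hw hg gB wa l0; have lp : 0 < modC l by rewrite modC_gt0.
have B0 := square_bounded_ge0 gB.
pose c := modC l / 2; have c0 : 0 < c by rewrite divr_gt0.
have [d1 d10 h1] := tends_lower_mod wa c0.
apply: (horizontal_limit hg) => e e0.
(* [k] absorbs [B], then [d] absorbs [k^-1]: both terms of [rint_amgm] are at most [c e]. *)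
pose k := c * e / (B + 1); have k0 : 0 < k by rewrite divr_gt0 ?mulr_gt0// ltr_wpDl.
pose d := Num.min (d1 / 4) (c * e * k / 2).
have d0 : 0 < d.
  by rewrite lt_min divr_gt0//= divr_gt0// mulr_gt0// mulr_gt0.
have dd1 : d <= d1 / 4 by rewrite ge_min lexx.
have dk : d <= c * e * k / 2 by rewrite ge_min lexx orbT.
exists d => // x y /andP[dy y0] xa.
have cg := rcont_modC (rcontM (holo_rcont hw y0) (holo_rcont_deriv hg y0)).
pose h x := c^-1 * modC (w (Complex x y) * g' (Complex x y)).
have ch : continuous h by move=> u; apply: cvgM; [exact: cvg_cst|exact: cg].
apply: le_trans (horizontal_oscillation (h := h) hg y0 ch _ _ xa) _.
- move=> s sa; rewrite /h modCM.
  have sd : `|s - a| < d1 / 2 by lra.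
  have yd : `|y| < d1 / 2 by rewrite ltr0_norm//; lra.
  have /andP[h2 _] := h1 (Complex s y) y0 (Complex_near sd yd).
  have h3 : c <= modC (w (Complex s y)) by rewrite /c in h2 *; lra.
  by rewrite mulrA ler_peMl ?modC_ge0// mulrC ler_pdivlMr// mul1r.
- by move=> s; rewrite /h mulr_ge0 ?modC_ge0// invr_ge0 ltW.
have c1 : continuous (fun _ : R => 1 : R) by exact: cst_continuous.
have := rint_amgm (a - d) (a + d) k0 cg c1.
rewrite (_ : (fun x => modC (w (Complex x y) * g' (Complex x y)) * 1) = (fun x => modC (w (Complex x y) * g' (Complex x y)))); last first.
  by apply/funext => u; rewrite mulr1.
have ad : a - d <= a + d by lra.
rewrite (_ : (fun _ : R => 1 ^+ 2 : R) = (fun=> 1)); last by apply/funext => u; rewrite expr1n.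
rewrite /h (rintZ _ _ _ cg) (rint_cst _ ad) mul1r => h2.
set I := rint _ _ _ in h2 *.
have h3 : k * rint (a - d) (a + d) (fun x => modC (w (Complex x y) * g' (Complex x y)) ^+ 2) <= c * e.
  apply: le_trans (_ : k * (B + 1) <= _).
    by rewrite ler_pM2l//; apply: le_trans (gB y _ _ y0) _; rewrite lerDl.
  by rewrite /k mulfVK// gt_eqF// ltr_wpDl.
have h4 : k^-1 * (a + d - (a - d)) <= c * e.
  rewrite (_ : a + d - (a - d) = 2 * d); last by ring.
  rewrite mulrC ler_pdivrMr//; lra.
rewrite mulrC ler_pdivrMr// mulrC; lra.
Qed.

End BoundaryLimits.

(** * The velocity gradient *)

Section Norms.
Context {R : realType}.
Local Notation C := R[i].
Local Notation mu := (@lebesgue_measure R).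

Lemma lpnorm_ge0 (p : \bar R) (h : R -> C) : (0 <= lpnorm p h)%E.
Proof. exact: Lnorm_ge0. Qed.

Lemma rint_le_lpnorm2 (h : R -> C) (a b : R) : rcont h ->
  ((rint a b (fun x => modC (h x) ^+ 2))%:E <= lpnorm 2%:E h ^+ 2)%E.
Proof.
move=> ch; have c2 := rcont_modC_sqr ch.
have -> : (lpnorm 2%:E h ^+ 2)%E = (\int[mu]_x (modC (h x) ^+ 2)%:E)%E.
  have := @poweR_Lnorm _ _ R mu (fun x => (modC (h x))%:E) 2 _.
  rewrite pnatr_eq0 => /(_ isT) E.
  transitivity (lpnorm 2%:E h `^ 2)%E.
    have := lpnorm_ge0 2%:E h; case: (lpnorm _ _) => [r r0| |//].
      by rewrite poweR_EFin powR_mulrn.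
    by rewrite poweRyr ?pnatr_eq0.
  rewrite /lpnorm E; apply: eq_integral => x _ /=.
  by rewrite ger0_norm ?modC_ge0// powR_mulrn ?modC_ge0.
rewrite /rint /Rintegral fineK; last first.
  by apply: integrable_fin_num => //; exact: rint_integrable.
apply: ge0_subset_integral => //.
- have m : measurable_fun [set: measurableTypeR R] (fun x : R => modC (h x) ^+ 2).
    exact: continuous_measurable_fun.
  exact: (measurableT_comp (@EFin_measurable R setT) m).
- by move=> x _; rewrite lee_fin sqr_ge0.
Qed.

Lemma sup_norm2_square_bounded (f : C * R -> C) (t : R) :
  (sup_norm2 (lpnorm 2%:E) f t < +oo)%E ->
  (forall y, y < 0 -> rcont (fun x => f (Complex x y, t))) ->
  exists B, square_bounded (fun z => f (z, t)) B.
Proof.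
move=> fin cf; exists (fine (sup_norm2 (lpnorm 2%:E) f t)) => y x1 x2 y0.
have h : ((rint x1 x2 (fun x => modC (f (Complex x y, t)) ^+ 2))%:E <= sup_norm2 (lpnorm 2%:E) f t)%E.
  apply: le_trans (rint_le_lpnorm2 x1 x2 (cf y y0)) _.
  by apply: ereal_sup_ubound; exists y.
have fn : sup_norm2 (lpnorm 2%:E) f t \is a fin_num.
  by rewrite fin_numElt fin andbT (lt_le_trans (ltNyr _) h).
by rewrite -lee_fin (fineK fn).
Qed.

Lemma sup_norm2_ge0 (N : (R -> C) -> \bar R) (f : C * R -> C) (t : R) :
  (forall h, 0 <= N h)%E -> (0 <= sup_norm2 N f t)%E.
Proof.
move=> N0; apply: (@le_trans _ _ (N (horizontal f (-1) t) ^+ 2)%E); first by rewrite expe_ge0.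
by apply: ereal_sup_ubound; exists (-1) => //=; rewrite ltrN10.
Qed.

Lemma hhalf_ge0 (f : R -> C) : (0 <= hhalf f)%E.
Proof. by apply: le_ereal_inf_tmp => _ [g _ <-]; exact: lpnorm_ge0. Qed.

Lemma adde_lty (x y : \bar R) : (0 <= x -> 0 <= y -> x + y < +oo -> x < +oo /\ y < +oo)%E.
Proof.
move=> x0 y0 xy; split; apply: le_lt_trans xy; [exact: leeDl|exact: leeDr].
Qed.

(** A finite sum of nonnegative extended reals has finite terms; the terms with [hhalf] are
    nonnegative as infima, even over an empty set. *)
Lemma energy1_terms (F Psi : C * R -> C) (t : R) : (energy1 F Psi t < +oo)%E ->
  [/\ (sup_norm2 (lpnorm 2%:E) (dz F) t < +oo)%E,
      (sup_norm2 (lpnorm 2%:E) (wdz Psi (wdz Psi F)) t < +oo)%E &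
      (sup_norm2 (lpnorm 2%:E) (dz (recip_dz Psi)) t < +oo)%E].
Proof.
rewrite /energy1 => h.
have l2 f : (0 <= sup_norm2 (lpnorm 2%:E) f t)%E by apply: sup_norm2_ge0 => ?; exact: lpnorm_ge0.
have loo f : (0 <= sup_norm2 (lpnorm +oo) f t)%E by apply: sup_norm2_ge0 => ?; exact: lpnorm_ge0.
have lh f : (0 <= sup_norm2 hhalf f t)%E by apply: sup_norm2_ge0 => ?; exact: hhalf_ge0.
have [{}h _] := adde_lty (adde_ge0 (adde_ge0 (adde_ge0 (adde_ge0 (adde_ge0 (l2 _) (lh _)) (l2 _)) (lh _)) (loo _)) (l2 _)) (l2 _) h.
have [{}h h6] := adde_lty (adde_ge0 (adde_ge0 (adde_ge0 (adde_ge0 (l2 _) (lh _)) (l2 _)) (lh _)) (loo _)) (l2 _) h.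
have [{}h _] := adde_lty (adde_ge0 (adde_ge0 (adde_ge0 (l2 _) (lh _)) (l2 _)) (lh _)) (loo _) h.
have [{}h _] := adde_lty (adde_ge0 (adde_ge0 (l2 _) (lh _)) (l2 _)) (lh _) h.
have [{}h h3] := adde_lty (adde_ge0 (l2 _) (lh _)) (l2 _) h.
by have [h1 _] := adde_lty (l2 _) (lh _) h.
Qed.

(** An essential bound on a continuous function is a pointwise one, since exceeding it at one point
    means exceeding it on an interval of positive length. *)
Lemma line_norm_infty (f : R * R -> C) (t K : R) : (line_norm +oo f t <= K%:E)%E ->
  rcont (fun a => f (a, t)) -> forall a, modC (f (a, t)) <= K.
Proof.
move=> h cf a; rewrite leNgt; apply/negP => aK.
have muT : (0 < mu [set: R])%E.
  apply: (@lt_le_trans _ _ (mu `[0, 1]%classic)).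
    by rewrite lebesgue_measure_itv /= lte_fin ltr01 oppr0 adde0 lte_fin.
  by apply: le_measure; rewrite ?inE.
move: h; rewrite /line_norm /lpnorm unlock muT => /ess_supP => -[N [mN N0 sub]].
have e0 : 0 < modC (f (a, t)) - K by rewrite subr_gt0.
have [d d0 dd] := cf a _ e0.
pose I : set R := `]a - d, a + d[%classic.
have : (mu I <= mu N)%E.
  apply: le_measure; rewrite ?inE//; first exact: measurable_itv.
  move=> x; rewrite /I /= in_itv /= => /andP[x1 x2]; apply: sub => /=; apply/negP.
  rewrite lee_fin ger0_norm ?modC_ge0// -ltNge.
  have xa : `|x - a| < d by rewrite ltr_norml; apply/andP; split; lra.
  have := dd x xa; have := modC_triB (f (a, t)) (f (x, t)); rewrite modC_sub; lra.
rewrite N0 /I lebesgue_measure_itv /= lte_fin ifT; last by lra.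
rewrite -EFinB lee_fin; lra.
Qed.

End Norms.

Section SlabFunctions.
Context {R : realType}.
Local Notation C := R[i].
Local Notation lower := (@lower R).
Implicit Types (f F Psi : C * R -> C) (T t : R).

Lemma ext_lim (X : topologicalType) (D : set X) (f : X -> C) (p : X) (l : C) :
  ProperFilter (within D (nbhs p)) -> f q @[q --> within D (nbhs p)] --> l -> ext D f p = l.
Proof. by move=> PF h; apply: cvg_lim => //; exact: norm_hausdorff. Qed.

Lemma proper_slab T (z : C) (t : R) : lowerbar z -> time T t -> ProperFilter (within (slab T) (nbhs (z, t))).
Proof.
move=> zl tT; apply: Build_ProperFilter_ex => P; rewrite /within /= => /nbhs_plane_time[d d0 dP] /=.
exists (z - iC * toC (d / 2), t); apply: dP => /=.
- rewrite addrAC subrr add0r modCN modCM modC_iC mul1r modC_toC gtr0_norm ?divr_gt0//.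
  by rewrite ltr_pdivrMr// ltr_pMr// ltr1n.
- by rewrite subrr normr0.
split => //=; rewrite /Defs.lower /= imD imN imM /=.
have : complex.Im z <= 0 by []. lra.
Qed.

(** [ext] is a joint limit in space and time; it is identified with the continuous extension through
    nearby points of the slab at nearby times. *)
Lemma extends_limit T f (z : C) (t : R) : lowerbar z -> time T t ->
  extends (slab T) (slabbar T) f ->
  forall e : R, 0 < e -> exists2 d : R, 0 < d & forall w s, slab T (w, s) ->
    modC (w - z) < d -> `|s - t| < d -> modC (f (w, s) - ext (slab T) f (z, t)) < e.
Proof.
move=> zl tT [g /within_slab_continuousP cg gf].
have gE w s : slab T (w, s) -> g (w, s) = f (w, s) by move=> h; apply: gf; rewrite inE.
have sb w s : slab T (w, s) -> slabbar T (w, s).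
  by move=> [wl sT]; split => //; exact: ltW.
have bt : slabbar T (z, t) by [].
suff -> : ext (slab T) f (z, t) = g (z, t).
  move=> e e0; have [d d0 dd] := cg z t bt e e0; exists d => // w s ws wz st.
  by rewrite -gE//; apply: dd => //; exact: sb.
apply: (ext_lim (proper_slab zl tT)); apply/cvg_modC => e e0.
have [d d0 dd] := cg z t bt e e0; apply/nbhs_plane_time; exists d => // w s wz st ws.
by rewrite /= -gE//; apply: dd => //; exact: sb.
Qed.

Lemma extends_tends_lower T f t a : time T t -> extends (slab T) (slabbar T) f ->
  tends_lower (fun z => f (z, t)) a (ext (slab T) f (bdry (a, t))).
Proof.
move=> tT xf e e0; have al : lowerbar (toC a : C) by rewrite /lowerbar /=.
have [d d0 dd] := extends_limit al tT xf e0; exists d => // z zl za.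
by apply: dd => //; rewrite subrr normr0.
Qed.

Lemma holomorphic_cdiff f t z : holomorphic (fun z => f (z, t)) -> lower z ->
  cdiff (fun w => f (w, t)) z (dz f (z, t)) /\ derive1 (fun w => f (w, t)) z = dz f (z, t).
Proof.
move=> hf zl; have h := derivable_cdiff (hf z zl).
by have [_ _ E] := cdiff_dz h; rewrite E.
Qed.

Lemma cont_at_slice T (D : set C) f t z : time T t -> D z ->
  (forall w s, (D `*` time T) (w, s) -> forall e : R, 0 < e ->
    exists2 d : R, 0 < d & forall w' s', (D `*` time T) (w', s') -> modC (w' - w) < d -> `|s' - s| < d ->
      modC (f (w', s') - f (w, s)) < e) ->
  cont_at D (fun z => f (z, t)) z.
Proof.
move=> tT Dz h e e0; have [d d0 dd] := h z t (conj Dz tT) e e0; exists d => // w Dw wz.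
by apply: dd => //; rewrite subrr normr0.
Qed.

(** By Cauchy-Riemann [dz] is the horizontal derivative, so its continuity is one clause of
    [C1_slab]. *)
Lemma C1_slab_holo T f t : time T t -> holomorphic (fun z => f (z, t)) -> C1_slab T f ->
  holo (fun z => f (z, t)) (fun z => dz f (z, t)).
Proof.
move=> tT hf cf z zl; have [df _] := holomorphic_cdiff hf zl; split => //.
have [_ /within_slab_continuousP cx] := cf dirx.
have := cont_at_slice tT zl cx => h e e0; have [d d0 dd] := h e e0; exists d => // w wl wz.
have E u : lower u -> dz f (u, t) = partial T dirx f (u, t).
  by move=> ul; have [du _] := holomorphic_cdiff hf ul; have [<- _ _] := cdiff_dz du.
by rewrite !E//; exact: dd.
Qed.

Lemma holoV (f f' : C -> C) : holo f f' -> (forall z, lower z -> f z != 0) ->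
  holo (fun z => (f z)^-1) (fun z => - f' z / f z ^+ 2).
Proof.
move=> hf f0 z zl; have [df cf'] := hf z zl; have cf := holo_cont hf zl.
split; first by apply: cdiffV => //; exact: f0.
apply: cont_atM; first exact: cont_atN.
by apply: cont_atV; [rewrite expf_neq0// f0|exact: cont_atM].
Qed.

Lemma holoM (f f' g g' : C -> C) : holo f f' -> holo g g' ->
  holo (fun z => f z * g z) (fun z => f' z * g z + f z * g' z).
Proof.
move=> hf hg z zl; have [df cf'] := hf z zl; have [dg cg'] := hg z zl.
have cf := holo_cont hf zl; have cg := holo_cont hg zl.
by split; [exact: cdiffM|apply: cont_atD; exact: cont_atM].
Qed.

Lemma square_bounded_le (f g : C -> C) (B B' : R) : B <= B' ->
  (forall z, lower z -> f z = g z) -> square_bounded f B -> square_bounded g B'.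
Proof.
move=> BB' fg h y x1 x2 y0; apply: le_trans BB'; apply: le_trans (h y x1 x2 y0).
by rewrite le_eqVlt; apply/orP; left; apply/eqP; congr rint; apply/funext => x; rewrite fg.
Qed.

Lemma conformal_dz_neq0 Psi t z : conformal (fun z => Psi (z, t)) -> lower z -> dz Psi (z, t) != 0.
Proof.
move=> [hP _ nz] zl; have [_ <-] := holomorphic_cdiff hP zl; exact: nz.
Qed.

(** Cauchy's estimate on the disc of radius half the depth; it supplies the growth bound that
    [no_concentration] asks for. *)
Lemma bounded_cauchy (f f' : C -> C) (M : R) : holo f f' -> (forall z, lower z -> modC (f z) <= M) ->
  forall z, lower z -> modC (f' z) <= 2 * M / - complex.Im z.
Proof.
move=> hf fM z zl; have y0 : 0 < - complex.Im z by rewrite oppr_gt0.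
have r0 : 0 < - complex.Im z / 2 by rewrite divr_gt0.
have zr : complex.Im z + - complex.Im z / 2 < 0 by lra.
have zr' : complex.Im z < 0 by [].
have := cauchy_estimate hf r0 zr (M := M); rewrite (_ : M / (- complex.Im z / 2) = 2 * M / - complex.Im z).
  by apply => w wz; apply: fM; apply: (lower_ball zr); rewrite wz.
by field; rewrite lt_eqF.
Qed.

(** The first, third and sixth terms of the energy are the square bounds on [f = F_z'], [w g'] and
    [w'], where [w = 1 / Psi_z'] and [g = w f], and boundedness of [F] gives the growth of [f]. The
    two product lemmas cover [w] vanishing or not at [a]. *)
Lemma velocity_gradient_limit T F Psi (P : C * R -> R) t a : 0 < T -> time T t ->
  water_wave T F Psi P -> wu_regularity T F Psi P ->
  exists2 l, tends_lower (fun z => dz F (z, t) / dz Psi (z, t)) a l &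
    (singular T Psi (a, t) -> l = 0).
Proof.
move=> T0 tT ww wr.
have hF := C1_slab_holo tT (ww_holomorphic ww tT) (wr_F wr).
have cP := ww_conformal ww tT.
have hPsi : holo (fun z => Psi (z, t)) (fun z => dz Psi (z, t)).
  by case: cP => hol _ _; exact: C1_slab_holo tT hol (wr_Psi wr).
have [f' hf] := holo_deriv hF; have [p' hp] := holo_deriv hPsi.
have p0 z : lower z -> dz Psi (z, t) != 0 by exact: conformal_dz_neq0.
pose w z := (dz Psi (z, t))^-1.
have hw := holoV hp p0; rewrite -/w in hw.
set w' := (fun z => - p' z / _) in hw.
pose f z := dz F (z, t); rewrite -/f in hf.
have hg := holoM hw hf.
set g' := (fun z => _ + _) in hg.
have [M FM] := wr_F_bounded wr.
have FM' z : lower z -> modC (F (z, t)) <= M by move=> zl; apply: FM; split => //; exact: ltW.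
have M0 : 0 <= M.
  by apply: le_trans (FM' (- iC) _); [exact: modC_ge0|rewrite /Defs.lower /= oppr_lt0].
have E1 z : lower z -> dz (recip_dz Psi) (z, t) = w' z.
  by move=> zl; have [d _] := hw z zl; have [_ _ ->] := cdiff_dz (F := recip_dz Psi) d.
have E2 z : lower z -> wdz Psi (wdz Psi F) (z, t) = w z * g' z.
  move=> zl; have [d _] := hg z zl.
  by rewrite {1}/wdz; have [_ _ ->] := cdiff_dz (F := wdz Psi F) d.
have [fin _] := wr_finite wr tT.
have [fin1 fin2 fin3] := energy1_terms fin.
have [B1 h1] : exists B, square_bounded f B.
  by apply: (sup_norm2_square_bounded fin1) => y y0; exact: (holo_rcont hf y0).
have [B2 h2] : exists B, square_bounded (fun z => w z * g' z) B.
  have [|B hB] := sup_norm2_square_bounded fin2.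
    move=> y y0; rewrite (_ : (fun x => _) = (fun x => w (Complex x y) * g' (Complex x y))).
      by apply: rcontM; [exact: (holo_rcont hw y0)|exact: (holo_rcont_deriv hg y0)].
    by apply/funext => x; rewrite E2.
  by exists B; apply: square_bounded_le hB.
have [B3 h3] : exists B, square_bounded w' B.
  have [|B hB] := sup_norm2_square_bounded fin3.
    move=> y y0; rewrite (_ : (fun x => _) = (fun x => w' (Complex x y))).
      exact: (holo_rcont_deriv hw y0).
    by apply/funext => x; rewrite E1.
  by exists B; apply: square_bounded_le hB.
pose B := Num.max B1 (Num.max B2 B3).
have {}h1 : square_bounded f B by apply: square_bounded_le h1 => //; rewrite le_max lexx.
have {}h2 : square_bounded (fun z => w z * g' z) B.
  by apply: square_bounded_le h2 => //; rewrite !le_max lexx orbT.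
have {}h3 : square_bounded w' B.
  by apply: square_bounded_le h3 => //; rewrite !le_max lexx !orbT.
have wa : tends_lower w a (ext (slab T) (recip_dz Psi) (bdry (a, t))).
  exact: (extends_tends_lower (f := recip_dz Psi) a tT (wr_recip wr)).
have gE : (fun z => dz F (z, t) / dz Psi (z, t)) = (fun z => w z * f z).
  by apply/funext => z; rewrite mulrC.
rewrite gE; have [s0|s0] := eqVneq (ext (slab T) (recip_dz Psi) (bdry (a, t))) 0.
  exists 0 => //; rewrite s0 in wa.
  apply: (product_limit_singular hf hw hg _ h1 h3 h2 (K := 2 * M)) => //.
  - by move=> z zl; rewrite invr_neq0// p0.
  - by rewrite mulr_ge0.
  - exact: bounded_cauchy hF FM'.
have [l hl] := product_limit_regular hw hg h2 wa s0.
by exists l => //; rewrite /singular => h; rewrite h eqxx in s0.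
Qed.

End SlabFunctions.

(** * Smooth approximations and the pressure gradient *)

Section SmoothTraces.
Context {R : realType}.
Local Notation C := R[i].
Local Notation lower := (@lower R).
Local Notation lowerbar := (@lowerbar R).
Implicit Types (T t : R).

Lemma ucvg_eps (X : topologicalType) (U : set X) (f_ : nat -> X -> C) (f : X -> C) (K : set X) :
  ucvg U f_ f -> compact K -> K `<=` U -> forall e : R, 0 < e ->
  exists N, forall n, (N <= n)%N -> forall x, K x -> modC (f_ n x - f x) < e.
Proof.
move=> h cK KU e e0.
have := h K cK KU (fun g => forall x, K x -> modC (g x - f x) < e); case.
  apply/uniform_nbhs; exists [set p : C * C | modC (p.2 - p.1) < e]; split; last by move=> g hg x Kx; exact: hg.
  rewrite -entourage_ballE; exists (toC e) => /=; first by rewrite ltcE /= eqxx.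
  move=> [x y]; rewrite /= -ball_normE /= normr_modC ltcE /= eqxx /= => xy.
  by rewrite modC_sub.
by move=> N _ hN; exists N => n Nn; exact: (hN n Nn).
Qed.

Lemma ucvg_point (X : topologicalType) (U : set X) (f_ : nat -> X -> C) (f : X -> C) (p : X) :
  ucvg U f_ f -> U p -> forall e : R, 0 < e ->
  exists N, forall n, (N <= n)%N -> modC (f_ n p - f p) < e.
Proof.
move=> h Up e e0; have [|N hN] := ucvg_eps h (@compact_set1 X p) _ e0.
  by move=> _ ->.
by exists N => n Nn; exact: (hN n Nn p erefl).
Qed.

(** Schwarz's theorem by the second difference over a small rectangle, estimated once through [A]
    and once through [B]. The rectangle lies on the side of [t0] towards [t1], so an end point of
    the time interval is allowed. *)
Lemma mixed_partials (I : set R) (phi phis phit A B : R -> R -> C) (s0 t0 t1 r : R) :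
  0 < r -> t0 != t1 ->
  (forall t, t0 <= t <= t1 \/ t1 <= t <= t0 -> I t) ->
  (forall s t, `|s - s0| < r -> I t ->
    [/\ is_rderiv setT (phi^~ t) s (phis s t), is_rderiv I (phi s) t (phit s t),
        is_rderiv setT (phit^~ t) s (A s t) & is_rderiv I (phis s) t (B s t)]) ->
  (forall e : R, 0 < e -> exists2 d : R, 0 < d & forall s t, `|s - s0| < d -> `|t - t0| < d -> I t ->
     modC (A s t - A s0 t0) < e /\ modC (B s t - B s0 t0) < e) ->
  A s0 t0 = B s0 t0.
Proof.
move=> r0 t01 tI H cAB; apply/eqP; rewrite -subr_eq0 -modC_eq0; apply/eqP/le_anti.
rewrite modC_ge0 andbT; apply/ler_addgt0Pl => e e0; rewrite addr0.
have e20 : 0 < e / 2 by rewrite divr_gt0.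
have [d d0 dd] := cAB _ e20.
pose h := Num.min (d / 2) (r / 2).
have h0 : 0 < h by rewrite lt_min !divr_gt0.
have hd : h <= d / 2 by rewrite ge_min lexx.
have hr : h <= r / 2 by rewrite ge_min lexx orbT.
have [lo [hi [lohi Ilh nlh]]] : exists lo hi, [/\ lo < hi, forall t, lo <= t <= hi -> I t &
     forall t, lo <= t <= hi -> `|t - t0| < d].
  pose k := Num.min (d / 2) (`|t1 - t0|).
  have k0 : 0 < k by rewrite lt_min divr_gt0//= normr_gt0 subr_eq0 eq_sym.
  have kd : k <= d / 2 by rewrite ge_min lexx.
  have kt : k <= `|t1 - t0| by rewrite ge_min lexx orbT.
  have [tt|tt] := lerP t0 t1.
    exists t0, (t0 + k); rewrite ger0_norm ?subr_ge0// in kt; split; first by lra.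
      by move=> t /andP[? ?]; apply: tI; left; apply/andP; split; lra.
    by move=> t /andP[? ?]; rewrite ltr_norml; apply/andP; split; lra.
  exists (t0 - k), t0; rewrite ltr0_norm ?subr_lt0// in kt; split; first by lra.
    by move=> t /andP[? ?]; apply: tI; right; apply/andP; split; lra.
  by move=> t /andP[? ?]; rewrite ltr_norml; apply/andP; split; lra.
have near s : s0 <= s <= s0 + h -> `|s - s0| < r /\ `|s - s0| < d.
  by move=> /andP[? ?]; rewrite ger0_norm ?subr_ge0//; split; lra.
have s00 : s0 <= s0 <= s0 + h by apply/andP; split; lra.
have s0h : s0 <= s0 + h <= s0 + h by apply/andP; split; lra.
have ilo : lo <= lo <= hi by rewrite lexx ltW.
have ihi : lo <= hi <= hi by rewrite lexx ltW.
have lh : lo <= hi by exact: ltW.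
have sh : s0 <= s0 + h by lra.
have is_rderivB (J : set R) (f g : R -> C) (x : R) (l m : C) :
    is_rderiv J f x l -> is_rderiv J g x m -> is_rderiv J (fun y => f y - g y) x (l - m).
  move=> hf hg; have := is_rderivD hf (is_rderivM (@is_rderiv_cst R J (-1) x) hg).
  rewrite mul0r add0r mulN1r; apply: is_rderiv_eq => y; by rewrite mulN1r.
have k1 : modC ((phi (s0 + h) hi - phi s0 hi) - (phi (s0 + h) lo - phi s0 lo) -
    (A s0 t0 * toC h) * toC (hi - lo)) <= (e / 2 * h) * (hi - lo).
  apply: (@mean_value_inequality R I (fun t => phi (s0 + h) t - phi s0 t)) => // t tlh.
  have It := Ilh t tlh.
  exists (phit (s0 + h) t - phit s0 t).
    have [_ d1 _ _] := H _ _ (near _ s0h).1 It; have [_ d2 _ _] := H _ _ (near _ s00).1 It.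
    exact: is_rderivB.
  have := @mean_value_inequality R setT (phit^~ t) (A s0 t0) (e / 2) s0 (s0 + h) sh (fun _ _ => Logic.I).
  rewrite (_ : s0 + h - s0 = h); last by ring.
  apply => s ss.
  have [n1 n2] := near s ss; have [_ _ d3 _] := H _ _ n1 It; exists (A s t) => //.
  by have [/ltW] := dd s t n2 (nlh t tlh) It.
have k2 : modC ((phi (s0 + h) hi - phi (s0 + h) lo) - (phi s0 hi - phi s0 lo) -
    (B s0 t0 * toC (hi - lo)) * toC (s0 + h - s0)) <= (e / 2 * (hi - lo)) * (s0 + h - s0).
  apply: (@mean_value_inequality R setT (fun s => phi s hi - phi s lo)) => // s ss.
  have [n1 n2] := near s ss.
  exists (phis s hi - phis s lo).
    have [d1 _ _ _] := H _ _ n1 (Ilh _ ihi); have [d2 _ _ _] := H _ _ n1 (Ilh _ ilo).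
    exact: is_rderivB.
  apply: (@mean_value_inequality R I (phis s) (B s0 t0) (e / 2) lo hi lh Ilh) => t tlh.
  have It := Ilh t tlh; have [_ _ _ d4] := H _ _ n1 It; exists (B s t) => //.
  by have [_ /ltW] := dd s t n2 (nlh t tlh) It.
have hs : s0 + h - s0 = h by ring.
rewrite hs in k2.
have hl0 : 0 < h * (hi - lo) by rewrite mulr_gt0// subr_gt0.
rewrite -(ler_pM2r hl0) -{1}(gtr0_norm hl0) -modC_toC -modCM.
rewrite (_ : (A s0 t0 - B s0 t0) * toC (h * (hi - lo)) =
  ((phi (s0 + h) hi - phi (s0 + h) lo) - (phi s0 hi - phi s0 lo) - (B s0 t0 * toC (hi - lo)) * toC h) -
  ((phi (s0 + h) hi - phi s0 hi) - (phi (s0 + h) lo - phi s0 lo) - (A s0 t0 * toC h) * toC (hi - lo))); last first.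
  by rewrite toCM; ring.
apply: le_trans (modCB _ _) _; apply: le_trans (lerD k2 k1) _.
by rewrite le_eqVlt; apply/orP; left; apply/eqP; field.
Qed.

Lemma time_other T t : 0 < T -> time T t -> exists2 t1, t != t1 &
  forall s, t <= s <= t1 \/ t1 <= s <= t -> time T s.
Proof.
move=> T0 /andP[t0 tT]; have [tT2|tT2] := lerP t (T / 2).
  exists T; first by apply/eqP => h; lra.
  by move=> s [/andP[? ?]|/andP[? ?]]; apply/andP; split; lra.
exists 0; first by apply/eqP => h; lra.
by move=> s [/andP[? ?]|/andP[? ?]]; apply/andP; split; lra.
Qed.

(* The time derivative is holomorphic because mixed partials commute. *)
Lemma smooth_slab_trace T (f : C * R -> C) : 0 < T -> smooth_slab T f ->
  (forall t, time T t -> holomorphic (fun z => f (z, t))) ->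
  exists Dx Dt : C * R -> C,
    [/\ {within slabbar T, continuous f} /\ {within slabbar T, continuous Dx} /\ {within slabbar T, continuous Dt},
        forall z t, slab T (z, t) -> Dx (z, t) = dz f (z, t) /\ Dt (z, t) = dt T f (z, t),
        forall a t, time T t -> is_rderiv setT (fun a : R => f (toC a, t)) a (Dx (toC a, t)) &
        forall t, time T t -> exists Dt', holo (fun z => Dt (z, t)) Dt'].
Proof.
move=> T0 [G [Gf Gc Gd]] hol.
have fE p : slabbar T p -> G [::] p = f p by move=> h; apply: Gf; rewrite inE.
have sb w s : slab T (w, s) -> slabbar T (w, s).
  by move=> [wl sT]; split => //; exact: ltW.
have lower_ball' (z w : C) : lower z -> modC (w - z) < - complex.Im z -> lower w.
  rewrite /Defs.lower /= => zl wz; have := le_lt_trans (Im_le_modC _) wz.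
  by rewrite imD imN => /(le_lt_trans (ler_norm _)); lra.
(* [G [::]] agrees with [f] on the closed slab only, so derivatives are transferred for increments
   shorter than the depth of the point. *)
have Gp d p : slab T p -> is_partial T d f p (G [:: d] p).
  case: p => z t [zl tT]; have := Gd d [::] (z, t) (conj zl tT).
  rewrite /is_partial => /is_rderivP h; apply/is_rderivP => e e0.
  have [r r0 rr] := h e e0; have zl0 : 0 < - complex.Im z by rewrite oppr_gt0.
  exists (Num.min r (- complex.Im z)); first by rewrite lt_min r0.
  move=> y Iy; rewrite lt_min => /andP[yr yz].
  have E s : domain T d s -> `|s - coordinate d (z, t)| < - complex.Im z ->
      slice d (G [::]) (z, t) s = slice d f (z, t) s.
    move=> ds sz; case: d ds sz {h rr Iy yr yz} => /= ds sz; apply: fE; apply: sb; split => //=.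
    apply: (lower_ball' z) => //; apply: le_lt_trans sz; apply: le_trans (modC_le _) _.
    by rewrite reD reN imD imN /= (subrr (complex.Re z)) normr0 add0r.
  have E0 : slice d (G [::]) (z, t) (coordinate d (z, t)) = slice d f (z, t) (coordinate d (z, t)).
    by apply: E; [case: (d)|rewrite subrr normr0].
  by rewrite -(E y)// -E0; exact: rr.
have CR z t : slab T (z, t) -> G [:: dirx] (z, t) = dz f (z, t) /\ G [:: diry] (z, t) = iC * dz f (z, t).
  move=> [zl tT]; have [df _] := holomorphic_cdiff (hol t tT) zl.
  have [hx hy _] := cdiff_dz df; split.
    rewrite -[RHS]hx; apply/esym; exact: (is_rderiv_val (proper_setT _) (Gp dirx (z, t) (conj zl tT))).
  rewrite -[RHS]hy; apply/esym; exact: (is_rderiv_val (proper_setT _) (Gp diry (z, t) (conj zl tT))).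
exists (G [:: dirx]), (G [:: dirt]); split.
- split; last by split; exact: Gc.
  apply/within_slab_continuousP => z t zt e e0.
  have /within_slab_continuousP/(_ z t zt e e0)[d d0 dd] := Gc [::].
  by exists d => // w s ws; rewrite -!fE//; exact: dd.
- move=> z t zt; split; first by have [] := CR z t zt.
  by apply/esym; apply: (is_rderiv_val (proper_time T0 zt.2) (Gp dirt (z, t) zt)).
(* For the derivative along the real line, the mean value inequality is applied on the segment
   lowered by [s], where the partial derivatives exist. A small [s] makes each vertical error less
   than [e1 / 2], with [e1] arbitrary. *)
- move=> a t tT; apply/is_rderivP => e e0.
  have al x : lowerbar (toC x : C) by rewrite /Defs.lowerbar /=.
  have /within_slab_continuousP/(_ (toC a) t (conj (al a) tT) e e0)[d d0 dd] := Gc [:: dirx].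
  exists (d / 2); first by rewrite divr_gt0.
  move=> y _ ya.
  apply/ler_addgt0Pl => e1 e10.
  have e20 : 0 < e1 / 2 by rewrite divr_gt0.
  have /within_slab_continuousP c0 := Gc [::].
  have [d1 d10 dd1] := c0 (toC a) t (conj (al a) tT) _ e20.
  have [d2 d20 dd2] := c0 (toC y) t (conj (al y) tT) _ e20.
  pose s := Num.min (d / 2) (Num.min (d1 / 2) (d2 / 2)).
  have s0 : 0 < s by rewrite !lt_min !divr_gt0.
  have sd : s <= d / 2 by rewrite ge_min lexx.
  have sd1 : s <= d1 / 2 by rewrite !ge_min lexx orbT.
  have sd2 : s <= d2 / 2 by rewrite !ge_min lexx !orbT.
  have low x : lower (Complex x (- s)) by rewrite /Defs.lower /= oppr_lt0.
  have vd x : modC (Complex x (- s) - toC x) = s.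
    rewrite (_ : _ - _ = iC * toC (- s)); last by apply: complexP => /=; ring.
    by rewrite modCM modC_iC mul1r modC_toC normrN gtr0_norm.
  have k1 : modC (f (Complex a (- s), t) - f (toC a, t)) < e1 / 2.
    rewrite -!fE; [|exact: (conj (al a) tT)|exact: (sb _ _ (conj (low a) tT))].
    apply: dd1; first exact: (sb _ _ (conj (low a) tT)).
      by rewrite vd; lra.
    by rewrite subrr normr0.
  have k2 : modC (f (Complex y (- s), t) - f (toC y, t)) < e1 / 2.
    rewrite -!fE; [|exact: (conj (al y) tT)|exact: (sb _ _ (conj (low y) tT))].
    apply: dd2; first exact: (sb _ _ (conj (low y) tT)).
      by rewrite vd; lra.
    by rewrite subrr normr0.
  have mv x : `|x - a| < d / 2 -> is_rderiv setT (fun x => f (Complex x (- s), t)) x (G [:: dirx] (Complex x (- s), t)) /\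
      modC (G [:: dirx] (Complex x (- s), t) - G [:: dirx] (toC a, t)) <= e.
    move=> xa; split; first exact: (Gp dirx (Complex x (- s), t) (conj (low x) tT)).
    apply/ltW; apply: dd; first exact: (sb _ _ (conj (low x) tT)).
      apply: le_lt_trans (modC_le _) _; rewrite reD reN imD imN /= subr0 normrN (gtr0_norm s0); lra.
    by rewrite subrr normr0.
  have k3 : modC (f (Complex y (- s), t) - f (Complex a (- s), t) - G [:: dirx] (toC a, t) * toC (y - a)) <= e * `|y - a|.
    have [ay|yla] := lerP a y.
      rewrite ger0_norm ?subr_ge0// in ya.
      apply: (@mean_value_inequality R setT (fun x => f (Complex x (- s), t))) => // x /andP[x1 x2].
      by have [] := mv x; [rewrite ger0_norm ?subr_ge0//; lra|move=> ? ?; exists (G [:: dirx] (Complex x (- s), t))].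
    rewrite ltr0_norm ?subr_lt0// in ya.
    have := @mean_value_inequality R setT (fun x => f (Complex x (- s), t)) (G [:: dirx] (toC a, t)) e y a (ltW yla) (fun _ _ => Logic.I).
    have /[swap]/[apply] : forall x, y <= x <= a -> exists2 l', is_rderiv setT (fun x => f (Complex x (- s), t)) x l' & modC (l' - G [:: dirx] (toC a, t)) <= e.
      move=> x /andP[x1 x2]; have [] := mv x; first by rewrite ler0_norm ?subr_le0//; lra.
      by move=> ? ?; exists (G [:: dirx] (Complex x (- s), t)).
    by apply: le_trans; rewrite -modCN !toCB le_eqVlt; apply/orP; left; apply/eqP; congr modC; ring.
  set D := G [:: dirx] (toC a, t) in k3 *.
  rewrite (_ : f (toC y, t) - f (toC a, t) - D * toC (y - a) =
    (f (Complex y (- s), t) - f (Complex a (- s), t) - D * toC (y - a)) -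
    (f (Complex y (- s), t) - f (toC y, t)) + (f (Complex a (- s), t) - f (toC a, t))); last by ring.
  apply: le_trans (modCD _ _) _; apply: le_trans (lerD (modCB _ _) (lexx _)) _; lra.
- move=> t tT; exists (fun z => G [:: dirx; dirt] (z, t)) => z zl.
  have zt : slab T (z, t) by [].
  have gc ds : cont_at lower (fun z => G ds (z, t)) z.
    have /within_slab_continuousP := Gc ds; move=> /(_ z t (sb _ _ zt)) h e e0.
    have [d d0 dd] := h e e0; exists d => // w wl wz.
    by apply: dd => //; [exact: (sb _ _ (conj wl tT))|rewrite subrr normr0].
  split; last exact: gc.
  have [t1 t01 tI] := time_other T0 tT.
  have zl0 : 0 < - complex.Im z by rewrite oppr_gt0.
  have cont ds e : 0 < e -> exists2 d : R, 0 < d & forall w s, slab T (w, s) -> modC (w - z) < d -> `|s - t| < d ->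
      modC (G ds (w, s) - G ds (z, t)) < e.
    move=> e0; have /within_slab_continuousP/(_ z t (sb _ _ zt) e e0)[d d0 dd] := Gc ds.
    by exists d => // w s ws; apply: dd; exact: sb.
  have mx : G [:: dirx; dirt] (z, t) = G [:: dirt; dirx] (z, t).
    pose c x : C := Complex x (complex.Im z).
    have cz x : modC (c x - z) = `|x - complex.Re z|.
      rewrite -[RHS]modC_toC; congr modC; rewrite /c; case: (z) => ? ?; by apply: complexP => /=; ring.
    have lc x : lower (c x) by [].
    have -> : z = c (complex.Re z) by rewrite /c; case: (z).
    apply: (@mixed_partials (time T) (fun x s => f (c x, s)) (fun x s => G [:: dirx] (c x, s))
      (fun x s => G [:: dirt] (c x, s)) (fun x s => G [:: dirx; dirt] (c x, s))
      (fun x s => G [:: dirt; dirx] (c x, s)) _ t t1 1) => //.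
      move=> x s _ sT; have xs : slab T (c x, s) by [].
      split; [exact: (Gp dirx _ xs)|exact: (Gp dirt _ xs)|exact: (Gd dirx [:: dirt] _ xs)|exact: (Gd dirt [:: dirx] _ xs)].
    have -> : c (complex.Re z) = z by rewrite /c; case: (z).
    move=> e e0; have [d d0 dd] := cont [:: dirx; dirt] e e0; have [d' d'0 dd'] := cont [:: dirt; dirx] e e0.
    exists (Num.min d d'); first by rewrite lt_min d0.
    move=> x s; rewrite !lt_min => /andP[x1 x2] /andP[s1 s2] sT.
    by split; [apply: dd|apply: dd'] => //; rewrite cz.
  have my : G [:: diry; dirt] (z, t) = G [:: dirt; diry] (z, t).
    pose c x : C := Complex (complex.Re z) x.
    have cz x : modC (c x - z) = `|x - complex.Im z|.
      rewrite (_ : c x - z = iC * toC (x - complex.Im z)); first by rewrite modCM modC_iC mul1r modC_toC.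
      rewrite /c; case: (z) => ? ?; by apply: complexP => /=; ring.
    have lc x : `|x - complex.Im z| < - complex.Im z -> lower (c x).
      by rewrite /Defs.lower /= => /(le_lt_trans (ler_norm _)); lra.
    have -> : z = c (complex.Im z) by rewrite /c; case: (z).
    apply: (@mixed_partials (time T) (fun x s => f (c x, s)) (fun x s => G [:: diry] (c x, s))
      (fun x s => G [:: dirt] (c x, s)) (fun x s => G [:: diry; dirt] (c x, s))
      (fun x s => G [:: dirt; diry] (c x, s)) _ t t1 (- complex.Im z)) => //.
      move=> x s /lc xl sT; have xs : slab T (c x, s) by [].
      split; [exact: (Gp diry _ xs)|exact: (Gp dirt _ xs)|exact: (Gd diry [:: dirt] _ xs)|exact: (Gd dirt [:: diry] _ xs)].
    have -> : c (complex.Im z) = z by rewrite /c; case: (z).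
    move=> e e0; have [d d0 dd] := cont [:: diry; dirt] e e0; have [d' d'0 dd'] := cont [:: dirt; diry] e e0.
    exists (Num.min (Num.min d d') (- complex.Im z)); first by rewrite !lt_min d0 d'0.
    move=> x s; rewrite !lt_min => /andP[/andP[x1 x2] x3] /andP[/andP[s1 s2] _] sT.
    by split; [apply: dd|apply: dd'] => //; rewrite ?cz//; split => //; exact: lc.
  (* The Cauchy-Riemann equation of [f] differentiated in time; with [mx] and [my] it becomes the
     Cauchy-Riemann equation of the time derivative. *)
  have tCR : G [:: dirt; diry] (z, t) = iC * G [:: dirt; dirx] (z, t).
    have PT := proper_time T0 tT.
    have h1 := Gd dirt [:: diry] (z, t) zt; have h2 := Gd dirt [:: dirx] (z, t) zt.
    rewrite -(is_rderiv_val PT h1); apply: (is_rderiv_val PT).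
    have h3 := is_rderivM (@is_rderiv_cst R (time T) iC t) h2.
    rewrite mul0r add0r in h3; apply/is_rderivP => e e0.
    have /is_rderivP/(_ e e0)[d d0 dd] := h3.
    exists d => // s sT st; have := dd s sT st; rewrite /slice /=.
    by have [-> ->] := CR z s (conj zl sT); have [-> ->] := CR z t zt.
  move=> e e0.
  have [||d d0 dd] := slab_differentiable (f := G [:: dirt]) (fx := G [:: dirx; dirt]) (fy := G [:: diry; dirt]) zt _ (Gd dirt [:: dirt] (z, t) zt) _ e0.
  - by move=> p ps; split; [exact: (Gd dirx [:: dirt] p ps)|exact: (Gd diry [:: dirt] p ps)].
  - move=> e1 e10; have [d d0 dd] := cont [:: dirx; dirt] e1 e10; have [d' d'0 dd'] := cont [:: diry; dirt] e1 e10.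
    exists (Num.min d d'); first by rewrite lt_min d0.
    move=> w s ws; rewrite !lt_min => /andP[w1 w2] /andP[s1 s2].
    by split; [exact: dd|exact: dd'].
  exists d => // w wz; have := dd w t tT wz; rewrite subrr normr0 => /(_ d0).
  rewrite addr0 my tCR -mx; apply: le_trans.
  rewrite le_eqVlt; apply/orP; left; apply/eqP; congr modC.
  rewrite [in LHS](complexRI (w - z)) (_ : toC 0 = 0)//; ring.
Qed.

End SmoothTraces.

(** * Boundary data of the smooth approximations *)

Section Approximants.
Context {R : realType}.
Local Notation C := R[i].
Local Notation lower := (@lower R).
Local Notation lowerbar := (@lowerbar R).
Implicit Types (T t : R).

(* In the intended use g = F_z'/Psi_z', and H is the holomorphic part of
   (1/Psi_z') (d_x' - i d_y') P = H - conj(F) g. *)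
Record trace_data T t (F Psi : C * R -> C) (Q : C * R -> R) (Ztt : R -> C)
    (M L : R) (g H : C -> C) : Prop := {
  td_g : exists g', holo g g' ;
  td_H : exists H', holo H H' ;
  td_g_cont : forall z, lowerbar z -> cont_at lowerbar g z ;
  td_H_cont : forall z, lowerbar z -> cont_at lowerbar H z ;
  td_interior : forall z, lower z ->
    recip_dz Psi (z, t) * cgrad Q (z, t) = H z - Num.conj (F (z, t)) * g z ;
  td_boundary : forall x : R,
    H (toC x) - Num.conj (F (toC x, t)) * g (toC x) = iC - Num.conj (Ztt x) ;
  td_g_bound : forall x : R, modC (g (toC x)) <= M ;
  td_q_bound : forall x : R,
    modC (iC - Num.conj (Ztt x)) <= M * modC (ext (slab T) (recip_dz Psi) (bdry (x, t))) ;
  td_recip_bound : forall x : R, modC (ext (slab T) (recip_dz Psi) (bdry (x, t))) <= L ;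
  td_F_bound : forall x : R, modC (F (toC x, t)) <= L ;
  td_growth : exists R0 B, forall z, lower z -> R0 <= modC z ->
    modC (g z) <= B / - complex.Im z /\ modC (H z) <= B + B / - complex.Im z
}.

Lemma rderiv_comp (u : R -> C) (h : R -> R) (a : R) (l m : C) :
  is_rderiv setT (fun x => toC (h x)) a m -> is_rderiv setT u (h a) l ->
  is_rderiv setT (fun x => u (h x)) a (l * m).
Proof.
move=> /is_rderivP hh /is_rderivP hu; apply/is_rderivP => e e0.
pose A := modC l + 1; pose B := modC m + 1.
have A0 : 0 < A by rewrite ltr_wpDl ?modC_ge0.
have B0 : 0 < B by rewrite ltr_wpDl ?modC_ge0.
have e1 : 0 < e / 2 / A by rewrite !divr_gt0.
have e2 : 0 < e / 2 / B by rewrite !divr_gt0.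
have [d1 d10 h1] := hh 1 ltr01; have [d2 d20 h2] := hh _ e1.
have [d3 d30 h3] := hu _ e2.
exists (Num.min (Num.min d1 d2) (d3 / B)); first by rewrite !lt_min d10 d20 divr_gt0.
move=> y Iy; rewrite !lt_min => /andP[/andP[/(h1 y Iy) k1 /(h2 y Iy) k2]].
rewrite ltr_pdivlMr// => k3.
have k4 : `|h y - h a| <= B * `|y - a|.
  rewrite -modC_toC toCB -(subrK (m * toC (y - a)) (toC (h y) - toC (h a))) (le_trans (modCD _ _))//.
  by rewrite modCM modC_toC mulrDl addrC lerD2l.
have k5 : `|h y - h a| < d3 by apply: le_lt_trans k4 _; rewrite mulrC.
rewrite /= (_ : u (h y) - u (h a) - l * m * toC (y - a) = (u (h y) - u (h a) - l * toC (h y - h a)) +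
  l * (toC (h y) - toC (h a) - m * toC (y - a))); last by rewrite !toCB; ring.
rewrite (le_trans (modCD _ _))// (splitr e) mulrDl lerD//.
  apply: le_trans (h3 _ I k5) _.
  apply: le_trans (_ : e / 2 / B * (B * `|y - a|) <= _); first by rewrite ler_wpM2l// ltW.
  by rewrite mulrA mulfVK// gt_eqF.
rewrite modCM; apply: le_trans (_ : A * (e / 2 / A * `|y - a|) <= _).
  by rewrite ler_pM ?modC_ge0// lerDl.
by rewrite mulrA (mulrC A) mulfVK// gt_eqF.
Qed.

Lemma line_da_val (f : R * R -> C) (a t : R) (l : C) :
  is_rderiv setT (fun x => f (x, t)) a l -> line_da f (a, t) = l.
Proof. by move=> h; exact: (is_rderiv_val (proper_setT a) h). Qed.

Lemma cont_at_rcont (f : C -> C) : (forall z, lowerbar z -> cont_at lowerbar f z) ->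
  rcont (fun x : R => f (toC x)).
Proof.
move=> cf x e e0; have xl (u : R) : lowerbar (toC u : C) by rewrite /Defs.lowerbar /=.
have [d d0 dd] := cf _ (xl x) e e0; exists d => // y yx; apply: dd => //.
by rewrite -toCB modC_toC.
Qed.

Lemma cvg_conj (X : Type) (A : set_system X) (FF : Filter A) (f : X -> C) (l : C) :
  f @ A --> l -> (fun x => Num.conj (f x)) @ A --> Num.conj l.
Proof.
move=> /cvg_modC h; apply/cvg_modC => e /h; apply: filterS => x /=.
by rewrite -rmorphB /= modC_conj.
Qed.

(** Solving the evolution equation for the pressure term gives [(i - F_t + Psi_t g) - conj(F) g],
    whose bracket [H] is holomorphic because [F_t] and [Psi_t] are. The constants come from the
    uniform bounds, hence do not depend on [eps]. *)
Lemma approximant_trace T t (Cst c1 c2 : R -> R) (C0 : R -> R -> R) (E c0 eps : R)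
    (F Psi Fe Pe : C * R -> C) (Qe : C * R -> R) (he hie : R * R -> R) :
  0 < T -> time T t -> 0 < c1 E ->
  smooth_approx T F Psi eps Fe Pe Qe he hie ->
  uniform_bounds T Cst c1 c2 C0 E c0 Fe Pe he ->
  exists g H, trace_data T t Fe Pe Qe (fun x => bZtt T Pe he hie (x, t)) (Cst E) (C0 c0 E) g H.
Proof.
move=> T0 tT c10 sa ub.
have [sF sP sQ] := sa_smooth sa; have ww := sa_water_wave sa.
have holP s : time T s -> holomorphic (fun z => Pe (z, s)) by move=> /(ww_conformal ww)[].
have [Fx [Ft [[cF [cFx cFt]] FE Fbd Fthol]]] := smooth_slab_trace T0 sF (ww_holomorphic ww).
have [Px [Pt [[cP [cPx cPt]] PE Pbd Pthol]]] := smooth_slab_trace T0 sP holP.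
have sb w s : slab T (w, s) -> slabbar T (w, s).
  by move=> [wl sT]; split => //; exact: ltW.
have xl (x : R) : lowerbar (toC x : C) by rewrite /Defs.lowerbar /=.
have slice (f : C * R -> C) : {within slabbar T, continuous f} -> forall z, lowerbar z -> cont_at lowerbar (fun z => f (z, t)) z.
  by move=> /within_slab_continuousP h z zl; exact: cont_at_slice tT zl h.
have bZa x s : time T s -> bZ_a Pe (x, s) = Px (toC x, s).
  by move=> sT; apply: line_da_val; exact: (Pbd x s sT).
have Px0 z s : slabbar T (z, s) -> Px (z, s) != 0.
  move=> [/= zl sT]; have [z0|z0] := eqVneq (complex.Im z) 0.
    have -> : z = toC (complex.Re z) by apply: complexP.
    by rewrite -bZa//; apply: (sa_immersed sa).
  have zl' : lower z by rewrite /Defs.lower /= lt_neqAle z0.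
  have [-> _] := PE z s (conj zl' sT); apply: conformal_dz_neq0 zl'; exact: (ww_conformal ww sT).
pose g2 p := Fx p / Px p.
pose q2 p := iC - Ft p + Pt p * g2 p - Num.conj (Fe p) * g2 p.
have g2E z s : slab T (z, s) -> g2 (z, s) = dz Fe (z, s) / dz Pe (z, s).
  by move=> zs; rewrite /g2; have [-> _] := FE z s zs; have [-> _] := PE z s zs.
have q2E z s : slab T (z, s) -> recip_dz Pe (z, s) * cgrad Qe (z, s) = q2 (z, s).
  move=> zs; have := ww_equation ww zs; have [_ hFt] := FE z s zs; have [_ hPt] := PE z s zs.
  rewrite /q2 g2E// hFt hPt => eq.
  set A := recip_dz _ _ * _ in eq *.
  have -> : A = iC - (- A + iC) by ring.
  by rewrite -eq; ring.
have cvg2 (f : C * R -> C) (p : C * R) : {within slabbar T, continuous f} -> slabbar T p -> f @ within (slabbar T) (nbhs p) --> f p.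
  by rewrite subspace_continuousP => h ps; exact: (h p ps).
have cg2 p : slabbar T p -> g2 @ within (slabbar T) (nbhs p) --> g2 p.
  case: p => z s ps; apply: (@cvgM C); first exact: (cvg2 _ _ cFx ps).
  by apply: (@cvgV C); [exact: Px0|exact: (cvg2 _ _ cPx ps)].
have cq2 p : slabbar T p -> q2 @ within (slabbar T) (nbhs p) --> q2 p.
  move=> ps; apply: cvgB; [apply: cvgD|].
  - by apply: cvgB; [exact: cvg_cst|exact: (cvg2 _ _ cFt ps)].
  - by apply: (@cvgM C); [exact: (cvg2 _ _ cPt ps)|exact: cg2].
  - by apply: (@cvgM C); [apply: cvg_conj; exact: (cvg2 _ _ cF ps)|exact: cg2].
have extE (f h : C * R -> C) (x : R) : h @ within (slabbar T) (nbhs (toC x, t)) --> h (toC x, t) ->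
    (forall z s, slab T (z, s) -> f (z, s) = h (z, s)) -> ext (slab T) f (bdry (x, t)) = h (toC x, t).
  move=> ch fh; apply: (ext_lim (proper_slab (xl x) tT)); apply/cvg_modC => e e0.
  move/cvg_modC : ch => /(_ e e0); rewrite /within /= => /nbhs_plane_time[d d0 dd].
  apply/nbhs_plane_time; exists d => // w s wz st ws /=; rewrite fh//.
  exact: (dd w s wz st (sb _ _ ws)).
have recE x : ext (slab T) (recip_dz Pe) (bdry (x, t)) = (Px (toC x, t))^-1.
  apply: (extE _ (fun p => (Px p)^-1)).
    have ps : slabbar T (toC x, t) := conj (xl x) tT.
    by have := cvgV (Px0 _ _ ps) (cvg2 _ _ cPx ps); exact.
  by move=> z s zs; rewrite /recip_dz; have [-> _] := PE z s zs.
have qbd x : q2 (toC x, t) = iC * (toC (bA1 Fe (x, t)) / bZ_a Pe (x, t)).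
  rewrite -(sa_pressure_trace sa (q := (x, t)))//; apply/esym.
  have h1 := cq2 (toC x, t) (conj (xl x) tT).
  have h2 := extE (fun p => recip_dz Pe p * cgrad Qe p) q2 x h1.
  by have h3 := h2 q2E; exact h3.
have Zttbd x : q2 (toC x, t) = iC - Num.conj (bZtt T Pe he hie (x, t)).
  rewrite qbd; have := sa_acceleration sa (q := (x, t)) (conj Logic.I tT) => eq.
  by rewrite -[LHS]opprK -eq opprB.
pose g z := g2 (z, t); pose H z := iC - Ft (z, t) + Pt (z, t) * g z.
have cg z : lowerbar z -> cont_at lowerbar g z.
  move=> zl; apply: cont_atM; first exact: slice.
  by apply: cont_atV; [exact: (Px0 _ _ (conj zl tT))|exact: slice].
have cH z : lowerbar z -> cont_at lowerbar H z.
  move=> zl; apply: cont_atD; last by apply: cont_atM; [exact: slice|exact: cg].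
  by apply: cont_atB; [exact: cont_at_cst|exact: slice].
have hol_of (f fx : C * R -> C) : (forall s, time T s -> holomorphic (fun z => f (z, s))) ->
    {within slabbar T, continuous fx} -> (forall z s, slab T (z, s) -> fx (z, s) = dz f (z, s)) ->
    holo (fun z => f (z, t)) (fun z => fx (z, t)).
  move=> hf cfx fxE z zl; rewrite fxE//; split; first by have [] := holomorphic_cdiff (hf t tT) zl.
  move=> e e0; have [d d0 dd] := slice _ cfx z (ltW zl) e e0; exists d => // w wl wz.
  by apply: dd => //; exact: ltW.
have hF : holo (fun z => Fe (z, t)) (fun z => Fx (z, t)).
  by apply: (hol_of _ _ (ww_holomorphic ww) cFx) => z s /(FE z s)[].
have hP : holo (fun z => Pe (z, t)) (fun z => Px (z, t)).
  by apply: (hol_of _ _ holP cPx) => z s /(PE z s)[].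
have [Fxx hFx] := holo_deriv hF; have [Pxx hPx] := holo_deriv hP.
have Px0' z : lower z -> Px (z, t) != 0 by move=> zl; exact: (Px0 _ _ (conj (ltW zl) tT)).
have hg := holoM hFx (holoV hPx Px0'); rewrite -/g in hg.
have [Ft' hFt] := Fthol t tT; have [Pt' hPt] := Pthol t tT.
have hH : exists H', holo H H'.
  exists (fun z => (0 - Ft' z) + (Pt' z * g z + Pt (z, t) *
    (Fxx z * (Px (z, t))^-1 + Fx (z, t) * (- Pxx z / Px (z, t) ^+ 2)))) => z zl.
  have [d1 k1] := hFt z zl; have [d2 k2] := holoM hPt hg zl.
  split; first by apply: cdiffD => //; apply: cdiffB => //; exact: cdiff_cst.
  by apply: cont_atD => //; apply: cont_atB => //; exact: cont_at_cst.
have st x : strip T (x, t) by [].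
have [L1 L2] : (line_norm +oo (bZt Fe) t <= (C0 c0 E)%:E)%E /\ (line_norm +oo (bZ_recip Pe) t <= (C0 c0 E)%:E)%E.
  have := ub_sup ub tT => h; have l1 := @lpnorm_ge0 R +oo (fun a => bZt Fe (a, t)).
  have l2 := @lpnorm_ge0 R +oo (fun a => bZ_recip Pe (a, t)).
  by split; apply: le_trans h; [exact: leeDl|exact: leeDr].
have rcPx : rcont (fun x => (Px (toC x, t))^-1).
  apply: (@cont_at_rcont (fun z => (Px (z, t))^-1)) => z zl.
  by apply: cont_atV; [exact: (Px0 _ _ (conj zl tT))|exact: slice].
have recb x : modC (ext (slab T) (recip_dz Pe) (bdry (x, t))) <= C0 c0 E.
  have rE y : bZ_recip Pe (y, t) = (Px (toC y, t))^-1 by rewrite /bZ_recip bZa.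
  rewrite recE -rE; apply: (line_norm_infty L2).
  by rewrite (_ : (fun a => _) = (fun x => (Px (toC x, t))^-1))//; apply/funext => y; rewrite rE.
have Fb x : modC (Fe (toC x, t)) <= C0 c0 E.
  rewrite -modC_conj; apply: (line_norm_infty L1 (f := bZt Fe)).
  apply: rcont_conj; apply: (@cont_at_rcont (fun z => Fe (z, t))); exact: slice.
(* This writes [bA1] through functions continuous on the line, so that its essential bound holds at
   every point. *)
have A1E x : toC (bA1 Fe (x, t)) = - iC * (q2 (toC x, t) * Px (toC x, t)).
  rewrite qbd bZa//; have := Px0 _ _ (conj (xl x) tT).
  set B := toC (bA1 _ _); set D := Px _ => D0.
  rewrite (_ : - iC * (iC * (B / D) * D) = - (iC * iC) * B * (D^-1 * D)); last by ring.
  by rewrite iCi mulVf// opprK mul1r mulr1.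
have A1b x : modC (toC (bA1 Fe (x, t))) <= Cst E.
  apply: (line_norm_infty (ub_A1 ub tT) (f := complexify (bA1 Fe))).
  rewrite (_ : (fun a => _) = (fun x => - iC * (q2 (toC x, t) * Px (toC x, t)))); last first.
    by apply/funext => y; rewrite -A1E.
  apply: rcontM; first exact: rcont_cst.
  apply: rcontM; last by apply: (@cont_at_rcont (fun z => Px (z, t))); exact: slice.
  apply: (@cont_at_rcont (fun z => H z - Num.conj (Fe (z, t)) * g z)) => z zl.
  apply: cont_atB; first exact: cH.
  by apply: cont_atM; [apply: cont_at_conj; exact: slice|exact: cg].
have qb x : modC (q2 (toC x, t)) <= Cst E * modC (ext (slab T) (recip_dz Pe) (bdry (x, t))).
  rewrite recE qbd modCM modC_iC mul1r bZa// modCM; apply: ler_wpM2r; first exact: modC_ge0.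
  exact: A1b.
have fl := sa_flow sa.
pose ha x := h_a he (x, t).
have hd x : is_rderiv setT (fun y => toC (he (y, t))) x (ha x).
  by have [h _] := fl_diff fl (st x); exact: h.
(* The lower bound [c1 E > 0] makes [h_a] nonzero, and it cancels in the quotient [ratio]. *)
have ha0 x : ha x != 0.
  rewrite -modC_gt0; have /andP[h _] := ub_h ub (st x); exact: lt_le_trans h.
have bzaE x : bz_a Pe he (x, t) = Px (toC (he (x, t)), t) * ha x.
  apply: line_da_val; exact: (rderiv_comp (u := fun y => Pe (toC y, t)) (hd x) (Pbd _ t tT)).
have bztaE x : bzt_a T Pe he (x, t) = Num.conj (Fx (toC (he (x, t)), t)) * ha x.
  apply: line_da_val.
  rewrite (_ : (fun y => _) = (fun y => Num.conj (Fe (toC (he (y, t)), t)))); last first.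
    by apply/funext => y; rewrite (sa_zt sa (st y)).
  exact: (rderiv_comp (u := fun y => Num.conj (Fe (toC y, t))) (hd x) (is_rderiv_conj (Fbd _ t tT))).
have ratio x : bzt_a T Pe he (x, t) / bz_a Pe he (x, t) =
    Num.conj (Fx (toC (he (x, t)), t)) / Px (toC (he (x, t)), t).
  rewrite bztaE bzaE; have := Px0 _ _ (conj (xl (he (x, t))) tT); have := ha0 x.
  set A := Num.conj _; set B := Px _; set D := ha x => D0 B0.
  by field; rewrite D0 B0.
(* Along the flow, [z_(t alpha) / z_alpha] is conj(F_z') / Psi_z', which has the modulus of [g];
   every boundary point is reached through the inverse flow [hie]. *)
have gb x : modC (g (toC x)) <= Cst E.
  have [_ hx] := fl_inv fl (st x); rewrite /= in hx.
  have -> : modC (g (toC x)) = modC (bzt_a T Pe he (hie (x, t), t) / bz_a Pe he (hie (x, t), t)).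
    by rewrite ratio hx /g /g2 !modCM modC_conj.
  apply: (line_norm_infty (ub_z_ta ub tT) (f := fun q => bzt_a T Pe he q / bz_a Pe he q)).
  rewrite (_ : (fun a => _) = (fun x => Num.conj (Fx (toC (he (x, t)), t)) / Px (toC (he (x, t)), t))); last first.
    by apply/funext => y; rewrite ratio.
  pose rr (y : R) : C := Num.conj (Fx (toC y, t)) / Px (toC y, t).
  have crr : rcont rr.
    apply: rcontM => //; apply: rcont_conj; apply: (@cont_at_rcont (fun z => Fx (z, t))); exact: slice.
  move=> y e e0; have [d d0 dd] := crr (he (y, t)) e e0.
  have [d' d'0 dd'] := is_rderiv_rcont hd y d0; exists d' => // y' yy'; apply: dd.
  by have := dd' y' yy'; rewrite -toCB modC_toC.
exists g, H; split => //.
- by eexists; exact: hg.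
- by move=> z zl; rewrite (q2E z t).
- by move=> x; rewrite -Zttbd.
have [i1 i2 i3 i4] := ww_infty ww tT.
have half0 : 0 < (2^-1 : R) by rewrite invr_gt0.
have [M1 h1] := i1 1 ltr01; have [M2 h2] := i2 1 ltr01; have [M3 h3] := i3 _ half0.
(* Past this modulus [F] is within 1 of its limit 0, [cgrad] within 1 of [i], and [Psi_z'] within
   1/2 of 1. *)
pose N := 1 + `|M1| + `|M2| + `|M3|.
have n1 := normr_ge0 M1; have n2 := normr_ge0 M2; have n3 := normr_ge0 M3.
have m1 := ler_norm M1; have m2 := ler_norm M2; have m3 := ler_norm M3.
(* Doubling the radius keeps the disc of radius [- Im z / 2] around [z] outside the disc of radius
   [N], so Cauchy's estimate may use [|F| <= 1]. The 4 is [2 * 2] both for [g] and for the pressure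
   term, as [|1 / Psi_z'| <= 2]. *)
exists (2 * N), 4 => z zl zN.
have y0 : 0 < - complex.Im z by rewrite oppr_gt0.
have F1 w : lower w -> N <= modC w -> modC (Fe (w, t)) <= 1.
  by move=> wl wN; have := h1 w wl; rewrite subr0 => h; apply/ltW/h; rewrite /N in wN; lra.
have zN1 : N <= modC z by rewrite /N in zN *; lra.
have Fx1 : modC (Fx (z, t)) <= 2 / - complex.Im z.
  have r0 : 0 < - complex.Im z / 2 by rewrite divr_gt0.
  have zr : complex.Im z + - complex.Im z / 2 < 0 by lra.
  have := cauchy_estimate hF r0 zr (M := 1).
  rewrite (_ : 1 / (- complex.Im z / 2) = 2 / - complex.Im z); last by field; rewrite lt_eqF//; lra.
  apply => w wz; apply: F1; first by apply: (lower_ball zr); rewrite wz.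
  have := modC_triB z w; rewrite modC_sub wz => h; have := Im_le_modC z; rewrite ler0_norm; lra.
have Px1 : 2^-1 <= modC (Px (z, t)).
  have : modC (Px (z, t) - 1) < 2^-1.
    by have [-> _] := PE z t (conj zl tT); apply: h3 => //; rewrite /N in zN1; lra.
  have := modC_triB 1 (Px (z, t)); rewrite modC1 modC_sub; lra.
have Pp : 0 < modC (Px (z, t)) by exact: lt_le_trans Px1.
have Pinv : (modC (Px (z, t)))^-1 <= 2 by rewrite -[leRHS]invrK lef_pV2.
have gz : modC (g z) <= 4 / - complex.Im z.
  rewrite /g /g2 modCM modCV (_ : 4 / - complex.Im z = 2 / - complex.Im z * 2); last by field; rewrite lt_eqF//; lra.
  by rewrite ler_pM ?invr_ge0 ?modC_ge0.
split => //.
have -> : H z = recip_dz Pe (z, t) * cgrad Qe (z, t) + Num.conj (Fe (z, t)) * g z.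
  by rewrite (q2E z t)// /q2 -/(g z) /H subrK.
apply: le_trans (modCD _ _) _; apply: lerD.
  rewrite modCM; have cg1 : modC (cgrad Qe (z, t)) <= 2.
    have : modC (cgrad Qe (z, t) - iC) < 1 by apply: h2 => //; rewrite /N in zN1; lra.
    have := modC_triB (cgrad Qe (z, t)) iC; rewrite modC_iC; lra.
  rewrite /recip_dz; have [<- _] := PE z t (conj zl tT); rewrite modCV.
  apply: le_trans (_ : 2 * 2 <= _); last by lra.
  by rewrite ler_pM ?invr_ge0 ?modC_ge0.
rewrite modCM modC_conj; apply: le_trans gz; rewrite -[leRHS]mul1r ler_wpM2r ?modC_ge0//.
exact: F1.
Qed.

End Approximants.

(** * Passage to the limit in the pressure gradient *)

Section PressureLimit.
Context {R : realType}.
Local Notation C := R[i].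
Local Notation lower := (@lower R).
Local Notation lowerbar := (@lowerbar R).
Implicit Types (T t : R).

Lemma ucvg_cvg (X : topologicalType) (U : set X) (f_ : nat -> X -> C) (f : X -> C) (p : X) :
  ucvg U f_ f -> U p -> f_ n p @[n --> \oo] --> f p.
Proof.
move=> h Up; apply/cvg_modC => e e0; have [N hN] := ucvg_point h Up e0.
by exists N.
Qed.

Lemma segment_time_compact (a b t : R) : compact (`[a, b]%classic `*` [set t]).
Proof. by apply: compact_setX; [exact: segment_compact|exact: compact_set1]. Qed.

Lemma bdry_segment_compact (a b t : R) : compact (@bdry R @` (`[a, b]%classic `*` [set t])).
Proof.
apply: continuous_compact; last exact: segment_time_compact.
apply: continuous_subspaceT => -[x s] A; rewrite nbhs_plane_time => -[d d0 dA].
exists ([set u | `|u - x| < d], [set v | `|v - s| < d]).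
  by split; apply/nbhs_realE; exists d.
by move=> [u v] /= [ux vs]; apply: dA => //; rewrite -toCB modC_toC.
Qed.

Lemma within_strip_eps T (f : R * R -> C) (x t : R) : time T t -> {within strip T, continuous f} ->
  forall e : R, 0 < e -> exists2 d : R, 0 < d &
    forall y, `|y - x| < d -> modC (f (y, t) - f (x, t)) < e.
Proof.
move=> tT; rewrite subspace_continuousP => h e e0.
have /cvg_modC/(_ e e0) := h (x, t) (conj Logic.I tT).
move=> [[U V] /= [/nbhs_realE[d d0 dU] /nbhs_realE[d' d'0 dV]] UV].
exists d => // y yx; have := UV (y, t); apply => //.
by split => /=; [exact: dU|apply: dV; rewrite subrr normr0].
Qed.

(** The limit is [i - conj(Z_tt)] at [a]. Estimates are obtained on a neighbourhood of [a] that is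
    the same for all large indices; the index can then be chosen according to the interior point. *)
Lemma pressure_gradient_limit T t a (Cst c1 c2 : R -> R) (C0 : R -> R -> R)
    (F Psi : C * R -> C) (P : C * R -> R) :
  0 < T -> time T t -> wu_solution T Cst c1 c2 C0 F Psi P ->
  exists2 k, tends_lower (fun z => recip_dz Psi (z, t) * cgrad P (z, t)) a k &
    (singular T Psi (a, t) -> k = 0).
Proof.
move=> T0 tT; rewrite /wu_solution.
set E := fine _; set c0 := fine _ => -[[_ ww wr [c10 _]]].
move=> [Fe [Pe [Qe [he [hie [approx [e [h [hi [z [epos _ cv]]]]]]]]]]].
have [Zj ZjE] : {f : nat -> R -> C | f = fun j x => bZtt T (Pe (e j)) (he (e j)) (hie (e j)) (x, t)}.
  by eexists.
have [Zl ZlE] : {f : R -> C | f = fun x => line_dt T (line_dt T z) (hi (x, t), t)} by eexists.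
have [M ME] : {x : R | x = Cst E} by eexists.
have [L LE] : {x : R | x = C0 c0 E} by eexists.
have [g [H td]] : exists g H : nat -> C -> C, forall j,
    trace_data T t (Fe (e j)) (Pe (e j)) (Qe (e j)) (Zj j) M L (g j) (H j).
  have td j : exists gH : (C -> C) * (C -> C),
      trace_data T t (Fe (e j)) (Pe (e j)) (Qe (e j)) (Zj j) M L gH.1 gH.2.
    have [sa ub] := approx (e j) (epos j).
    rewrite ME LE ZjE; have [g [H h']] := approximant_trace T0 tT c10 sa ub; by exists (g, H).
  have [gH hgH] := choice td; exists (fun j => (gH j).1), (fun j => (gH j).2); exact: hgH.
have [k kE] : {k : C | k = iC - Num.conj (Zl a)} by eexists.
have [c cE] : {c : C | c = Num.conj (F (toC a, t))} by eexists.
clear ME LE.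
have al (x : R) : lowerbar (toC x : C) by rewrite /Defs.lowerbar /=.
have M0 : 0 <= M by apply: le_trans (td_g_bound (td 0%N) a); exact: modC_ge0.
have L0 : 0 <= L by apply: le_trans (td_F_bound (td 0%N) a); exact: modC_ge0.
have near1 (x : R) : `|x - a| <= 1 -> (`[a - 1, a + 1]%classic `*` [set t]) (x, t).
  by rewrite ler_norml => /andP[? ?]; split => //=; rewrite in_itv /=; apply/andP; split; lra.
(* Convergence is uniform on compact sets only; the segment of half-width 1 around [a] serves the
   near part of the boundary estimate. *)
have F1 e1 : 0 < e1 -> exists N, forall j, (N <= j)%N -> forall x, `|x - a| <= 1 -> modC (Zj j x - Zl x) < e1.
  move=> e10; have [|N hN] := ucvg_eps (cv_Ztt cv) (@segment_time_compact (a - 1) (a + 1) t) _ e10.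
    by move=> [x s] [_ /= ->]; split.
  by exists N => j Nj x xa; rewrite ZjE ZlE; exact (hN j Nj (x, t) (near1 x xa)).
have F2 e1 : 0 < e1 -> exists2 d : R, 0 < d & forall x, `|x - a| < d -> modC (Zl x - Zl a) < e1.
  move=> e10; have [d d0 dd] := within_strip_eps (hi (a, t)) tT (cv_z_C2 cv).2 e10.
  have [_ ch] := cv_h_homeo cv tT.
  have /nbhs_realE[d' d'0 dd'] : nbhs a [set x | `|hi (x, t) - hi (a, t)| < d].
    by apply: (ch a [set u | `|u - hi (a, t)| < d]); apply/nbhs_realE; exists d.
  by exists d' => // x xa; rewrite ZlE; apply: dd; exact: dd'.
have F3 e1 : 0 < e1 -> exists N, forall j, (N <= j)%N -> forall x, `|x - a| <= 1 ->
    modC (Fe (e j) (toC x, t) - F (toC x, t)) < e1.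
  move=> e10; have [|N hN] := ucvg_eps (cv_F cv) (@bdry_segment_compact (a - 1) (a + 1) t) _ e10.
    by move=> _ [[x s] [_ /= ->] <-]; split => //; exact: al.
  by exists N => j Nj x xa; apply: (hN j Nj (toC x, t)); exists (x, t) => //; exact: near1.
have F4 e1 : 0 < e1 -> exists2 d : R, 0 < d & forall z, lowerbar z -> modC (z - toC a) < d ->
    modC (F (z, t) - F (toC a, t)) < e1.
  by move=> e10; apply: (cont_at_slice tT (al a) _) e10; apply/within_slab_continuousP; exact: wr_F_cont wr.
exists k.
  pose q w := recip_dz Psi (w, t) * cgrad P (w, t).
  suff main e1 : 0 < e1 -> exists2 d : R, 0 < d & forall w, lower w -> modC (w - toC a) < d ->
      modC (q w - k) <= 5 * e1.
    move=> e2 e20; have e60 : 0 < e2 / 6 by rewrite divr_gt0.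
    have [d d0 dd] := main _ e60; exists d => // w wl wa.
    by apply: le_lt_trans (dd w wl wa) _; lra.
  (* [2 e3] for the acceleration and [2 e3 M] for the velocity, weighted by [|g| <= M], add up to
     [e1]. *)
  move=> e10; pose e3 := e1 / (2 * (1 + M)).
  have M1 : 0 < 2 * (1 + M) by lra.
  have e30 : 0 < e3 by rewrite divr_gt0.
  have e3E : 2 * e3 + 2 * e3 * M = e1 by rewrite /e3; field; lra.
  clearbody e3.
  have e3M : 0 <= e3 * M by rewrite mulr_ge0// ltW.
  have [N1 h1] := F1 _ e30; have [d2 d20 h2] := F2 _ e30.
  have [N3 h3] := F3 _ e30; have [d4 d40 h4] := F4 _ e30.
  pose d := Num.min 1 (Num.min d2 d4).
  have d0 : 0 < d by rewrite !lt_min ltr01 d20.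
  have d_1 : d <= 1 by rewrite ge_min lexx.
  have d_2 : d <= d2 by rewrite !ge_min lexx orbT.
  have d_4 : d <= d4 by rewrite !ge_min lexx !orbT.
  clearbody d.
  (* Bound on the whole line: [M L] for the pressure term, [(L + |c|) M] for the change of the
     velocity factor to [c], then [|k|]; the 1 makes it positive. *)
  pose M' := M * L + (L + modC c) * M + modC k + 1.
  have M'0 : 0 < M'.
    by rewrite ltr_wpDl// addr_ge0 ?modC_ge0// addr_ge0 ?mulr_ge0// addr_ge0// modC_ge0.
  have ctrl j : (maxn N1 N3 <= j)%N -> forall w, lower w -> modC (w - toC a) <= e1 * d / M' ->
      modC (H j w - c * g j w - k) <= 2 * e1.
    move=> Nj; have [g' hg] := td_g (td j); have [H' hH] := td_H (td j).
    have [R0 [B gr]] := td_growth (td j).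
    have hK : holo (fun w => H j w - c * g j w) (fun w => H' w - c * g' w).
      move=> w wl; have [dg cg'] := hg w wl; have [dH cH'] := hH w wl.
      split; first by apply: cdiffB => //; exact: cdiffZ.
      by apply: cont_atB => //; apply: cont_atM => //; exact: cont_at_cst.
    (* With conj(F) frozen at [a] the combination is holomorphic, and on the line it differs from
       [k] only by increments of [Z_tt] and of [F], the latter multiplied by [g]. *)
    have bdE x : H j (toC x) - c * g j (toC x) - k =
        Num.conj (Zl a - Zj j x) + Num.conj (Fe (e j) (toC x, t) - F (toC a, t)) * g j (toC x).
      have := td_boundary (td j) x; rewrite !rmorphB /= -cE kE => eq.
      have -> : H j (toC x) = iC - Num.conj (Zj j x) + Num.conj (Fe (e j) (toC x, t)) * g j (toC x).
        by rewrite -eq subrK.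
      by rewrite mulrBl; ring.
    apply: (boundary_control (R0 := R0) (B := `|B| * (1 + modC c)) hK) => //.
    - move=> w wl; apply: cont_atB; first exact: td_H_cont (td j) w wl.
      by apply: cont_atM; [exact: cont_at_cst|exact: td_g_cont (td j) w wl].
    - move=> x.
      have -> : H j (toC x) - c * g j (toC x) = (iC - Num.conj (Zj j x)) +
          (Num.conj (Fe (e j) (toC x, t)) - c) * g j (toC x).
        by rewrite -(td_boundary (td j) x); ring.
      apply: le_trans (modCB _ _) _; rewrite /M'.
      have t1 : modC (iC - Num.conj (Zj j x)) <= M * L.
        apply: le_trans (td_q_bound (td j) x) _; rewrite ler_wpM2l//; exact: td_recip_bound (td j) x.
      have t2 : modC ((Num.conj (Fe (e j) (toC x, t)) - c) * g j (toC x)) <= (L + modC c) * M.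
        rewrite modCM ler_pM ?modC_ge0//; last exact: td_g_bound (td j) x.
        apply: le_trans (modCB _ _) _; rewrite lerD2r modC_conj; exact: td_F_bound (td j) x.
      have := modCD (iC - Num.conj (Zj j x)) ((Num.conj (Fe (e j) (toC x, t)) - c) * g j (toC x)).
      lra.
    - move=> x xd; rewrite bdE; apply: le_trans (modCD _ _) _; rewrite modCM !modC_conj.
      have xa1 : `|x - a| <= 1 by lra.
      have Nj1 := leq_trans (leq_maxl N1 N3) Nj; have Nj3 := leq_trans (leq_maxr N1 N3) Nj.
      have t1 : modC (Zl a - Zj j x) <= 2 * e3.
        have xd2 : `|x - a| < d2 by lra.
        have k1 := h1 j Nj1 x xa1; have k2 := h2 x xd2.
        rewrite modC_sub; have := modC_tri (Zj j x) (Zl x) (Zl a); lra.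
      have t2 : modC (Fe (e j) (toC x, t) - F (toC a, t)) <= 2 * e3.
        have k1 := h3 j Nj3 x xa1.
        have k2 : modC (F (toC x, t) - F (toC a, t)) < e3.
          by apply: h4; [exact: al|rewrite -toCB modC_toC; lra].
        have := modC_tri (Fe (e j) (toC x, t)) (F (toC x, t)) (F (toC a, t)); lra.
      have t3 : modC (Fe (e j) (toC x, t) - F (toC a, t)) * modC (g j (toC x)) <= 2 * e3 * M.
        by rewrite ler_pM ?modC_ge0//; exact: td_g_bound (td j) x.
      lra.
    - move=> w wl wR; have [g1 g2] := gr w wl wR.
      have y0 : 0 < - complex.Im w by rewrite oppr_gt0.
      apply: le_trans (modCB _ _) _; rewrite modCM.
      have b1 : B / - complex.Im w <= `|B| / - complex.Im w by rewrite ler_pM2r ?invr_gt0// ler_norm.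
      have t1 : modC c * modC (g j w) <= modC c * (`|B| / - complex.Im w).
        by rewrite ler_wpM2l ?modC_ge0//; exact: le_trans g1 b1.
      have t2 := ler_norm B; have t3 := normr_ge0 B.
      have t4 : 0 <= `|B| * modC c by rewrite mulr_ge0 ?modC_ge0.
      have t5 : `|B| * (1 + modC c) / - complex.Im w =
        `|B| / - complex.Im w + modC c * (`|B| / - complex.Im w) by ring.
      rewrite t5 mulrDr mulr1; lra.
  (* The growth of order [1 / |Im z|] lets the bound on [g] pass from the line to the half plane
     without loss. *)
  have gM j w : lower w -> modC (g j w) <= M.
    move=> wl; have [g' hg] := td_g (td j); have [R0 [B gr]] := td_growth (td j).
    apply: (phragmen_lindelof (R0 := R0) (B := B) hg) => //.
    - exact: td_g_cont (td j).
    - exact: td_g_bound (td j).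
    - by move=> u ul uR; have [] := gr u ul uR.
  exists (Num.min d4 (e1 * d / M')); first by rewrite lt_min d40 divr_gt0// mulr_gt0.
  move=> w wl; rewrite lt_min => /andP[w4 wM].
  have wt : slab T (w, t) by [].
  have qcv : recip_dz (Pe (e j)) (w, t) * cgrad (Qe (e j)) (w, t) @[j --> \oo] --> q w.
    apply: (@cvgM C).
      apply: (@cvgV C); first exact: (conformal_dz_neq0 (ww_conformal ww tT) wl).
      exact: (ucvg_cvg (cv_Psiz cv) wt).
    exact: (ucvg_cvg (cv_cgrad cv) wt).
  have Fcv := ucvg_cvg (cv_F cv) (conj (ltW wl) tT : slabbar T (w, t)).
  move/cvg_modC : qcv => /(_ e1 e10)[Nq _ hq].
  move/cvg_modC : Fcv => /(_ e3 e30)[NF _ hF].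
  (* The index depends on [w]; the radius fixed before does not. *)
  pose j := maxn (maxn N1 N3) (maxn Nq NF).
  have j1 : (maxn N1 N3 <= j)%N := leq_maxl _ _.
  have j2 : (Nq <= j)%N := leq_trans (leq_maxl Nq NF) (leq_maxr _ _).
  have j3 : (NF <= j)%N := leq_trans (leq_maxr Nq NF) (leq_maxr _ _).
  have {}hq := hq j j2; have {}hF := hF j j3; rewrite /= in hq hF.
  have k1 := ctrl j j1 w wl (ltW wM).
  have k2 : modC (F (w, t) - F (toC a, t)) < e3 by apply: h4 => //; exact: ltW.
  have k3 := gM j w wl.
  have qE : recip_dz (Pe (e j)) (w, t) * cgrad (Qe (e j)) (w, t) - k =
      (H j w - c * g j w - k) - Num.conj (Fe (e j) (w, t) - F (toC a, t)) * g j w.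
    by rewrite (td_interior (td j) wl) rmorphB /= -cE; ring.
  have k4 : modC (Fe (e j) (w, t) - F (toC a, t)) * modC (g j w) <= 2 * e3 * M.
    rewrite ler_pM ?modC_ge0//; have := modC_tri (Fe (e j) (w, t)) (F (w, t)) (F (toC a, t)); lra.
  have := modC_tri (q w) (recip_dz (Pe (e j)) (w, t) * cgrad (Qe (e j)) (w, t)) k.
  rewrite modC_sub in hq; rewrite qE.
  have := modCB (H j w - c * g j w - k) (Num.conj (Fe (e j) (w, t) - F (toC a, t)) * g j w).
  rewrite modCM modC_conj; lra.
rewrite /singular => s0; apply/eqP; rewrite -modC_eq0; apply/eqP/le_anti; rewrite modC_ge0 andbT.
apply/ler_addgt0Pl => e1 e10; rewrite addr0.
have e20 : 0 < e1 / (1 + M) by rewrite divr_gt0//; lra.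
have [N1 h1] := F1 _ e20.
have [N2 h2] := ucvg_point (cv_recip cv) (conj (al a) tT : slabbar T (bdry (a, t))) e20.
pose j := maxn N1 N2.
have k1 := h1 j (leq_maxl _ _) a; rewrite subrr normr0 in k1; have {}k1 := k1 ler01.
have := h2 j (leq_maxr _ _); rewrite s0 subr0 => k2.
have k3 := td_q_bound (td j) a.
have k4 : modC k <= modC (iC - Num.conj (Zj j a)) + modC (Zj j a - Zl a).
  rewrite -(modC_conj (Zj j a - Zl a)) rmorphB /=; apply: le_trans (modCD _ _).
  by rewrite le_eqVlt; apply/orP; left; apply/eqP; congr modC; rewrite kE; ring.
have k5 : M * modC (ext (slab T) (recip_dz (Pe (e j))) (bdry (a, t))) <= M * (e1 / (1 + M)).
  by rewrite ler_wpM2l// ltW.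
have k6 : e1 / (1 + M) + M * (e1 / (1 + M)) = e1 by field; lra.
lra.
Qed.

End PressureLimit.

(** * Conjugation by Psi *)

Section LocalInverse.
Context {R : realType}.
Local Notation C := R[i].
Local Notation lower := (@lower R).
Local Notation lowerbar := (@lowerbar R).
Implicit Types (T t : R).

Lemma C1_slab_frechet T (f : C * R -> C) (z : C) (t : R) : slab T (z, t) -> C1_slab T f ->
  forall e : R, 0 < e -> exists2 d : R, 0 < d & forall w s, time T s ->
    modC (w - z) < d -> `|s - t| < d ->
    modC (f (w, s) - f (z, t) - dx f (z, t) * toC (complex.Re (w - z))
          - dy f (z, t) * toC (complex.Im (w - z)) - dt T f (z, t) * toC (s - t))
      <= e * (modC (w - z) + `|s - t|).
Proof.
move=> zt cf; apply: (slab_differentiable (fx := dx f) (fy := dy f) zt).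
- by move=> p pT; split; [exact: ((cf dirx).1 p pT)|exact: ((cf diry).1 p pT)].
- exact: ((cf dirt).1 (z, t) zt).
move=> e e0; have /within_slab_continuousP/(_ z t zt e e0)[d d0 dd] := (cf dirx).2.
have /within_slab_continuousP/(_ z t zt e e0)[d' d'0 dd'] := (cf diry).2.
exists (Num.min d d'); first by rewrite lt_min d0.
move=> w s ws; rewrite !lt_min => /andP[w1 w2] /andP[s1 s2].
by split; [exact: dd|exact: dd'].
Qed.

Lemma holomorphic_frechet T (f : C * R -> C) (z : C) (t : R) : slab T (z, t) -> C1_slab T f ->
  holomorphic (fun z => f (z, t)) ->
  forall e : R, 0 < e -> exists2 d : R, 0 < d & forall w s, time T s ->
    modC (w - z) < d -> `|s - t| < d ->
    modC (f (w, s) - f (z, t) - dz f (z, t) * (w - z) - dt T f (z, t) * toC (s - t))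
      <= e * (modC (w - z) + `|s - t|).
Proof.
move=> zt cf hf e e0; have [d d0 dd] := C1_slab_frechet zt cf e0.
exists d => // w s sT wz st; have := dd w s sT wz st.
have [df _] := holomorphic_cdiff hf zt.1; have [-> -> _] := cdiff_dz df.
apply: le_trans; rewrite le_eqVlt; apply/orP; left; apply/eqP; congr modC.
by rewrite [in LHS](complexRI (w - z)); ring.
Qed.

(* Newton's step decreases |Psi - x| wherever it is nonzero, so an interior
   minimum of it is a solution of Psi = x. *)
Lemma interior_min_zero (f f' : C -> C) (x c : C) (r : R) : 0 < r ->
  cdiff f c (f' c) -> f' c != 0 ->
  (forall w, modC (w - c) < r -> modC (f c - x) <= modC (f w - x)) -> f c = x.
Proof.
move=> r0 df p0 hmin; apply/eqP; rewrite -subr_eq0; apply/negPn/negP => u0.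
set u := f c - x in u0 hmin; set p := f' c in df p0.
have up : 0 < modC u by rewrite modC_gt0.
have pp : 0 < modC p by rewrite modC_gt0.
have e0 : 0 < modC p / 2 by rewrite divr_gt0.
have [d d0 dd] := df _ e0.
pose s := Num.min (1 / 2) (Num.min (d / 2) (r / 2) * modC p / modC u).
have m0 : 0 < Num.min (d / 2) (r / 2) by rewrite lt_min !divr_gt0.
have s0 : 0 < s by rewrite lt_min divr_gt0//= divr_gt0// mulr_gt0.
have s1 : s <= 1 / 2 by rewrite ge_min lexx.
have s2 : s <= Num.min (d / 2) (r / 2) * modC p / modC u by rewrite ge_min lexx orbT.
pose w := c - toC s * u / p.
have wcE : w - c = - (toC s * u / p) by rewrite /w; ring.
have wc : modC (w - c) = s * modC u / modC p.
  by rewrite wcE modCN !modCM modCV modC_toC gtr0_norm.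
have wm : modC (w - c) <= Num.min (d / 2) (r / 2).
  by rewrite wc ler_pdivrMr// -ler_pdivlMr.
have wd : modC (w - c) < d by apply: le_lt_trans wm _; rewrite gt_min; apply/orP; left; lra.
have wr : modC (w - c) < r by apply: le_lt_trans wm _; rewrite gt_min; apply/orP; right; lra.
have h1 := dd w wd; have h2 := hmin w wr.
have E : f w - x = toC (1 - s) * u + (f w - f c - p * (w - c)).
  rewrite wcE /u toCB toC1; field; exact: p0.
have h3 : modC (f w - x) <= (1 - s) * modC u + s * modC u / 2.
  rewrite E; apply: le_trans (modCD _ _) _; rewrite modCM modC_toC ger0_norm; last by lra.
  rewrite lerD2l; apply: le_trans h1 _; rewrite wc le_eqVlt; apply/orP; left; apply/eqP.
  by field; rewrite gt_eqF.
have : 0 < s * modC u by rewrite mulr_gt0.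
lra.
Qed.

(** A quantitative inverse of [(w, s) -> (Psi(w, s), s)]. The minimum of [|Psi(., s) - x|] on a
    closed disc is not on its circle, where [lowb] keeps the values above the one at the centre, so
    [interior_min_zero] applies. *)
Lemma local_solvability T (Psi : C * R -> C) (z : C) (t : R) :
  slab T (z, t) -> C1_slab T Psi -> (forall s, time T s -> conformal (fun z => Psi (z, s))) ->
  exists2 K : R, 0 < K & forall r : R, 0 < r -> exists2 d : R, 0 < d &
    forall x s, time T s -> modC (x - Psi (z, t)) < d -> `|s - t| < d ->
    exists w, [/\ lower w, modC (w - z) < r, Psi (w, s) = x &
      modC (w - z) <= K * (modC (x - Psi (z, t)) + `|s - t|)].
Proof.
move=> zt cP cf; have [zl tT] := zt.
have hol s : time T s -> holomorphic (fun z => Psi (z, s)) by move=> /cf[].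
set p := dz Psi (z, t); set q := dt T Psi (z, t).
have p0 : 0 < modC p by rewrite modC_gt0; exact: (conformal_dz_neq0 (cf t tT) zl).
have e0 : 0 < modC p / 2 by rewrite divr_gt0.
have [d1 d10 fr] := holomorphic_frechet zt cP (hol t tT) e0.
set x0 := Psi (z, t) in fr *; rewrite -/p -/q in fr; clearbody p q.
pose A := modC q + modC p / 2 + 1.
have q0 := modC_ge0 q; have A0 : 0 < A by rewrite /A; lra.
have lowb x s w : time T s -> modC (w - z) < d1 -> `|s - t| < d1 ->
    modC p / 2 * modC (w - z) <= modC (Psi (w, s) - x) + (modC (x - x0) + A * `|s - t|).
  move=> sT wz st; have h := fr w s sT wz st.
  have h1 : modC (p * (w - z)) <= modC (Psi (w, s) - x0 - p * (w - z) - q * toC (s - t)) +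
      (modC (Psi (w, s) - x) + modC (x - x0)) + modC (q * toC (s - t)).
    rewrite -modCN; set B := _ - _ - q * _.
    rewrite (_ : - (p * (w - z)) = B - ((Psi (w, s) - x) + (x - x0)) + q * toC (s - t)); last by rewrite /B -/q; ring.
    apply: le_trans (modCD _ _) _; rewrite lerD2r; apply: le_trans (modCB _ _) _.
    by rewrite lerD2l; exact: modCD.
  move: h1; rewrite !modCM modC_toC => h1; have s0 := normr_ge0 (s - t).
  have : A * `|s - t| = modC q * `|s - t| + modC p / 2 * `|s - t| + `|s - t| by rewrite /A; ring.
  lra.
pose K := 2 / modC p * (1 + A); have K0 : 0 < K by rewrite mulr_gt0 ?divr_gt0//; lra.
exists K => // r r0.
pose rho := Num.min (Num.min (d1 / 2) (r / 2)) (- complex.Im z / 2).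
have zl0 : 0 < - complex.Im z by rewrite oppr_gt0.
have rho0 : 0 < rho by rewrite !lt_min !divr_gt0.
have rd : rho <= d1 / 2 by rewrite !ge_min lexx.
have rr : rho <= r / 2 by rewrite !ge_min lexx orbT.
have rz : rho <= - complex.Im z / 2 by rewrite ge_min lexx orbT.
have lowd w : modC (w - z) <= rho -> lower w.
  by move=> wz; apply: (lower_ball (r := rho)) wz; lra.
(* With this threshold [|x - x0| + A |s - t|] is below [|p| rho / 4], half of the main term
   [|p| rho / 2] on the circle. *)
pose eta := modC p * rho / (8 * (1 + A)).
have A1 : 0 < 8 * (1 + A) by lra.
have eta0 : 0 < eta by rewrite divr_gt0// mulr_gt0.
have etaE : eta * (8 * (1 + A)) = modC p * rho by rewrite /eta mulfVK// gt_eqF.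
exists (Num.min d1 eta); first by rewrite lt_min d10.
move=> x s sT; rewrite !lt_min => /andP[_ xe] /andP[sd se].
have xn := modC_ge0 (x - x0); have sn := normr_ge0 (s - t).
have Ase : A * `|s - t| <= A * eta by rewrite ler_wpM2l// ltW.
have small : modC (x - x0) + A * `|s - t| < modC p * rho / 4.
  have : (1 + A) * eta = modC p * rho / 8 by rewrite -etaE; field; lra.
  have : 0 < modC p * rho by rewrite mulr_gt0.
  rewrite mulrDl mul1r; lra.
have contP w : modC (w - z) <= rho -> cdiff (fun w => Psi (w, s)) w (dz Psi (w, s)).
  by move=> /lowd wl; have [] := holomorphic_cdiff (hol s sT) wl.
have [||c cz cmax] := @compact_max R [set w | modC (w - z) <= rho] (fun w => - modC (Psi (w, s) - x))
    (compact_disc (c := z) (r := rho)).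
- by exists z => /=; rewrite subrr modC0 ltW.
- move=> w wz e1 e10.
  have cw : cont_at [set w | modC (w - z) <= rho] (fun w => Psi (w, s) - x) w.
    by apply: cont_atB; [exact: cdiff_cont (contP w wz)|exact: cont_at_cst].
  have [d d0 dd] := modC_cont cw e10; exists d => // w' w'z ww'.
  by have := dd w' w'z ww'; rewrite -opprD normrN.
have {cmax} cmin w : modC (w - z) <= rho -> modC (Psi (c, s) - x) <= modC (Psi (w, s) - x).
  by move=> wz; rewrite -lerN2; exact: cmax.
have cin : modC (c - z) < rho.
  rewrite lt_neqAle cz andbT; apply/eqP => cE.
  have h1 := lowb x s c sT; rewrite cE in h1; have {}h1 := h1 _ sd.
  have h2 : modC (Psi (z, s) - x) <= modC (x - x0) + A * `|s - t|.
    have := fr z s sT; rewrite subrr modC0 => /(_ d10 sd); rewrite mulr0 subr0 add0r => h.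
    rewrite modC_sub (_ : x - Psi (z, s) = (x - x0) - ((Psi (z, s) - x0 - q * toC (s - t)) + q * toC (s - t))); last by ring.
    apply: le_trans (modCB _ _) _; rewrite lerD2l; apply: le_trans (modCD _ _) _.
    rewrite modCM modC_toC; have : A * `|s - t| = modC q * `|s - t| + modC p / 2 * `|s - t| + `|s - t| by rewrite /A; ring.
    by rewrite -/q in h; lra.
  have h3 := cmin z; rewrite subrr modC0 in h3; have {}h3 := h3 (ltW rho0).
  have h4 : rho < d1 by lra.
  have := h1 h4; have : 0 < modC p * rho by rewrite mulr_gt0.
  lra.
have sol : Psi (c, s) = x.
  have cr : 0 < rho - modC (c - z) by rewrite subr_gt0.
  apply: (@interior_min_zero (fun w => Psi (w, s)) (fun w => dz Psi (w, s)) x c _ cr).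
  - exact: contP.
  - exact: (conformal_dz_neq0 (cf s sT) (lowd c cz)).
  - move=> w wc; apply: cmin; apply: le_trans (modC_tri _ c _) _; lra.
exists c; split => //; first exact: lowd.
  by apply: lt_le_trans cin _; lra.
have cd : modC (c - z) < d1 by lra.
have := lowb x s c sT cd sd; rewrite sol subrr modC0 add0r => h.
have -> : modC (c - z) = 2 / modC p * (modC p / 2 * modC (c - z)) by field; rewrite gt_eqF.
rewrite /K -[leRHS]mulrA ler_pM2l ?divr_gt0//; apply: le_trans h _.
have h5 : 0 <= A * modC (x - x0) by rewrite mulr_ge0// ltW.
rewrite (_ : (1 + A) * _ = modC (x - x0) + `|s - t| + A * modC (x - x0) + A * `|s - t|); last by ring.
lra.
Qed.

(* zeta is the displacement of the preimage, to first order. *)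
Lemma conjugated_frechet T (Psi U phi : C * R -> C) (z : C) (t : R) (A B D : C) :
  slab T (z, t) -> C1_slab T Psi -> (forall s, time T s -> conformal (fun z => Psi (z, s))) ->
  (forall p, slab T p -> U (Psi p, p.2) = phi p) ->
  (forall e : R, 0 < e -> exists2 d : R, 0 < d & forall w s, time T s ->
    modC (w - z) < d -> `|s - t| < d ->
    modC (phi (w, s) - phi (z, t) - A * toC (complex.Re (w - z)) - B * toC (complex.Im (w - z)) - D * toC (s - t))
      <= e * (modC (w - z) + `|s - t|)) ->
  let zeta x s := (x - Psi (z, t) - dt T Psi (z, t) * toC (s - t)) / dz Psi (z, t) in
  forall e : R, 0 < e -> exists2 d : R, 0 < d & forall x s, time T s ->
    modC (x - Psi (z, t)) < d -> `|s - t| < d ->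
    modC (U (x, s) - U (Psi (z, t), t) - (A * toC (complex.Re (zeta x s)) + B * toC (complex.Im (zeta x s)) + D * toC (s - t)))
      <= e * (modC (x - Psi (z, t)) + `|s - t|).
Proof.
move=> zt cP cf Uphi hphi zeta e e0; have [zl tT] := zt.
have [K K0 solv] := local_solvability zt cP cf.
have hol : holomorphic (fun z => Psi (z, t)) by have [] := cf t tT.
set p := dz Psi (z, t) in zeta *; set q := dt T Psi (z, t) in zeta *; set x0 := Psi (z, t) in zeta solv *.
have p0 : 0 < modC p by rewrite modC_gt0; exact: (conformal_dz_neq0 (cf t tT) zl).
have pn0 : p != 0 by rewrite -modC_gt0.
pose S := modC A + modC B + 1; have S0 : 0 < S by rewrite ltr_wpDl// addr_ge0 ?modC_ge0.
have e1 : 0 < e / 2 / (K + 1) by rewrite !divr_gt0//; lra.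
have e2 : 0 < e / 2 * modC p / S / (K + 1) by rewrite divr_gt0 ?divr_gt0 ?mulr_gt0 ?divr_gt0//; lra.
have [d1 d10 h1] := hphi _ e1; have [d2 d20 h2] := holomorphic_frechet zt cP hol e2.
pose r := Num.min d1 d2; have r0 : 0 < r by rewrite lt_min d10.
have [d3 d30 h3] := solv r r0.
exists (Num.min d3 r); first by rewrite lt_min d30.
move=> x s sT; rewrite !lt_min => /andP[x3 _] /andP[s3 /andP[s1 s2]].
have [w [wl]] := h3 x s sT x3 s3; rewrite lt_min => /andP[w1 w2] wx wK.
have k1 := h1 w s sT w1 s1; have k2 := h2 w s sT w2 s2.
rewrite wx -/p -/q -/x0 in k2.
have -> : U (x, s) = phi (w, s) by rewrite -wx; exact: (Uphi (w, s) (conj wl sT)).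
have -> : U (x0, t) = phi (z, t) by exact: (Uphi (z, t) zt).
set N := modC (x - x0) + `|s - t| in wK *.
have N0 : 0 <= N by rewrite addr_ge0 ?modC_ge0.
have sN : `|s - t| <= N by rewrite lerDr modC_ge0.
have wN : modC (w - z) + `|s - t| <= (K + 1) * N by rewrite mulrDl mul1r lerD.
(* The error of the first-order displacement: the remainder of [Psi] divided by [p]. The factor [S]
   pays for the coefficients [A] and [B]. *)
pose eta := (w - z) - zeta x s.
have etaE : eta = - ((x - x0 - p * (w - z) - q * toC (s - t)) / p) by rewrite /eta /zeta; field.
have eta_le : modC eta * S <= e / 2 * N.
  rewrite etaE modCN modCM modCV mulrAC ler_pdivrMr//.
  apply: le_trans (_ : e / 2 * modC p / S / (K + 1) * ((K + 1) * N) * S <= _).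
    rewrite ler_pM2r//; apply: le_trans k2 _; rewrite ler_pM2l//.
  by rewrite le_eqVlt; apply/orP; left; apply/eqP; field; rewrite !gt_eqF//; lra.
set Z := zeta x s.
rewrite (_ : phi (w, s) - phi (z, t) - (A * toC (complex.Re Z) + B * toC (complex.Im Z) + D * toC (s - t)) =
  (phi (w, s) - phi (z, t) - A * toC (complex.Re (w - z)) - B * toC (complex.Im (w - z)) - D * toC (s - t)) +
  (A * toC (complex.Re eta) + B * toC (complex.Im eta))); last first.
  have wE : w - z = eta + Z by rewrite /eta subrK.
  by rewrite wE reD imD !toCD; ring.
have t1 : modC (A * toC (complex.Re eta) + B * toC (complex.Im eta)) <= e / 2 * N.
  apply: le_trans eta_le; apply: le_trans (modCD _ _) _; rewrite !modCM !modC_toC.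
  have a1 : modC A * `|complex.Re eta| <= modC A * modC eta by rewrite ler_wpM2l ?modC_ge0 ?Re_le_modC.
  have a2 : modC B * `|complex.Im eta| <= modC B * modC eta by rewrite ler_wpM2l ?modC_ge0 ?Im_le_modC.
  have := modC_ge0 eta; rewrite /S !mulrDr mulr1 (mulrC _ (modC A)) (mulrC _ (modC B)); lra.
have t2 : e / 2 / (K + 1) * (modC (w - z) + `|s - t|) <= e / 2 * N.
  apply: le_trans (_ : e / 2 / (K + 1) * ((K + 1) * N) <= _); first by rewrite ler_pM2l.
  by rewrite mulrA mulfVK// gt_eqF//; lra.
apply: le_trans (modCD _ _) _; apply: le_trans (lerD k1 t1) _; lra.
Qed.

(** Along the three coordinate lines [zeta] is linear in the increment, with slopes [1 / Psi_z'],
    [i / Psi_z'] and [- Psi_t / Psi_z']; the last is the motion of the preimage of a fixed point of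
    the fluid. *)
Lemma conjugated_partials T (Psi U phi : C * R -> C) (z : C) (t : R) (A B D : C) :
  slab T (z, t) -> C1_slab T Psi -> (forall s, time T s -> conformal (fun z => Psi (z, s))) ->
  (forall p, slab T p -> U (Psi p, p.2) = phi p) ->
  (forall e : R, 0 < e -> exists2 d : R, 0 < d & forall w s, time T s ->
    modC (w - z) < d -> `|s - t| < d ->
    modC (phi (w, s) - phi (z, t) - A * toC (complex.Re (w - z)) - B * toC (complex.Im (w - z)) - D * toC (s - t))
      <= e * (modC (w - z) + `|s - t|)) ->
  let L (c : C) := A * toC (complex.Re (c / dz Psi (z, t))) + B * toC (complex.Im (c / dz Psi (z, t))) in
  [/\ is_partial T dirx U (Psi (z, t), t) (L 1), is_partial T diry U (Psi (z, t), t) (L iC) &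
      is_partial T dirt U (Psi (z, t), t) (L (- dt T Psi (z, t)) + D)].
Proof.
move=> zt cP cf Uphi hphi L.
have h := conjugated_frechet zt cP cf Uphi hphi; rewrite /= in h.
set x0 := Psi (z, t) in h *; set p := dz Psi (z, t) in h L *; set q := dt T Psi (z, t) in h *.
have Lr (c : C) (r : R) : A * toC (complex.Re (c * toC r / p)) + B * toC (complex.Im (c * toC r / p)) = L c * toC r.
  have -> : c * toC r / p = (c / p) * toC r by ring.
  by rewrite reM imM /= !mulr0 subr0 add0r !toCM /L; ring.
split; apply/is_rderivP => e e0; have [d d0 dd] := h e e0; exists d => //.
- move=> y _ yx; rewrite /slice /coordinate /=.
  have x0E : Complex (complex.Re x0) (complex.Im x0) = x0 by case: (x0).
  have E : Complex y (complex.Im x0) - x0 = 1 * toC (y - complex.Re x0).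
    by rewrite -{2}x0E; apply: complexP => /=; ring.
  have m : modC (Complex y (complex.Im x0) - x0) = `|y - complex.Re x0| by rewrite E mul1r modC_toC.
  have := dd (Complex y (complex.Im x0)) t zt.2; rewrite m subrr normr0 => /(_ yx d0).
  rewrite x0E E (_ : toC 0 = 0)// !mulr0 subr0 !addr0 Lr; exact.
- move=> y _ yx; rewrite /slice /coordinate /=.
  have x0E : Complex (complex.Re x0) (complex.Im x0) = x0 by case: (x0).
  have E : Complex (complex.Re x0) y - x0 = iC * toC (y - complex.Im x0).
    by rewrite -{2}x0E; apply: complexP => /=; ring.
  have m : modC (Complex (complex.Re x0) y - x0) = `|y - complex.Im x0|.
    by rewrite E modCM modC_iC mul1r modC_toC.
  have := dd (Complex (complex.Re x0) y) t zt.2; rewrite m subrr normr0 => /(_ yx d0).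
  rewrite x0E E (_ : toC 0 = 0)// !mulr0 subr0 !addr0 Lr; exact.
- move=> s sT st; rewrite /slice /coordinate /=.
  have := dd x0 s sT; rewrite subrr modC0 => /(_ d0 st).
  rewrite !add0r -mulNr Lr -mulrDl; exact.
Qed.

(** Pressure is differentiated as a complex-valued function; conjugating its gradient uses that the
    partial derivatives are real. *)
Lemma is_rderiv_real (g : R -> R) (x : R) (l : C) :
  is_rderiv setT (fun y => toC (g y)) x l -> Num.conj l = l.
Proof.
move=> /is_rderivP h; suff l0 : complex.Im l = 0.
  by rewrite conjE; apply: complexP; case: l l0 {h} => a b //= ->; rewrite oppr0.
apply/eqP; rewrite -normr_eq0; apply/eqP/le_anti; rewrite normr_ge0 andbT.
apply/ler_addgt0Pl => e e0; rewrite addr0; have [d d0 dd] := h e e0.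
have d20 : 0 < d / 2 by rewrite divr_gt0.
have := dd (x + d / 2) Logic.I; rewrite addrAC subrr add0r (gtr0_norm d20) => /(_ _).
have -> : d / 2 < d by lra.
move=> /(_ isT) /(le_trans (Im_le_modC _)).
rewrite -toCB imD imN imM /= mulr0 !add0r normrN normrM (gtr0_norm d20).
by rewrite ler_pM2r.
Qed.

End LocalInverse.

(** * The closed half plane as the closed fluid domain *)

Section ProperMap.
Context {R : realType}.
Local Notation C := R[i].
Local Notation lower := (@lower R).
Local Notation lowerbar := (@lowerbar R).
Implicit Types (psi p phi u : C -> C) (z x : C).

Lemma lower_lowerbar z : lower z -> lowerbar z.
Proof. exact: ltW. Qed.

Lemma approach_boundary z (d : R) : lowerbar z -> 0 < d ->
  lower (z - iC * toC (d / 2)) /\ modC (z - iC * toC (d / 2) - z) < d.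
Proof.
move=> zl d0; split.
  by rewrite /Defs.lower /= imD imN imM /=; have : complex.Im z <= 0 by []; lra.
by rewrite addrAC subrr add0r modCN modCM modC_iC mul1r modC_toC gtr0_norm ?divr_gt0//; lra.
Qed.

(* A large z is joined to the fixed point -iN by a vertical and a straight
   segment along which the derivative of psi is close to 1. *)
Lemma coercive psi p : (forall z, lowerbar z -> cont_at lowerbar psi z) ->
  (forall z, lower z -> cdiff psi z (p z)) -> tends_at_infinity p 1 ->
  forall B : R, exists N : R, forall z, lowerbar z -> modC (psi z) <= B -> modC z <= N.
Proof.
move=> cpsi dpsi pinf.
have q0 : 0 < 1 / 4 :> R by lra.
have [M0 hM0] := pinf _ q0; pose M := `|M0|.
have hM w : lower w -> M < modC w -> modC (p w - 1) <= 1 / 4.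
  move=> wl wM; apply: ltW; apply: hM0 => //; apply: le_lt_trans wM; exact: ler_norm.
have MM : 0 <= M by exact: normr_ge0.
clearbody M; clear hM0; pose N := M + 1; pose c : C := psi (- (iC * toC N)).
have N0 : 0 < N by rewrite /N; lra.
have low z : lower z -> M + N < modC z -> modC (psi z) >= 3 / 4 * modC z - (5 / 4 * N + modC c).
  move=> zl zM; have zI : complex.Im z < 0 by [].
  (* Down from [z] by [N]: as [|z| > M + N], this segment avoids the disc of radius [M]. *)
  have v : modC (psi (z + (- iC) * toC N) - psi (z + (- iC) * toC 0) - (- iC) * toC (N - 0)) <= 1 / 4 * (N - 0).
    apply: (@mean_value_inequality _ setT (fun s => psi (z + (- iC) * toC s))) => //; first exact: ltW.
    move=> s /andP[s0 sN]; exists (p (z + (- iC) * toC s) * - iC).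
      apply: (@cdiff_path _ setT psi (fun s => z + (- iC) * toC s)); first exact: is_rderiv_affine.
      by apply: dpsi; rewrite /Defs.lower /= imD imM imN /=; lra.
    rewrite (_ : _ - - iC = (p (z + (- iC) * toC s) - 1) * - iC); last by ring.
    rewrite modCM modCN modC_iC mulr1; apply: hM.
      by rewrite /Defs.lower /= imD imM imN /=; lra.
    have := modC_triB z (iC * toC s); rewrite modCM modC_iC mul1r modC_toC (ger0_norm s0) mulNr; lra.
  (* From [- i N] in the direction [z]: this segment stays at or below height [- N < - M]. The error
     [|z| / 4] leaves the [3 / 4 |z|] of the lower bound. *)
  have h : modC (psi (- (iC * toC N) + z * toC 1) - psi (- (iC * toC N) + z * toC 0) - z * toC (1 - 0)) <= modC z / 4 * (1 - 0).
    apply: (@mean_value_inequality _ setT (fun s => psi (- (iC * toC N) + z * toC s))) => //.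
    move=> s /andP[s0 s1]; exists (p (- (iC * toC N) + z * toC s) * z).
      apply: (@cdiff_path _ setT psi (fun s => - (iC * toC N) + z * toC s)); first exact: is_rderiv_affine.
      apply: dpsi; rewrite /Defs.lower /= imD imN !imM /=.
      have : 0 <= s * - complex.Im z by rewrite mulr_ge0// oppr_ge0 ltW.
      lra.
    rewrite (_ : _ - z = (p (- (iC * toC N) + z * toC s) - 1) * z); last by ring.
    rewrite modCM mulrC ler_wpM2l ?modC_ge0// -[leRHS]div1r; apply: hM.
      rewrite /Defs.lower /= imD imN !imM /=.
      have : 0 <= s * - complex.Im z by rewrite mulr_ge0// oppr_ge0 ltW.
      lra.
    apply: lt_le_trans (Im_le_modC _); rewrite imD imN !imM /=.
    have : 0 <= s * - complex.Im z by rewrite mulr_ge0// oppr_ge0 ltW.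
    rewrite -normrN => sz; apply: lt_le_trans (ler_norm _); rewrite /N; lra.
  rewrite toC0 mulr0 addr0 subr0 mulNr opprK in v.
  rewrite toC0 subr0 toC1 mulr0 addr0 !mulr1 -/c in h.
  rewrite (addrC (- _) z) in h.
  have E : z - iC * toC N - z = - (iC * toC N) by ring.
  have k1 := modC_tri z (psi (z - iC * toC N) - c) 0; rewrite !subr0 in k1.
  have k2 := modCB (psi (z - iC * toC N)) c.
  have k3 : modC (psi (z - iC * toC N)) <= 1 / 4 * N + N + modC (psi z).
    rewrite (_ : psi (z - iC * toC N) = (psi (z - iC * toC N) - psi z + iC * toC N) - iC * toC N + psi z); last by ring.
    apply: le_trans (modCD _ _) _; rewrite lerD2r; apply: le_trans (modCB _ _) _.
    by rewrite modCM modC_iC mul1r modC_toC (gtr0_norm N0) lerD2r.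
  rewrite modC_sub in h; lra.
move=> B; exists (Num.max (M + N) (4 / 3 * (B + 1 + (5 / 4 * N + modC c))) + 1) => z zl zB.
have [d d0 dd] := cpsi z zl 1 ltr01.
(* Real points are covered by continuity from an interior point at distance less than 1, where [psi]
   changes by less than 1; these are the two units added in the witness. *)
pose e := Num.min d 1; have e0 : 0 < e by rewrite lt_min d0 ltr01.
have [wl wz] := approach_boundary zl e0; set w := z - _ in wl wz.
have [wd w1] : modC (w - z) < d /\ modC (w - z) < 1.
  by move: wz; rewrite lt_min => /andP[].
have k1 := dd w (lower_lowerbar wl) wd.
have k2 := modC_triB (psi w) (psi z).
have k3 : modC z <= modC w + 1.
  by have := modC_triB z w; rewrite modC_sub; lra.
have [wM|wM] := lerP (modC w) (M + N).
  by apply: le_trans k3 _; rewrite lerD2r le_max wM.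
apply: le_trans k3 _; rewrite lerD2r le_max; apply/orP; right.
have := low w wl wM; lra.
Qed.

Lemma lowerbar_disc_compact (N : R) : compact [set z | lowerbar z /\ modC z <= N].
Proof.
apply: (@compact_bounded_closed R _ N) => [|z []]; last by [].
apply: closedI; first exact: closed_lowerbar.
have <- : [set z : C | modC (z - 0) <= N] = (fun z => modC z <= N).
  by apply/funext => z; rewrite /= subr0.
exact: closed_disc.
Qed.

Lemma closest_point psi x (S : set C) : compact S -> S !=set0 ->
  (forall z, S z -> cont_at S psi z) ->
  exists2 c, S c & forall z, S z -> modC (psi c - x) <= modC (psi z - x).
Proof.
move=> cS S0 cpsi.
have [|c Sc cmax] := @compact_max R S (fun w => - modC (psi w - x)) cS S0.
  move=> w Sw e e0.
  have cw : cont_at S (fun w => psi w - x) w by apply: cont_atB; [exact: cpsi|exact: cont_at_cst].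
  have [d d0 dd] := modC_cont cw e0; exists d => // w' Sw' ww'.
  by have := dd w' Sw' ww'; rewrite -opprD normrN.
by exists c => // z Sz; rewrite -lerN2; exact: cmax.
Qed.

Lemma closed_outside (c : C) (r : R) : closed [set z | r <= modC (z - c)].
Proof.
rewrite (_ : [set z | r <= modC (z - c)] = ~` [set z | modC (z - c) < r]); last first.
  by apply/seteqP; split => z /=; rewrite leNgt => /negP.
apply: open_closedC; rewrite openE => z /= zr; apply/nbhs_modC.
exists (r - modC (z - c)); first by rewrite subr_gt0.
move=> w wz /=; have := modC_tri w z c; lra.
Qed.

(** Coercivity confines the candidates to a compact set, and by injectivity the distance to [psi z0]
    has a positive minimum over those at distance at least [r] from [z0]. *)
Lemma inverse_cont psi z0 (r : R) : (forall z, lowerbar z -> cont_at lowerbar psi z) ->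
  {in lowerbar &, injective psi} ->
  (forall B : R, exists N : R, forall z, lowerbar z -> modC (psi z) <= B -> modC z <= N) ->
  lowerbar z0 -> 0 < r ->
  exists2 d : R, 0 < d & forall z, lowerbar z -> modC (psi z - psi z0) < d -> modC (z - z0) < r.
Proof.
move=> cpsi inj coer z0l r0; have [N hN] := coer (modC (psi z0) + 1).
pose K := [set z | lowerbar z /\ modC z <= N] `&` [set z | r <= modC (z - z0)].
have cK : compact K.
  apply: (subclosed_compact _ (@lowerbar_disc_compact N)) => [|z []//].
  apply: closedI; last exact: closed_outside.
  exact: (compact_closed (@norm_hausdorff _ _) (@lowerbar_disc_compact N)).
have bound z : lowerbar z -> modC (psi z - psi z0) < 1 -> modC z <= N.
  by move=> zl z1; apply: hN => //; have := modC_triB (psi z) (psi z0); lra.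
have [K0|K0] := pselect (K !=set0); last first.
  exists 1 => // z zl z1; rewrite ltNge; apply/negP => zr; apply: K0; exists z; split => //.
  by split => //; exact: bound.
have [|c [[cl cN] cr] cmin] := closest_point (psi z0) cK K0 (psi := psi).
  move=> z [[zl _] _] e e0; have [d d0 dd] := cpsi z zl e e0.
  by exists d => // w [[wl _] _]; exact: dd.
have m0 : 0 < modC (psi c - psi z0).
  rewrite modC_gt0 subr_eq0; apply/eqP => E.
  have cE : c = z0 by apply: inj E; rewrite inE.
  by move: cr; rewrite /= cE subrr modC0; lra.
exists (Num.min 1 (modC (psi c - psi z0))); first by rewrite lt_min ltr01.
move=> z zl; rewrite lt_min => /andP[z1 zm]; rewrite ltNge; apply/negP => zr.
have Kz : K z by split => //; split => //; exact: bound.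
by have := cmin z Kz; lra.
Qed.

(** Values close to [x] have preimages in one compact half disc, so a closest value is attained
    there, and its distance to [x] can only be 0. *)
Lemma closure_image psi : (forall z, lowerbar z -> cont_at lowerbar psi z) ->
  (forall B : R, exists N : R, forall z, lowerbar z -> modC (psi z) <= B -> modC z <= N) ->
  closure (psi @` lower) = psi @` lowerbar.
Proof.
move=> cpsi coer; apply/seteqP; split => x; last first.
  move=> [z zl <-] A /nbhs_modC[e e0 eA]; have [d d0 dd] := cpsi z zl e e0.
  have [wl wz] := approach_boundary zl d0; set w := z - _ in wl wz.
  exists (psi w); split; first by exists w.
  by apply: eA; apply: dd => //; exact: lower_lowerbar.
move=> xcl; have [N hN] := coer (modC x + 1).
have near (r : R) : 0 < r -> r <= 1 -> exists2 z, lowerbar z /\ modC z <= N & modC (psi z - x) < r.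
  move=> r0 r1; have /xcl[_ [[z zl <-] zr]] : nbhs x [set w | modC (w - x) < r].
    by apply/nbhs_modC; exists r.
  exists z => //; split; first exact: lower_lowerbar.
  apply: hN; first exact: lower_lowerbar.
  have := modC_triB (psi z) x; rewrite /= in zr; lra.
have [z1 K1 _] := near 1 ltr01 (lexx _).
have [||c [cl _] cmin] := closest_point x (@lowerbar_disc_compact N) _ (psi := psi).
- by exists z1.
- move=> z [zl _] e e0; have [d d0 dd] := cpsi z zl e e0.
  by exists d => // w [wl _]; exact: dd.
exists c => //; apply/eqP; rewrite -subr_eq0 -modC_eq0; apply/negPn/negP => m0.
have {}m0 : 0 < modC (psi c - x) by rewrite lt_def m0 modC_ge0.
have [||z Kz zm] := near (Num.min 1 (modC (psi c - x))).
- by rewrite lt_min ltr01.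
- by rewrite ge_min lexx.
have := cmin z Kz; move: zm; rewrite lt_min => /andP[_]; lra.
Qed.

(** [psi] being a homeomorphism onto its image, a function extends to the closed domain once its
    composition with [psi] extends to the closed half plane. *)
Lemma extends_image psi phi u : (forall z, lowerbar z -> cont_at lowerbar psi z) ->
  {in lowerbar &, injective psi} ->
  (forall B : R, exists N : R, forall z, lowerbar z -> modC (psi z) <= B -> modC z <= N) ->
  (forall z, lowerbar z -> cont_at lowerbar phi z) ->
  (forall z, lower z -> u (psi z) = phi z) ->
  extends (psi @` lower) (closure (psi @` lower)) u /\
  forall z, lowerbar z -> ext (psi @` lower) u (psi z) = phi z.
Proof.
move=> cpsi inj coer cphi uphi.
have lim z : lowerbar z -> forall e : R, 0 < e -> exists2 d : R, 0 < d &
    forall w, lowerbar w -> modC (psi w - psi z) < d -> modC (phi w - phi z) < e.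
  move=> zl e e0; have [r r0 hr] := cphi z zl e e0.
  have [d d0 dd] := inverse_cont cpsi inj coer zl r0.
  by exists d => // w wl wz; apply: hr => //; exact: dd.
(* The default 0 is taken only off the image of the closed half plane. *)
pose inv x := xget (0 : C) [set z | lowerbar z /\ psi z = x].
have invK z : lowerbar z -> inv (psi z) = z.
  move=> zl; rewrite /inv; case: xgetP => [w _ [wl E]|/(_ z)[]//].
  by apply: inj => //; rewrite inE.
split.
  exists (phi \o inv); last first.
    by move=> x; rewrite inE => -[z zl <-]; rewrite /= invK ?uphi//; exact: lower_lowerbar.
  rewrite closure_image//; apply/within_continuousP => _ [z zl <-] e e0.
  have [d d0 dd] := lim z zl e e0; exists d => // _ [w wl <-] wz.
  by rewrite /= !invK//; exact: dd.
move=> z zl; apply: ext_lim.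
  apply: Build_ProperFilter_ex => A; rewrite /within /= => hA.
  have : closure (psi @` lower) (psi z) by rewrite closure_image//; exists z.
  by move=> /(_ _ hA)[x [xl xA]]; exists x; exact: xA.
apply/cvg_modC => e e0; have [d d0 dd] := lim z zl e e0.
apply/nbhs_modC; exists d => // y xz [w wl wE] /=.
by move: xz; rewrite -wE uphi// => xz; apply: dd => //; exact: lower_lowerbar.
Qed.

(** Continuity of [b] is automatic: its value at a nearby real point is itself a limit of interior
    values, all close to the value at [z]. *)
Lemma cont_at_glue phi (b : R -> C) : (forall z, lower z -> cont_at lower phi z) ->
  (forall a, tends_lower phi a (b a)) ->
  forall z, lowerbar z ->
    cont_at lowerbar (fun w => if complex.Im w < 0 then phi w else b (complex.Re w)) z.
Proof.
move=> cphi hb z zl e e0; have e20 : 0 < e / 2 by rewrite divr_gt0.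
have zI : complex.Im z <= 0 by [].
have [zn|zn] := ltrP (complex.Im z) 0.
  have [d d0 dd] := cphi z zn e e0.
  exists (Num.min d (- complex.Im z)); first by rewrite lt_min d0 oppr_gt0.
  move=> w _; rewrite lt_min => /andP[wd wz].
  have wl : complex.Im w < 0.
    by have := Im_le_modC (w - z); rewrite imD imN => /(le_trans (ler_norm _)); lra.
  by rewrite wl; exact: dd.
have z0 : complex.Im z = 0 by apply/le_anti; rewrite zI zn.
have zE : z = toC (complex.Re z) by apply: complexP.
have [d d0 dd] := hb (complex.Re z) _ e20.
exists (d / 2); first by rewrite divr_gt0.
have d20 : 0 < d / 2 by rewrite divr_gt0.
move=> w wl wz; have [wn|wn] := ltrP (complex.Im w) 0.
  apply: lt_trans (_ : e / 2 < _); last by lra.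
  by apply: dd => //; rewrite -zE; lra.
have wE : w = toC (complex.Re w).
  by apply: complexP => //=; apply/le_anti; rewrite wn andbT; exact: wl.
have [d' d'0 dd'] := hb (complex.Re w) _ e20.
have r0 : 0 < Num.min (d / 2) d' by rewrite lt_min d20.
have [ul uw] := approach_boundary wl r0; set u := w - _ in ul uw.
have h1 : modC (phi u - b (complex.Re w)) < e / 2.
  by apply: dd' => //; rewrite -wE; move: uw; rewrite lt_min => /andP[].
have h2 : modC (phi u - b (complex.Re z)) < e / 2.
  apply: dd => //; rewrite -zE; have := modC_tri u w z; move: uw; rewrite lt_min => /andP[]; lra.
rewrite modC_sub in h1; have := modC_tri (b (complex.Re w)) (phi u) (b (complex.Re z)); lra.
Qed.

End ProperMap.

(** * Velocity and pressure on the fluid domain *)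

Section EulerSolution.
Context {R : realType}.
Local Notation C := R[i].
Local Notation lower := (@lower R).
Local Notation lowerbar := (@lowerbar R).
Implicit Types (F Psi : C * R -> C) (P : C * R -> R) (T t : R).

(* If a boundary value were also taken inside, nearby values would be taken both
   near the boundary and near the interior point. *)
Lemma closed_half_plane_injective T Psi t : time T t -> C1_slab T Psi ->
  (forall s, time T s -> conformal (fun z => Psi (z, s))) ->
  (forall z, lowerbar z -> cont_at lowerbar (fun z => Psi (z, t)) z) ->
  injective (fun a => Psi (toC a, t)) ->
  {in lowerbar &, injective (fun z => Psi (z, t))}.
Proof.
move=> tT cP cf cpsi ainj; have [_ linj _] := cf t tT.
have mixed z a : lower z -> lowerbar a -> complex.Im a = 0 -> Psi (a, t) <> Psi (z, t).
  move=> zl al a0 E; have [K _ solv] := local_solvability (conj zl tT : slab T (z, t)) cP cf.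
  (* Half the depth of [z] separates points near [z] from points near the real point [a], so the two
     preimages [w] and [u] of one value cannot coincide. *)
  have y0 : 0 < - complex.Im z / 2 by rewrite divr_gt0// oppr_gt0.
  have [d d0 hd] := solv _ y0.
  have [d' d'0 hd'] := cpsi a al d d0.
  have r0 : 0 < Num.min d' (- complex.Im z / 2) by rewrite lt_min d'0.
  have [ul] := approach_boundary al r0; set u := a - _ in ul *.
  rewrite lt_min => /andP[ud uy].
  have uP : modC (Psi (u, t) - Psi (z, t)) < d.
    by rewrite -E; apply: hd' => //; exact: lower_lowerbar.
  have [w [wl wz wu _]] : exists w, [/\ lower w, modC (w - z) < - complex.Im z / 2, Psi (w, t) = Psi (u, t) & True].
    have [|w [wl wz wu _]] := hd (Psi (u, t)) t tT uP; first by rewrite subrr normr0.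
    by exists w.
  have wE : w = u by apply: linj wu; rewrite inE.
  rewrite wE in wz; have := Im_le_modC (u - z); have := Im_le_modC (u - a).
  rewrite !imD !imN a0 subr0 -normrN => /(le_trans (ler_norm _)) h1 /(le_trans (ler_norm _)).
  lra.
move=> z w; rewrite !inE => zl wl E.
have [zI wI] : complex.Im z <= 0 /\ complex.Im w <= 0 by [].
have [zn|zn] := ltrP (complex.Im z) 0; have [wn|wn] := ltrP (complex.Im w) 0.
- by apply: linj E; rewrite inE.
- have w0 : complex.Im w = 0 by apply/le_anti; rewrite wI wn.
  by case: (mixed z w zn wl w0); rewrite E.
- have z0 : complex.Im z = 0 by apply/le_anti; rewrite zI zn.
  by case: (mixed w z wn zl z0); rewrite E.
have zE : z = toC (complex.Re z) by apply: complexP => //=; apply/le_anti; rewrite zI zn.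
have wE : w = toC (complex.Re w) by apply: complexP => //=; apply/le_anti; rewrite wI wn.
by rewrite zE wE; congr toC; apply: ainj; rewrite -zE -wE.
Qed.

Lemma conj_toC (a : R) : Num.conj (toC a : C) = toC a.
Proof. by rewrite conjE; apply: complexP => /=; rewrite ?oppr0. Qed.

Lemma conj_iC : Num.conj (iC : C) = - iC.
Proof. by rewrite conjE; apply: complexP => /=; rewrite ?oppr0. Qed.

(** Conjugation is only real-linear, so the expansion takes the form with separate coefficients for
    real and imaginary increments that [conjugated_partials] expects. *)
Lemma conj_mulRI (f w : C) : Num.conj (f * w) =
  Num.conj f * toC (complex.Re w) + - iC * Num.conj f * toC (complex.Im w).
Proof.
rewrite rmorphM /= [in LHS](complexRI w) rmorphD rmorphM /= !conj_toC conj_iC; ring.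
Qed.

Lemma is_partial_has T d (f : C * R -> C) p (l : C) : is_partial T d f p l -> has_partial T d f p.
Proof. by move=> h; apply: cvgP h. Qed.

(** The conjugate of [v] is [F] composed with the inverse of [Psi], holomorphic in space with
    derivative [g]; its time derivative picks up [- Psi_t g] from the moving preimage. *)
Lemma velocity_partials T F Psi (v : C * R -> C) z t :
  0 < T -> slab T (z, t) -> C1_slab T Psi -> C1_slab T F ->
  (forall s, time T s -> conformal (fun z => Psi (z, s))) ->
  (forall s, time T s -> holomorphic (fun z => F (z, s))) ->
  (forall p, slab T p -> Num.conj (v (Psi p, p.2)) = F p) ->
  let g := dz F (z, t) / dz Psi (z, t) in
  [/\ forall d, has_partial T d v (Psi (z, t), t),
      dx v (Psi (z, t), t) = Num.conj g, dy v (Psi (z, t), t) = - iC * Num.conj g &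
      dt T v (Psi (z, t), t) = Num.conj (dt T F (z, t) - dt T Psi (z, t) * g)].
Proof.
move=> T0 zt cP cF cf hF hv g; have tT := zt.2.
have := @conjugated_partials R T Psi v (fun p => Num.conj (F p)) z t
  (Num.conj (dz F (z, t))) (- iC * Num.conj (dz F (z, t))) (Num.conj (dt T F (z, t))) zt cP cf.
have LE (c : C) : Num.conj (dz F (z, t)) * toC (complex.Re (c / dz Psi (z, t))) +
    - iC * Num.conj (dz F (z, t)) * toC (complex.Im (c / dz Psi (z, t))) = Num.conj (c * g).
  rewrite (_ : c * g = dz F (z, t) * (c / dz Psi (z, t))); last by rewrite /g; ring.
  by rewrite conj_mulRI.
rewrite /= !LE mul1r; case => [p pT|e e0|hx hy ht].
- by rewrite -(hv p pT) conjCK.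
- have [d d0 dd] := holomorphic_frechet zt cF (hF t tT) e0.
  exists d => // w s sT wz st; have := dd w s sT wz st; apply: le_trans.
  rewrite -[leRHS]modC_conj.
  rewrite (_ : Num.conj (_ - _ - _ - _) = Num.conj (F (w, s)) - Num.conj (F (z, t)) -
    Num.conj (dz F (z, t) * (w - z)) - Num.conj (dt T F (z, t) * toC (s - t))); last by rewrite -!rmorphB.
  rewrite conj_mulRI (rmorphM _ (dt T F (z, t))) /= conj_toC.
  by rewrite le_eqVlt; apply/orP; left; apply/eqP; congr modC; ring.
split.
- by case; [exact: is_partial_has hx|exact: is_partial_has hy|exact: is_partial_has ht].
- exact: (is_rderiv_val (proper_setT _) hx).
- rewrite (_ : - iC * Num.conj g = Num.conj (iC * g)); last by rewrite (rmorphM _ iC) /= conj_iC.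
  exact: (is_rderiv_val (proper_setT _) hy).
have := is_rderiv_val (proper_time T0 tT) ht; rewrite /dt /partial /= => ->.
by rewrite rmorphB /= mulNr rmorphN /= addrC.
Qed.

(** The gradient of a real function transported by a conformal map is divided by the conjugate of
    [Psi_z']; conjugation brings in [cgrad]. *)
Lemma pressure_partials T P Psi (Pr : C * R -> R) z t :
  slab T (z, t) -> C1_slab T Psi -> C1_slab T (complexify P) ->
  (forall s, time T s -> conformal (fun z => Psi (z, s))) ->
  (forall p, slab T p -> Pr (Psi p, p.2) = P p) ->
  [/\ has_partial T dirx (complexify Pr) (Psi (z, t), t),
      has_partial T diry (complexify Pr) (Psi (z, t), t) &
      rgrad Pr (Psi (z, t), t) = Num.conj (recip_dz Psi (z, t) * cgrad P (z, t))].
Proof.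
move=> zt cP cQ cf hP.
set A := dx (complexify P) (z, t); set B := dy (complexify P) (z, t).
have Ar : Num.conj A = A.
  exact: (@is_rderiv_real R (fun s => P (Complex s (complex.Im z), t)) (complex.Re z) A ((cQ dirx).1 (z, t) zt)).
have Br : Num.conj B = B.
  exact: (@is_rderiv_real R (fun s => P (Complex (complex.Re z) s, t)) (complex.Im z) B ((cQ diry).1 (z, t) zt)).
have := @conjugated_partials R T Psi (complexify Pr) (complexify P) z t A B
  (dt T (complexify P) (z, t)) zt cP cf.
case => [p pT|e e0|hx hy _].
- by rewrite /complexify hP.
- exact: C1_slab_frechet zt cQ e e0.
split; [exact: is_partial_has hx|exact: is_partial_has hy|].
have Ex : dx (complexify Pr) (Psi (z, t), t) = _ := is_rderiv_val (proper_setT _) hx.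
have Ey : dy (complexify Pr) (Psi (z, t), t) = _ := is_rderiv_val (proper_setT _) hy.
rewrite /rgrad Ex Ey.
rewrite /cgrad -/A -/B /recip_dz mul1r; move: (dz Psi (z, t))^-1 Ar Br => w Ar Br.
clearbody A B.
rewrite rmorphM /= rmorphB rmorphM /= Ar Br conj_iC [in RHS](complexRI w) rmorphD rmorphM /= !conj_toC conj_iC.
rewrite !reM !imM /= !mul0r !mul1r sub0r add0r toCN.
by ring: (@iCi R).
Qed.

End EulerSolution.

Theorem corollary3p5 (R : realType) (T0 : R)
    (C c1 c2 : R -> R) (C0 : R -> R -> R)
    (F Psi : R[i] * R -> R[i]) (P : R[i] * R -> R)
    (v : R[i] * R -> R[i]) (Pr : R[i] * R -> R) :
  0 < T0 ->
  wu_solution T0 C c1 c2 C0 F Psi P ->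
  (forall t, time T0 t -> jordan_interface (fun a => Psi (toC a, t))) ->
  (forall p, slab T0 p ->
     (v (Psi p, p.2))^* = F p /\ Pr (Psi p, p.2) = P p) ->
  forall t, time T0 t ->
  let Om := fluid_domain Psi t in
  let V := ext Om (fun x => v (x, t)) in
  let Vt := ext Om (fun x => dt T0 v (x, t)) in
  let Vx := ext Om (fun x => dx v (x, t)) in
  let Vy := ext Om (fun x => dy v (x, t)) in
  let G := ext Om (fun x => rgrad Pr (x, t)) in
  let acceleration x :=
    Vt x + (toC (complex.Re (V x)) * Vx x + toC (complex.Im (V x)) * Vy x) in
  [/\ forall x, Om x ->
        [/\ forall d, has_partial T0 d v (x, t),
            has_partial T0 dirx (complexify Pr) (x, t) &
            has_partial T0 diry (complexify Pr) (x, t)],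
      [/\ extends Om (closure Om) (fun x => v (x, t)),
          extends Om (closure Om) (fun x => dt T0 v (x, t)),
          extends Om (closure Om) (fun x => dx v (x, t)),
          extends Om (closure Om) (fun x => dy v (x, t)) &
          extends Om (closure Om) (fun x => rgrad Pr (x, t))],
      forall x, closure Om x -> acceleration x = - iC - G x,
      forall a, singular T0 Psi (a, t) ->
        [/\ Vx (Psi (toC a, t)) = 0, Vy (Psi (toC a, t)) = 0
          & G (Psi (toC a, t)) = 0] &
      forall a, singular T0 Psi (a, t) -> acceleration (Psi (toC a, t)) = - iC].
Proof.
move=> T0p wu jor hv t tT Om V Vt Vx Vy G acceleration.
have [[_ ww wr _] _] := wu.
have cf := ww_conformal ww; have hF := ww_holomorphic ww.
have cP := wr_Psi wr; have cF := wr_F wr; have cQ := wr_P wr.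
pose psi (z : R[i]) := Psi (z, t).
have cpsi z : lowerbar z -> cont_at lowerbar psi z.
  by move=> zl; apply: (cont_at_slice tT zl); apply/within_slab_continuousP; exact: wr_Psi_cont wr.
have cFb z : lowerbar z -> cont_at lowerbar (fun z => F (z, t)) z.
  by move=> zl; apply: (cont_at_slice tT zl); apply/within_slab_continuousP; exact: wr_F_cont wr.
have [_ _ pinf _] := ww_infty ww tT.
have coer : forall B : R, exists N : R, forall z, lowerbar z -> modC (psi z) <= B -> modC z <= N.
  have [hol _ _] := cf t tT.
  by apply: (coercive cpsi _ pinf) => z zl; have [] := holomorphic_cdiff hol zl.
have inj : {in lowerbar &, injective psi}.
  by apply: (closed_half_plane_injective tT cP cf cpsi); have [] := jor t tT.
pose g (z : R[i]) := dz F (z, t) / dz Psi (z, t).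
pose q (z : R[i]) := recip_dz Psi (z, t) * cgrad P (z, t).
have /choice[lg hlg] : forall a, exists l, tends_lower g a l /\ (singular T0 Psi (a, t) -> l = 0).
  by move=> a; have [l l1 l2] := velocity_gradient_limit a T0p tT ww wr; exists l.
have /choice[lq hlq] : forall a, exists l, tends_lower q a l /\ (singular T0 Psi (a, t) -> l = 0).
  by move=> a; have [l l1 l2] := pressure_gradient_limit a T0p tT wu; exists l.
have cslice d f z : C1_slab T0 f -> lower z -> cont_at lower (fun z => partial T0 d f (z, t)) z.
  move=> cf' zl; apply: (cont_at_slice tT zl); apply/within_slab_continuousP.
  by have [_] := cf' d.
have p0 z : lower z -> dz Psi (z, t) != 0 by exact: (conformal_dz_neq0 (cf t tT)).
have [psihol _ _] := cf t tT.
have cp z : lower z -> cont_at lower (fun z => dz Psi (z, t)) z.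
  by move=> zl; have [] := C1_slab_holo tT psihol cP zl.
have cg z : lower z -> cont_at lower g z.
  move=> zl; apply: cont_atM; last by apply: cont_atV; [exact: p0|exact: cp].
  by have [] := C1_slab_holo tT (hF t tT) cF zl.
have cq z : lower z -> cont_at lower q z.
  move=> zl; apply: cont_atM; first by apply: cont_atV; [exact: p0|exact: cp].
  apply: cont_atB; first exact: (cslice dirx).
  by apply: cont_atM; [exact: cont_at_cst|exact: (cslice diry)].
(* Interior values and boundary limits joined into one function on the closed half plane, from which
   the extended gradients are read off. *)
pose gb z := if complex.Im z < 0 then g z else lg (complex.Re z).
pose qb z := if complex.Im z < 0 then q z else lq (complex.Re z).
have cgb z : lowerbar z -> cont_at lowerbar gb z.
  by apply: cont_at_glue => // a; have [] := hlg a.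
have cqb z : lowerbar z -> cont_at lowerbar qb z.
  by apply: cont_at_glue => // a; have [] := hlq a.
have gbE z : lower z -> gb z = g z by move=> zl; rewrite /gb ifT.
have qbE z : lower z -> qb z = q z by move=> zl; rewrite /qb ifT.
have vE p : slab T0 p -> Num.conj (v (Psi p, p.2)) = F p by move=> /hv[].
have PrE p : slab T0 p -> Pr (Psi p, p.2) = P p by move=> /hv[].
have vp z (zl : lower z) := velocity_partials T0p (conj zl tT : slab T0 (z, t)) cP cF cf hF vE.
have prp z (zl : lower z) := pressure_partials (conj zl tT : slab T0 (z, t)) cP cQ cf PrE.
have extn phi u := @extends_image R psi phi u cpsi inj coer.
have [xV eV] : extends Om (closure Om) (fun x => v (x, t)) /\
    forall z, lowerbar z -> V (psi z) = Num.conj (F (z, t)).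
  apply: extn => z zl; first by apply: cont_at_conj; exact: cFb.
  by rewrite -(vE (z, t) (conj zl tT)) conjCK.
have [xVx eVx] : extends Om (closure Om) (fun x => dx v (x, t)) /\
    forall z, lowerbar z -> Vx (psi z) = Num.conj (gb z).
  apply: extn => z zl; first by apply: cont_at_conj; exact: cgb.
  by rewrite gbE//; have [] := vp z zl.
have [xVy eVy] : extends Om (closure Om) (fun x => dy v (x, t)) /\
    forall z, lowerbar z -> Vy (psi z) = - iC * Num.conj (gb z).
  apply: extn => z zl; first by apply: cont_atM; [exact: cont_at_cst|apply: cont_at_conj; exact: cgb].
  by rewrite gbE//; have [] := vp z zl.
(* The time derivative has no separate boundary analysis: the evolution equation expresses it
   through [gb], [qb] and [F]. *)
have [xVt eVt] : extends Om (closure Om) (fun x => dt T0 v (x, t)) /\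
    forall z, lowerbar z -> Vt (psi z) = Num.conj (iC - qb z - Num.conj (F (z, t)) * gb z).
  apply: extn => z zl.
    apply: cont_at_conj; apply: cont_atB; first by apply: cont_atB; [exact: cont_at_cst|exact: cqb].
    by apply: cont_atM; [apply: cont_at_conj; exact: cFb|exact: cgb].
  have [_ _ _ ->] := vp z zl; rewrite gbE// qbE//; congr Num.conj.
  have E := ww_equation ww (conj zl tT : slab T0 (z, t)); rewrite -/(g z) -/(q z) in E.
  have rearrange (a b c d : R[i]) : a + c = - d + b -> a = b - d - c.
    by move=> ac; rewrite -(addrK c a) ac; ring.
  exact: rearrange E.
have [xG eG] : extends Om (closure Om) (fun x => rgrad Pr (x, t)) /\
    forall z, lowerbar z -> G (psi z) = Num.conj (qb z).
  apply: extn => z zl; first by apply: cont_at_conj; exact: cqb.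
  by rewrite qbE//; have [] := prp z zl.
(* As [Vy = - i Vx], the convection term is [conj(V) Vx = F conj(gb)]; it cancels the same term in
   [Vt], on the boundary as well as inside. *)
have accE z : lowerbar z -> acceleration (psi z) = - iC - Num.conj (qb z).
  move=> zl; rewrite /acceleration eVt// eVx// eVy// eV//.
  set f := F (z, t); set a := gb z; set b := qb z.
  rewrite !rmorphB rmorphM /= conjCK conj_iC.
  have -> : f * Num.conj a = (toC (complex.Re f) + iC * toC (complex.Im f)) * Num.conj a by rewrite -complexRI.
  have -> : complex.Re (Num.conj f) = complex.Re f by rewrite conjE; case: (f).
  have -> : complex.Im (Num.conj f) = - complex.Im f by rewrite conjE; case: (f).
  by rewrite toCN; ring.
have al (a : R) : lowerbar (toC a : R[i]) by rewrite /lowerbar /=.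
have sing a : singular T0 Psi (a, t) -> gb (toC a) = 0 /\ qb (toC a) = 0.
  by move=> s; rewrite /gb /qb /= ltxx; split; [exact: (hlg a).2|exact: (hlq a).2].
split.
- move=> _ [z zl <-]; have [h1 _ _ _] := vp z zl; have [h2 h3 _] := prp z zl; split.
  + exact: h1.
  + exact: h2.
  + exact: h3.
- by split.
- by move=> x; rewrite /Om /fluid_domain (closure_image cpsi coer) => -[z zl <-]; rewrite -/(psi z) accE// eG.
- move=> a /sing[g0 q0]; rewrite -/(psi (toC a)) eVx// eVy// eG// g0 q0.
  by rewrite rmorph0 mulr0.
- by move=> a /sing[g0 q0]; rewrite -/(psi (toC a)) accE// q0 rmorph0 subr0.
Qed.
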